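(* Suppose $V\sim N(\mu,\gamma^2)$ with $\gamma>0$, and $c=\kappa\frac{\gamma}{\sigma}$ for some $\kappa>0$. Let $\Lambda(\kappa)=\frac{\sqrt{\kappa^2+4}-\kappa}{2}$ and $\lambda^*=\frac{-c+\sqrt{c^2+4\gamma^2/\sigma^2}}{2}=\Lambda(\kappa)\frac{\gamma}{\sigma}$. Then $(H^*,\theta^* )$ is an equilibrium, where $H^*(t,y)=h^*(y)=\lambda^*y+\mu$ and $$d\theta^*_t=\Lambda(\kappa)\sigma\,\frac{\frac{V-\mu}{\gamma}-\frac{\Lambda(\kappa)Y^*_t}{\sigma}}{1-t\Lambda^2(\kappa)}\,dt,\qquad\theta^*_0=0 .$$ Moreover: 1. For $t\in[0,1]$, the conditional law of $V$ given $\mathcal F^{Y^*}_t$ is Gaussian with mean $\lambda^*Y^*_t+\mu$ and variance $\gamma^2(1-t\Lambda^2(\kappa))$. Thus its density at $v$ with respect to $\Pi=N(\mu,\gamma^2)$ is $\rho^*(t,Y^*_t,v)$, where $$\rho^*(t,y,v)=\frac{1}{\sqrt{1-t\Lambda^2(\kappa)}}\exp\Big(-\frac1{2\gamma^2}\Big(\frac{(v-\lambda^*y-\mu)^2}{1-t\Lambda^2(\kappa)}-(v-\mu)^2\Big)\Big).$$ 2. The equilibrium demand $Y^*$ follows $$dY^*_t=\sigma\,dB_t+\Lambda(\kappa)\sigma\,\frac{\frac{V-\mu}{\gamma}-\frac{\Lambda(\kappa)Y^*_t}{\sigma}}{1-t\Lambda^2(\kappa)}\,dt,\qquad Y^*_0=0.$$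 3. The informed trader's expected profit is, for $v\in\mathbb R$, $$E^{0,v}[W_1^{\theta^*}]=\frac{\hat c}{2}\log\frac{c}{c+\lambda^*}+\frac{(\mu-v)^2}{2(c+\lambda^* )}+\frac{\lambda^*\sigma^2}{2}.$$ 4. The expected loss of the noise traders is $\lambda^*\sigma^2=\Lambda(\kappa)\gamma\sigma$. 5. The price inefficiency $\delta:=\mathbb E[\mathrm{Var}(V\mid\mathcal F_1^{Y^*})]$ is $\delta=\hat c\lambda^*=\kappa\Lambda(\kappa)\gamma^2$. Moreover, for $t\in[0,1]$, $$\mathrm{Var}(V\mid\mathcal F^{Y^*}_t)=\kappa\Lambda(\kappa)\gamma^2+\Lambda^2(\kappa)\gamma^2(1-t)=\gamma^2(1-t)+t\kappa\Lambda(\kappa)\gamma^2 .$$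
   Context: Fix $c>0$, $\sigma>0$, $\hat c:=c\sigma^2$. $B$ is a standard Brownian motion on $[0,1]$ with $B_0=0$, independent of the real random variable $V$ (the fundamental value), which has law $\Pi$ and support $\mathcal V$ (here $\mathcal V=\mathbb R$). $\mathcal F=\sigma(B_t,V;t\le1)$; $P^{0,v}$ is the regular conditional law given $B_0=0,V=v$ (under which $B$ is a Brownian motion and $V=v$), with expectation $E^{0,v}$; $\mathbb P(E)=\int_{\mathcal V}P^{0,v}(E)\Pi(dv)$, with expectation $\mathbb E$. Noise traders' demand is $\sigma B$, the insider's is $\theta$ with $d\theta_t=\alpha_tdt$, $\theta_0=0$, and total demand is $Y=\theta+\sigma B$ (denoted $Y^*$ when $\theta=\theta^*$). Market makers set the price $S_t=H(t,Y_t)$; $\mathcal F^M$ is the filtration generated by $Y$, made right-continuous and augmented with the $\mathbb P$-null sets; $\mathcal F^{Y^*}$ denotes this filtration when $Y=Y^*$. $\mathcal F^{B,V}$ is the right-continuous augmentation of the filtration generated by $B$ and $V$ with the sets $E\subset\mathcal F$ that satisfy $P^{0,v}(E)=0$ for all $v$. The insider's terminal wealth is $W_1^\theta=\int_0^1(V-S_s)\alpha_s\,ds-\frac c2\int_0^1\alpha_s^2\,ds$. An *admissible pricing rule* is a function $H\in C^{1,2}([0,1)\times\mathbb R)\cap C([0,1]\times\mathbb R)$ such that $x\mapsto H(t,x)$ is strictly increasing for every $t\in[0,1]$. Given such $H$, an $\mathcal F^{B,V}$-adapted $\theta$ is *admissible* ($\theta\in\mathcal A(H)$) if $\theta_t=\int_0^t\alpha_sds$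 for some adapted $\alpha$ with $\int_0^1|\alpha_t|dt<\infty$ $P^{0,v}$-a.s. for each $v\in\mathcal V$, and $E^{0,v}\int_0^1(H^2(s,Y_s)+\alpha_s^2)ds<\infty$ for all $v\in\mathcal V$. A pair $(H,\theta)$ is an *equilibrium* if $H$ is an admissible pricing rule, $\theta\in\mathcal A(H)$, (i) given $\theta$, $H(t,Y_t)=\mathbb E[V\mid\mathcal F^M_t]$ for all $t$, and (ii) given $H$, $E^{0,v}[W_1^{\theta}]=\sup_{\theta'\in\mathcal A(H)}E^{0,v}[W_1^{\theta'}]<\infty$ for all $v\in\mathcal V$. The noise traders' terminal wealth is $\sigma B_1(V-S_1)+\sigma\int_0^1B_t\,dS_t$ (they pay no additional transaction costs), and their expected loss is minus its $\mathbb P$-expectation. *)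

(* Defs.v *)
From HB Require Import structures.
From mathcomp Require Import all_boot all_order all_algebra.
From mathcomp Require Import all_classical all_reals all_analysis.
From mathcomp Require Import measurable_realfun.

Set Implicit Arguments.
Unset Strict Implicit.
Unset Printing Implicit Defensive.

Import Order.TTheory GRing.Theory Num.Theory.
Import numFieldNormedType.Exports.

Local Open Scope classical_set_scope.
Local Open Scope ring_scope.

(* Processes are functions [X : R -> Omega -> R] of time and scenario; only
   their values at times in [0, 1] matter. Sub-sigma-algebras of Omega are
   plain set systems, since several of them live on the same space. *)

Section Processes.
Context (R : realType) (d : measure_display) (Omega : measurableType d).
Implicit Types (X Y : R -> Omega -> R) (G : set_system Omega).
Implicit Types (F : R -> set_system Omega).

(* Generators of sigma(X_s : s in [0, t]). *)
Definition history X (t : R) : set_system Omega :=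
  \bigcup_(s in `[0, t]) g_sigma_algebra_preimage (X s).

(* For t < 1 this is the intersection over s in (t, 1] of the sigma-algebras
   generated by [F s] and the null sets; there is no time after 1, and at t = 1
   it is the sigma-algebra generated by [F 1] and the null sets. *)
Definition augmentation F (null : set_system Omega) (t : R) : set_system Omega :=
  \bigcap_(s in [set s | t < s <= 1 \/ s = 1]) <<s F s `|` null >>.

Definition adapted F X : Prop :=
  forall t : R, t \in `[0, 1] ->
  forall D : set R, measurable D -> F t (X t @^-1` D).

(* [f] is absolutely continuous on [0, 1] with f(0) = 0 and density [a]. *)
Definition path_primitive (a f : R -> R) : Prop :=
  lebesgue_measure.-integrable `[0, 1] (EFin \o a) /\
  forall t : R, t \in `[0, 1] -> f t = \int[lebesgue_measure]_(s in `[0, t]) a s.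

Definition is_brownian (Q : probability Omega R) (B : R -> Omega -> R) : Prop :=
  [/\ forall t : R, t \in `[0, 1] -> measurable_fun [set: Omega] (B t),
      {ae Q, forall w, B 0 w = 0},
      forall w, {within `[0, 1], continuous (fun t => B t w)},
      forall s t : R, 0 <= s -> s < t -> t <= 1 ->
        forall D : set R, measurable D ->
        Q ((B t \- B s)%R @^-1` D) = normal_prob 0 (Num.sqrt (t - s)) D
    & forall s t : R, 0 <= s -> s < t -> t <= 1 ->
        forall A, <<s history B s >> A ->
        forall D : set R, measurable D ->
        Q (A `&` ((B t \- B s)%R @^-1` D)) =
          (Q A * Q ((B t \- B s)%R @^-1` D))%E].

Section Conditioning.
Variable P : probability Omega R.

(* [Z] is a version of E[X | G]. *)
Definition is_cond_exp G (X Z : Omega -> R) : Prop :=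
  [/\ G `<=` measurable,
      P.-integrable [set: Omega] (EFin \o X),
      P.-integrable [set: Omega] (EFin \o Z),
      forall D : set R, measurable D -> G (Z @^-1` D)
    & forall A, G A ->
        (\int[P]_(w in A) (X w)%:E = \int[P]_(w in A) (Z w)%:E)%E].

(* The random law [K] is a version of the conditional law of [X] given [G]. *)
Definition is_cond_law G (X : Omega -> R) (K : Omega -> set R -> \bar R) : Prop :=
  forall D : set R, measurable D ->
  is_cond_exp G (\1_(X @^-1` D)) (fun w => fine (K w D)).

(* [Z] is a version of Var(X | G). *)
Definition is_cond_var G (X Z : Omega -> R) : Prop :=
  exists2 m : Omega -> R, is_cond_exp G X m
    & is_cond_exp G (fun w => (X w - m w) ^+ 2) Z.

(* [I] is a version of the stochastic integral of [X] with respect to [S] over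
   [0, 1]: for a continuous adapted integrand and a continuous semimartingale
   integrator it is the limit in probability of the left-endpoint Riemann sums,
   i.e. of the integrals of the simple processes sampling [X], as the mesh of
   the partition 0 = t_0 <= ... <= t_n = 1 tends to 0. *)
Definition is_ito_integral X (S : R -> Omega -> R) (I : Omega -> R) : Prop :=
  measurable_fun [set: Omega] I /\
  forall eps eta : R, 0 < eps -> 0 < eta ->
  exists2 delta : R, 0 < delta &
  forall (n : nat) (t : nat -> R), t 0%N = 0 -> t n = 1 ->
    (forall i, (i < n)%N -> t i <= t i.+1 < t i + delta) ->
    (P [set w | (eps <= `| \sum_(0 <= i < n)
                             X (t i) w * (S (t i.+1) w - S (t i) w) - I w |)%R]
       <= eta%:E)%E.

End Conditioning.
End Processes.

(* The derivative in time is taken within [0, 1), hence is one-sided at 0. *)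
Definition C12 (R : realType) (H : R -> R -> R) : Prop :=
  exists Ht Hx Hxx : R -> R -> R,
  [/\ forall t x : R, t \in `[0, 1[ ->
        (H s x - H t x) / (s - t) @[s --> within `[0, 1[%classic t^'] --> Ht t x,
      forall t x : R, t \in `[0, 1[ -> is_derive x (1 : R) (H t) (Hx t x),
      forall t x : R, t \in `[0, 1[ -> is_derive x (1 : R) (Hx t) (Hxx t x),
      {within `[0, 1[ `*` [set: R], continuous (fun p : R * R => H p.1 p.2)}
    & [/\ {within `[0, 1[ `*` [set: R], continuous (fun p : R * R => Ht p.1 p.2)},
          {within `[0, 1[ `*` [set: R], continuous (fun p : R * R => Hx p.1 p.2)}
        & {within `[0, 1[ `*` [set: R], continuous (fun p : R * R => Hxx p.1 p.2)}]].

Definition admissible_pricing_rule (R : realType) (H : R -> R -> R) : Prop :=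
  [/\ C12 H,
      {within `[0, 1] `*` [set: R], continuous (fun p : R * R => H p.1 p.2)}
    & forall t : R, t \in `[0, 1] -> forall x y : R, x < y -> H t x < H t y].

(* [noise] is B, [value] is V, [prior] is Pi, [cond_law v] is P^{0,v} and
   [joint_law] is the unconditional probability. The support of V is all of R,
   so [cond_law v] is given for every v. That V has law Pi and that B is a
   Brownian motion independent of V under [joint_law] also follow from the
   properties of [cond_law]. *)
Record kyle_model (R : realType) (d : measure_display) (Omega : measurableType d)
    := KyleModel {
  noise : R -> Omega -> R ;
  value : Omega -> R ;
  prior : probability R R ;
  cond_law : R -> probability Omega R ;
  joint_law : probability Omega R ;
  kyle_sigma_algebra : @measurable d Omega =
    <<s history noise 1 `|` g_sigma_algebra_preimage value >> ;
  kyle_value_law : forall D : set R, measurable D ->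
    joint_law (value @^-1` D) = prior D ;
  kyle_brownian : is_brownian joint_law noise ;
  kyle_independence : forall A, <<s history noise 1 >> A ->
    forall D : set R, measurable D ->
    joint_law (A `&` value @^-1` D) =
      (joint_law A * joint_law (value @^-1` D))%E ;
  kyle_cond_law_measurable : forall E, measurable E ->
    measurable_fun [set: R] (fun v => cond_law v E) ;
  kyle_disintegration : forall E, measurable E ->
    (joint_law E = \int[prior]_v cond_law v E)%E ;
  kyle_cond_value : forall v, {ae cond_law v, forall w, value w = v} ;
  kyle_cond_brownian : forall v, is_brownian (cond_law v) noise
}.

Section Equilibrium.
Context (R : realType) (d : measure_display) (Omega : measurableType d).
Variables (M : kyle_model R Omega) (sigma c : R).
Implicit Types (H : R -> R -> R) (theta alpha : R -> Omega -> R).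

Definition demand theta (t : R) (w : Omega) : R :=
  theta t w + sigma * noise M t w.

(* The filtration F^M. *)
Definition market_filtration theta : R -> set_system Omega :=
  augmentation (history (demand theta))
    [set E | measurable E /\ joint_law M E = 0%E].

(* The filtration F^{B,V}. *)
Definition insider_filtration : R -> set_system Omega :=
  augmentation
    (fun t => history (noise M) t `|` g_sigma_algebra_preimage (value M))
    [set E | measurable E /\ forall v, cond_law M v E = 0%E].

(* [alpha] is a trading rate of [theta], i.e. d theta_t = alpha_t dt. *)
Definition trading_rate theta alpha : Prop :=
  [/\ adapted insider_filtration alpha,
      measurable_fun (`[(0 : R), 1] `*` [set: Omega])
        (fun p : R * Omega => alpha p.1 p.2)
    & forall v, {ae cond_law M v, forall w,
        path_primitive (fun s => alpha s w) (fun t => theta t w)}].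

Definition admissible_with_rate H theta alpha : Prop :=
  [/\ adapted insider_filtration theta,
      trading_rate theta alpha
    & forall v, (\int[cond_law M v]_w \int[lebesgue_measure]_(s in `[0%R, 1%R])
        (H s (demand theta s w) ^+ 2 + alpha s w ^+ 2)%R%:E < +oo)%E].

Definition admissible_strategy H theta : Prop :=
  exists alpha, admissible_with_rate H theta alpha.

(* The insider's terminal wealth W_1^theta. A trading rate of [theta] is unique
   up to null sets, so its expectation does not depend on the choice of
   [alpha]. *)
Definition insider_wealth H theta alpha (w : Omega) : R :=
  \int[lebesgue_measure]_(s in `[0, 1])
    ((value M w - H s (demand theta s w)) * alpha s w)
  - c / 2 * \int[lebesgue_measure]_(s in `[0, 1]) (alpha s w) ^+ 2.

Definition expected_wealth H theta alpha (v : R) : \bar R :=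
  ('E_(cond_law M v)[insider_wealth H theta alpha])%E.

Definition equilibrium H theta : Prop :=
  [/\ admissible_pricing_rule H,
      admissible_strategy H theta,
      forall t : R, t \in `[0, 1] ->
        is_cond_exp (joint_law M) (market_filtration theta t) (value M)
          (fun w => H t (demand theta t w))
    & forall alpha, trading_rate theta alpha -> forall v,
        expected_wealth H theta alpha v =
          ereal_sup [set e | exists theta' alpha',
            admissible_with_rate H theta' alpha' /\
            e = expected_wealth H theta' alpha' v] /\
        (expected_wealth H theta alpha v < +oo)%E].

(* [I] stands for the stochastic integral of B against the price. *)
Definition noise_wealth H theta (I : Omega -> R) (w : Omega) : R :=
  sigma * noise M 1 w * (value M w - H 1 (demand theta 1 w)) + sigma * I w.

End Equilibrium.

Definition Lambda (R : realType) (kappa : R) : R :=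
  (Num.sqrt (kappa ^+ 2 + 4) - kappa) / 2.

Definition lambda_star (R : realType) (c gamma sigma : R) : R :=
  (- c + Num.sqrt (c ^+ 2 + 4 * gamma ^+ 2 / sigma ^+ 2)) / 2.

Definition price_star (R : realType) (lambda mu : R) (t y : R) : R :=
  lambda * y + mu.

Definition drift_star (R : realType) (kappa gamma sigma mu : R) (t v y : R) : R :=
  Lambda kappa * sigma *
    (((v - mu) / gamma - Lambda kappa * y / sigma) / (1 - t * Lambda kappa ^+ 2)).

Definition rho_star (R : realType) (kappa gamma lambda mu : R) (t y v : R) : R :=
  (Num.sqrt (1 - t * Lambda kappa ^+ 2))^-1 *
  expR (- (1 / (2 * gamma ^+ 2)) *
    ((v - lambda * y - mu) ^+ 2 / (1 - t * Lambda kappa ^+ 2) - (v - mu) ^+ 2)).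

(* [theta] solves d theta_t = drift_star(t, V, theta_t + sigma B_t) dt,
   theta_0 = 0. *)
Definition solves_theta_star (R : realType) (d : measure_display)
    (Omega : measurableType d) (M : kyle_model R Omega)
    (kappa gamma sigma mu : R) (theta : R -> Omega -> R) : Prop :=
  adapted (insider_filtration M) theta /\
  forall v, {ae cond_law M v, forall w,
    path_primitive
      (fun s => drift_star kappa gamma sigma mu s (value M w)
                  (demand M sigma theta s w))
      (fun t => theta t w)}.

(* Main.v *)
(* With a_t = 1 - t L^2 and Z = (V - mu) / gamma, the linear equation for the
   demand has the explicit solution Y_t = sigma (L t Z + a_t W_t), where
   W_t = B_t / a_t - L^2 \int_0^t B_s / a_s^2 ds is, after an integration by
   parts, the Wiener integral \int_0^t dB_s / a_s. The innovation
   Z - L Y_t / sigma = a_t (Z - L W_t) is N(0, a_t) and independent of the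
   demand up to time t: W has independent Gaussian increments, so this passes
   from one time to the next by an orthogonal change of variables in the plane.
   It survives the augmentation of the filtration by path continuity, and it
   gives the conditional laws, the price and the price inefficiency.

   Completing the square in the control problem, with A_t solving the Riccati
   equation A' = - c / (c + lambda (1 - t))^2, A_1 = 0, and X the mispricing,
   writes the insider's wealth pathwise, without stochastic calculus, as
     A_0 x0^2 / 2 - (c / 2) \int (alpha - X / (c + lambda (1 - t)))^2
       + lambda sigma \int B f - (lambda^2 sigma^2 / 2) \int A' B^2,
   where f is the density of A (x0 - lambda theta). The integral of f is
   deterministic, so that E \int B f = E \int (B_s - B_1) f_s ds, and the latter
   vanishes because f is adapted and B_1 - B_s is independent of the past.

   The integral of B against the price is
   lambda \int B alpha ds + lambda sigma (B_1^2 - 1) / 2, by an L^1 bound for the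
   drift part of the Riemann sums and an L^2 bound for the quadratic variation. *)
From HB Require Import structures.
Require Import Defs.
From mathcomp Require Import all_boot all_order all_algebra.
From mathcomp Require Import all_classical all_reals all_analysis.
From mathcomp Require Import measurable_realfun.
From mathcomp Require Import ring lra.
Set Implicit Arguments.
Unset Strict Implicit.
Unset Printing Implicit Defensive.
Import Order.TTheory GRing.Theory Num.Theory.
Import numFieldNormedType.Exports.
Local Open Scope classical_set_scope.
Local Open Scope ring_scope.

(** * Integration *)

(** The filtering half and the control half meet in one identity: since Lambda^2 + kappa Lambda = 1,
    the feedback denominator c + lambda (1 - t) is gamma / (sigma Lambda) times the normalised
    conditional variance 1 - t Lambda^2. Hence the drift that makes the price rational is exactly
    the maximiser of the insider's completed square. The same facts are needed under every P^{0,v}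
    and under the joint law, so most of the probability is stated for a law Q under which B is
    Brownian and independent of V. Under P^{0,v} this independence is automatic, V being almost
    surely constant. Null sets are the recurring obstacle. Demand, trading rates and arbitrary
    strategies are described only almost surely under each P^{0,v}, while the market's filtration is
    augmented with null sets of the joint law. Results are therefore proved first for versions that
    behave well in every scenario and then transferred; an exceptional set reaches the joint law by
    disintegration once it is known to be measurable. *)

Section ae_integral.
Local Open Scope ereal_scope.
Context d (T : measurableType d) (R : realType) (mu : {measure set T -> \bar R}).
Import HBNNSimple.

(* The integral is a supremum over simple functions, which can be cut off on the
   exceptional null set. *)
Lemma ge0_ae_le_integral (f g : T -> \bar R) :
  (forall x, 0 <= f x) -> (forall x, 0 <= g x) ->
  {ae mu, forall x, f x <= g x} -> \int[mu]_x f x <= \int[mu]_x g x.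
Proof.
move=> f0 g0 [N [mN N0 sN]]; rewrite !ge0_integralTE//.
apply: ge_ereal_sup => /= _ [h hf <-].
apply: ereal_sup_ubound => /=.
pose k := [the {nnsfun T >-> R} of (h \* indic_nnsfun R (measurableC mN))%R].
exists k => [x|].
  rewrite /k/= mindicE; case: (pselect (N x)) => Nx.
    by rewrite memNset ?mulr0 //=; apply.
  rewrite mem_set// mulr1 (le_trans (hf x))//.
  by apply: contrapT => fg; apply/Nx/sN.
rewrite -!integralT_nnsfun; apply: ae_eq_integral => //.
- exact/measurable_EFinP.
- exact/measurable_EFinP.
exists N; split => // x /= /not_implyP[_ H]; apply: contrapT => Nx; apply: H.
by rewrite /k/= mindicE mem_set// mulr1.
Qed.

(** Stated for arbitrary functions, since the wealth of a strategy is only known to agree almost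
    surely with a measurable expression. *)
Lemma ae_integral_eq (f g : T -> \bar R) :
  {ae mu, forall x, f x = g x} -> \int[mu]_x f x = \int[mu]_x g x.
Proof.
move=> fg.
have ge0 (u v : T -> \bar R) : (forall x, 0 <= u x) -> (forall x, 0 <= v x) ->
    {ae mu, forall x, u x = v x} -> \int[mu]_x u x = \int[mu]_x v x.
  move=> u0 v0 uv; apply/eqP; rewrite eq_le !ge0_ae_le_integral//.
    by apply: filterS uv => x ->.
  by apply: filterS uv => x ->.
rewrite integralE [RHS]integralE; congr (_ - _); apply: ge0 => //.
- by apply: filterS fg => x; rewrite !funeposE => ->.
- by apply: filterS fg => x; rewrite !funenegE => ->.
Qed.

End ae_integral.

Section law.
Context d d' (T1 : measurableType d) (T2 : measurableType d') (R : realType).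

Definition law (m : {measure set T1 -> \bar R}) (f : T1 -> T2)
    (mf : measurable_fun [set: T1] f) : {measure set T2 -> \bar R} :=
  measure_function_pushforward__canonical__measure_function_Measure m mf.

Lemma lawE m f mf (A : set T2) : @law m f mf A = m (f @^-1` A).
Proof. by []. Qed.

End law.

Section affine_change.
Local Open Scope ereal_scope.
Context (R : realType).
Notation mu := (@lebesgue_measure R).

(** Lebesgue measure is determined by its values on half-open intervals, where [a] times the
    pushforward under x -> a x + b gives the same length. *)
Lemma ge0_integral_affine (a b : R) (f : R -> \bar R) : (0 < a)%R ->
  measurable_fun setT f -> (forall x, 0 <= f x) ->
  \int[mu]_x f (a * x + b)%R = (a^-1)%:E * \int[mu]_x f x.
Proof.
move=> a0 mf f0.
have mphi : measurable_fun [set: measurableTypeR R]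
    (fun x : measurableTypeR R => (a * x + b)%R : measurableTypeR R).
  by apply: measurable_funD => //; exact: measurable_funM.
pose m := mscale (NngNum (ltW a0)) (law mu mphi).
have mE A : measurable A -> mu A = m A.
  apply: lebesgue_measure_unique => _ [[x y] _ <-].
  rewrite -[RHS]/(a%:E * mu ((fun z : R => (a * z + b)%R) @^-1` `]x, y]))%E.
  rewrite (_ : _ @^-1` _ = `](x - b) / a, (y - b) / a]%classic)%R; last first.
    apply/seteqP; split => z /=; rewrite !in_itv /= => /andP[xz zy];
      apply/andP; split; move: xz zy;
      by rewrite ?ltr_pdivrMr ?ler_pdivlMr ?ltrBlDr ?lerBrDr 1?mulrC.
  rewrite !lebesgue_measure_itv /= !lte_fin ltr_pM2r ?invr_gt0// ltrD2r.
  case: ifPn => _; last by rewrite mule0.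
  rewrite -!EFinD -EFinM; congr EFin; field; exact: lt0r_neq0.
have -> : \int[mu]_x f x = \int[m]_x f x.
  by apply: eq_measure_integral => A mA _; exact: mE.
rewrite ge0_integral_mscale//= ge0_integral_pushforward//=.
by rewrite muleA -EFinM mulVf ?mul1e// lt0r_neq0.
Qed.

End affine_change.

Section real_laws.
Local Open Scope ereal_scope.
Context (R : realType).

(** The open right rays form a pi-system generating the Borel sets. They are a convenient one
    because their indicators are increasing limits of continuous functions, which is what
    [limit_joint_law] exploits. *)
Lemma eq_measure_rays (m1 m2 : {measure set R -> \bar R}) :
  m1 setT < +oo ->
  (forall y, m1 `]y, +oo[%classic = m2 `]y, +oo[%classic) ->
  forall D, measurable D -> m1 D = m2 D.
Proof.
move=> m1oo H; apply: (measure_unique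
  [set `]y, +oo[%classic | y in [set: R]] (fun n => `](- n%:R)%R, +oo[%classic)).
- transitivity (@measurable _ (measurableTypeR R)) => //; rewrite [LHS]RGenOInfty.measurableE; congr (<<s _ >>).
  apply/seteqP; split => A /=.
    by move=> [x ->]; exists x.
  by move=> [x _ <-]; exists x.
- move=> _ _ [x _ <-] [y _ <-]; exists (Num.max x y) => //.
  apply/seteqP; split => z /=; rewrite !in_itv /= !andbT gt_max.
    by move=> /andP[].
  by move=> [-> ->].
- by move=> n; exists (- n%:R)%R.
- rewrite -subTset => x _; exists (Num.bound `|x|) => //=.
  rewrite in_itv/= andbT ltrNl (le_lt_trans (ler_norm _))// normrN.
  exact: archi_boundP.
- by move=> _ [y _ <-].
- move=> k; apply: le_lt_trans m1oo; apply: le_measure => //; rewrite inE//.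
Qed.

End real_laws.

Section restricted_measure.
Local Open Scope ereal_scope.
Context d (T : measurableType d) (R : realType).
Variables (mu : {measure set T -> \bar R}) (A : set T) (mA : measurable A).

Lemma integral_mrestr (f : T -> \bar R) :
  \int[mrestr mu mA]_x f x = \int[mu]_(x in A) f x.
Proof.
have -> : \int[mu]_(x in A) f x = \int[mrestr mu mA]_(x in A) f x.
  apply: eq_measure_integral => B mB BA.
  by rewrite /mrestr; congr (mu _); rewrite setIidl.
rewrite [RHS]integral_mkcond; apply: ae_integral_eq.
exists (~` A); split => [|/=|x /=].
- exact: measurableC.
- by rewrite /mrestr setICl measure0.
- by apply: contra_not => /= Ax; rewrite patchE mem_set.
Qed.

End restricted_measure.

Section joint_law.
Local Open Scope ereal_scope.
Context d (T : measurableType d) (R : realType) (P : probability T R).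
Context d1 (S1 : measurableType d1) d2 (S2 : measurableType d2).
Variables (A : set T) (mA : measurable A) (X : T -> S1) (Y : T -> S2).
Variables (nu : probability S2 R).
Hypotheses (mX : measurable_fun setT X) (mY : measurable_fun setT Y).
Hypothesis XY : forall D E, measurable D -> measurable E ->
  P (A `&` (X @^-1` D `&` Y @^-1` E)) = P (A `&` X @^-1` D) * nu E.

Let m := law (mrestr P mA) mX.

Let m_fin : fin_num_fun m.
Proof.
move=> D mD; rewrite /m lawE; apply: fin_num_measure.
by rewrite -[X in measurable X]setTI; exact: mX.
Qed.

HB.instance Definition _ := Measure.on (m : set S1 -> \bar R).
HB.instance Definition _ := @Measure_isFinite.Build _ S1 R (m : set S1 -> \bar R) m_fin.

Let mXY : measurable_fun setT (fun w => (X w, Y w)).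
Proof. exact: measurable_fun_pair. Qed.

Let jointE E : measurable E ->
  (m \x nu) E = law (mrestr P mA) mXY E.
Proof.
apply: product_measure_unique => D F mD mF.
by have := XY mD mF; rewrite setIC [A `&` _]setIC.
Qed.

(** On the event [A] the pair (X, Y) is distributed as the product of the law of [X] on [A] with
    [nu], by uniqueness on rectangles; what remains is Tonelli. Keeping [A] inside lets independence
    from a sigma-algebra be tested event by event. *)
Lemma ge0_integral_joint (f : S1 * S2 -> \bar R) : measurable_fun setT f ->
  (forall x, 0 <= f x) ->
  \int[P]_(w in A) f (X w, Y w) = \int[P]_(w in A) \int[nu]_y f (X w, y).
Proof.
move=> mf f0.
transitivity (\int[m \x nu]_z f z).
  rewrite (eq_measure_integral (law (mrestr P mA) mXY)); last first.
    by move=> ? ? _; exact: jointE.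
  by rewrite ge0_integral_pushforward//= integral_mrestr.
rewrite fubini_tonelli1//.
rewrite ge0_integral_pushforward//=.
- by rewrite integral_mrestr.
- exact: measurable_fun_fubini_tonelli_F.
- by move=> ? _; exact: integral_ge0.
Qed.

End joint_law.

(** * Independence from a sigma-algebra, up to null sets *)

Section independence.
Local Open Scope ereal_scope.
Context d (T : measurableType d) (R : realType) (P : probability T R).
Implicit Types (G S : set_system T).

(** Independence from [G] and the law of [Y] are bundled in one equation; the law is recovered at A
    = [setT] when [G] contains it. *)
Definition indep_law G d' (U : measurableType d') (Y : T -> U)
    (nu : set U -> \bar R) :=
  forall A, G A -> forall D, measurable D -> P (A `&` Y @^-1` D) = P A * nu D.

Lemma sub_indep_law G S d' (U : measurableType d') (Y : T -> U) nu :
  S `<=` G -> indep_law G Y nu -> indep_law S Y nu.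
Proof. by move=> SG H A SA; exact: H (SG _ SA). Qed.

(** For fixed [D] both sides are finite measures in [A], so agreement on the pi-system [G] is
    enough. *)
Lemma indep_law_sigma G d' (U : measurableType d') (Y : T -> U)
    (nu : probability U R) :
  G `<=` measurable -> setI_closed G -> G setT -> measurable_fun setT Y ->
  indep_law G Y nu -> indep_law <<s G>> Y nu.
Proof.
move=> Gm GI GT mY GY A sA D mD.
have mYD : measurable (Y @^-1` D) by rewrite -[X in measurable X]setTI; exact: mY.
have nuD : (0 <= fine (nu D))%R by apply: fine_ge0; exact: measure_ge0.
have /= := @g_sigma_algebra_measure_unique _ _ _ G Gm (fun=> setT) (fun=> GT) _
  (mrestr P mYD) (mscale (NngNum nuD) P) GI _ _ _ sA.
rewrite /mrestr /mscale/= fineK ?fin_num_measure// muleC; apply.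
- by rewrite bigcup_const.
- by move=> B GB; rewrite GY// muleC.
- by move=> k; rewrite ltey_eq fin_num_measure//; exact: measurableI.
Qed.

Definition eq_mod_null A A' :=
  exists N, [/\ measurable N, P N = 0 & A `\` N = A' `\` N].

Lemma eq_mod_null_measure A A' C : measurable A -> measurable A' ->
  measurable C -> eq_mod_null A A' -> P (A `&` C) = P (A' `&` C).
Proof.
move=> mA mA' mC [N [mN N0 AN]].
have H B : measurable B -> P (B `&` C) = P ((B `\` N) `&` C).
  move=> mB; apply/eqP; rewrite eq_le; apply/andP; split; last first.
    by apply: le_measure; rewrite ?inE; [exact: measurableI (measurableD mB mN) mC|
      exact: measurableI|apply: setSI; exact: subDsetl].
  apply: (@le_trans _ _ (P (((B `\` N) `&` C) `|` N))).
    apply: le_measure; rewrite ?inE; [exact: measurableI| |].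
      by apply: measurableU => //; exact: measurableI (measurableD mB mN) mC.
    by move=> x [Bx Cx]; case: (pselect (N x)) => Nx; [right|left].
  have mX : measurable ((B `\` N) `&` C).
    exact: measurableI (measurableD mB mN) mC.
  apply: (le_trans (measureU2 P mX mN)).
  by rewrite [X in _ + X]N0 adde0.
by rewrite H// AN -H.
Qed.

(** The measurable sets that agree with a member of [S] off a null set form a sigma-algebra: for a
    countable union the exceptional sets are united. This strips the null sets from an augmented
    sigma-algebra before independence is used. *)
Lemma sigma_mod_null G S : sigma_algebra setT S -> S `<=` measurable ->
  (forall A, G A -> measurable A /\ exists2 A', S A' & eq_mod_null A A') ->
  forall A, <<s G>> A -> measurable A /\ exists2 A', S A' & eq_mod_null A A'.
Proof.
move=> [S0 SC SU] Sm GS A.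
apply: (smallest_sub (X := [set A | measurable A /\
  exists2 A', S A' & eq_mod_null A A'])) => //.
split => /=.
- by split => //; exists set0 => //; exists set0; rewrite measure0; split.
- move=> B [mB [B' SB' [N [mN N0 BN]]]]; split; first exact: measurableD.
  exists (setT `\` B'); first exact: SC.
  exists N; split => //.
  have H C : (setT `\` C) `\` N = ~` ((C `\` N) `|` N).
    rewrite setTD; apply/seteqP; split => x /=; first by tauto.
    by move=> /not_orP[H ?]; split => // Cx; apply: H.
  by rewrite !H BN.
- move=> F HF; split; first by apply: bigcupT_measurable => n; have [] := HF n.
  have /choice[F' HF'] : forall n, exists F', S F' /\ eq_mod_null (F n) F'.
    by move=> n; have [_ [F' ? ?]] := HF n; exists F'.
  have /choice[N HN] : forall n, exists N,
      [/\ measurable N, P N = 0 & F n `\` N = F' n `\` N].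
    by move=> n; have [_ [N ?]] := HF' n; exists N.
  exists (\bigcup_n F' n); first by apply: SU => n; have [] := HF' n.
  have mN n : measurable (N n) by have [] := HN n.
  exists (\bigcup_n N n); split.
  + exact: bigcupT_measurable.
  + apply/eqP; rewrite eq_le measure_ge0 andbT.
    apply: le_trans (measure_sigma_subadditive _ _ _ _) _; last first.
    * by rewrite eseries0// => n _ _; have [_ N0 _] := HN n; exact: N0.
    * by [].
    * exact: bigcupT_measurable.
    * exact: mN.
  + apply/seteqP; split => x [[n _ Fx] Nx]; split => //; exists n => //;
      have [_ _ FN] := HN n; have xN : ~ N n x by move=> ?; apply: Nx; exists n.
    * by have [] : (F' n `\` N n) x by rewrite -FN; split.
    * by have [] : (F n `\` N n) x by rewrite FN; split.
Qed.

Lemma indep_law_mod_null G S d' (U : measurableType d') (Y : T -> U) nu :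
  sigma_algebra setT S -> S `<=` measurable -> measurable_fun setT Y ->
  (forall A, G A -> measurable A /\ exists2 A', S A' & eq_mod_null A A') ->
  indep_law S Y nu -> indep_law <<s G>> Y nu.
Proof.
move=> sS Sm mY GS SY A sA D mD.
have [mA [A' SA' AA']] := sigma_mod_null sS Sm GS sA.
have mA' := Sm _ SA'.
have mYD : measurable (Y @^-1` D) by rewrite -[X in measurable X]setTI; exact: mY.
rewrite (eq_mod_null_measure mA mA' mYD AA') SY//.
by rewrite -(setIT A) (eq_mod_null_measure mA mA' measurableT AA') setIT.
Qed.

End independence.

(** * Product formulas under pointwise limits *)

Section limit_law.
Local Open Scope ereal_scope.
Context (R : realType).
Context d (T : measurableType d) (P : probability T R).
Context d' (T' : measurableType d') (Q : probability T' R).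
Variables (A : set T) (mA : measurable A).

Lemma bounded_cvg_integral d1 (T1 : measurableType d1) (m : probability T1 R)
    (D : set T1) (mD : measurable D) (f : nat -> T1 -> R) (g : T1 -> R) :
  (forall n, measurable_fun setT (f n)) ->
  (forall n x, (0 <= f n x <= 1)%R) -> (forall x, f n x @[n --> \oo] --> g x) ->
  \int[m]_(x in D) (f n x)%:E @[n --> \oo] --> \int[m]_(x in D) (g x)%:E.
Proof.
move=> mf f01 fg.
have mg : measurable_fun setT g.
  by apply: (measurable_fun_cvg mf) => x _; exact: fg.
have := @dominated_convergence _ _ _ m D mD (fun n x => (f n x)%:E)
   (fun x => (g x)%:E) (cst 1).
case=> //.
- by move=> n; apply/measurable_EFinP; exact: measurable_funTS.
- by apply/measurable_EFinP; exact: measurable_funTS.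
- by apply: aeW => x _; apply: cvg_EFin; [exact: nearW|exact: fg].
- exact: finite_measure_integrable_cst.
- by apply: aeW => x n _; have /andP[? ?] := f01 n x; rewrite gee0_abs lee_fin.
Qed.

(** The formula is passed to the limit for continuous test functions with values in [0, 1], by
    dominated convergence, and then extended to rays. The reference law is carried by variables [Sn]
    that converge too, so that a law depending on [n] needs no separate continuity statement. *)
Lemma limit_joint_law (Rn : nat -> T -> R) (L : T -> R)
    (Sn : nat -> T' -> R) (S : T' -> R) :
  (forall n, measurable_fun setT (Rn n)) ->
  (forall n, measurable_fun setT (Sn n)) ->
  (forall w, Rn n w @[n --> \oo] --> L w) ->
  (forall w, Sn n w @[n --> \oo] --> S w) ->
  (forall n D, measurable D ->
     P (A `&` Rn n @^-1` D) = P A * Q (Sn n @^-1` D)) ->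
  forall D, measurable D -> P (A `&` L @^-1` D) = P A * Q (S @^-1` D).
Proof.
move=> mR mS RL SS RS.
have mL : measurable_fun setT L.
  by apply: (measurable_fun_cvg mR) => x _; exact: RL.
have mS' : measurable_fun setT S.
  by apply: (measurable_fun_cvg mS) => x _; exact: SS.
have [p p0 PAE] : exists2 p : R, (0 <= p)%R & P A = p%:E.
  exists (fine (P A)); first by apply: fine_ge0; exact: measure_ge0.
  by rewrite fineK// fin_num_measure.
rewrite PAE in RS *.
have step1 n (g : R -> R) : measurable_fun setT g -> (forall x, 0 <= g x)%R ->
    \int[P]_(w in A) (g (Rn n w))%:E = p%:E * \int[Q]_w (g (Sn n w))%:E.
  move=> mg g0.
  transitivity (\int[law (mrestr P mA) (mR n)]_x (g x)%:E).
    rewrite ge0_integral_pushforward//= ?integral_mrestr//.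
      exact/measurable_EFinP.
    by move=> x _; rewrite lee_fin.
  rewrite (eq_measure_integral (mscale (NngNum p0) (law Q (mS n)))); last first.
    by move=> D mD _; have := RS n D mD; rewrite setIC.
  rewrite ge0_integral_mscale//=.
    congr (_ * _); rewrite ge0_integral_pushforward//=.
      exact/measurable_EFinP.
    by move=> x _; rewrite lee_fin.
  exact/measurable_EFinP.
  by move=> x _; rewrite lee_fin.
have step2 (g : R -> R) : continuous g -> (forall x, 0 <= g x <= 1)%R ->
    \int[P]_(w in A) (g (L w))%:E = p%:E * \int[Q]_w (g (S w))%:E.
  move=> cg g01.
  have mg : measurable_fun setT g by exact: continuous_measurable_fun.
  have g0 x : (0 <= g x)%R by have /andP[] := g01 x.
  have h1 : \int[P]_(w in A) (g (Rn n w))%:E @[n --> \oo] -->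
      \int[P]_(w in A) (g (L w))%:E.
    apply: (@bounded_cvg_integral _ _ P A mA (fun n w => g (Rn n w))) => //.
      by move=> n; exact: measurableT_comp.
    by move=> w; apply: continuous_cvg; [exact: cg|exact: RL].
  have h2 : p%:E * \int[Q]_w (g (Sn n w))%:E @[n --> \oo] -->
      p%:E * \int[Q]_w (g (S w))%:E.
    apply: cvgeZl => //.
    apply: (@bounded_cvg_integral _ _ Q setT measurableT (fun n w => g (Sn n w))) => //.
      by move=> n; exact: measurableT_comp.
    by move=> w; apply: continuous_cvg; [exact: cg|exact: SS].
  apply: (cvg_unique _ h1); first exact: ereal_hausdorff.
  by rewrite (_ : (fun n => _) = fun n => p%:E * \int[Q]_w (g (Sn n w))%:E)//;
    apply/funext => n; rewrite step1.
(* Continuous ramps that increase with [k] to the indicator of the ray above [y]. *)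
pose h (y : R) (k : nat) (x : R) := (Num.min 1 (k%:R * Num.max 0 (x - y)))%R.
have h01 y k x : (0 <= h y k x <= 1)%R.
  by rewrite /h ge_min lexx /= le_min ler01 mulr_ge0// le_max lexx.
have ch y k : continuous (h y k).
  move=> x; apply: (@continuous_min _ _ (fun=> 1%R) (fun x => k%:R * Num.max 0 (x - y))%R).
    exact: cvg_cst.
  apply: cvgM; first exact: cvg_cst.
  apply: (@continuous_max _ _ (fun=> 0%R) (fun x => (x - y))%R); first exact: cvg_cst.
  by apply: cvgB; [exact: cvg_id|exact: cvg_cst].
have hcvg y x : h y k x @[k --> \oo] --> ((\1_(`]y, +oo[) x : R))%R.
  rewrite indicE; have [yx|xy] := ltP y x; last first.
    rewrite memNset/= ?in_itv/= ?andbT; last by apply/negP; rewrite -leNgt.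
    rewrite (_ : (fun k => h y k x) = cst 0%R); first exact: cvg_cst.
    apply/funext => k; rewrite /h max_l ?subr_le0// mulr0.
    by rewrite min_r.
  rewrite mem_set/= ?in_itv/= ?yx//.
  apply: cvg_near_cst; near=> k.
  rewrite /h max_r ?subr_ge0 ?(ltW yx)//.
  apply/min_l; rewrite -ler_pdivrMr ?subr_gt0// mul1r.
  by near: k; exact: nbhs_infty_ger.
have mh y k : measurable_fun setT (h y k).
  exact: continuous_measurable_fun (ch y k).
have step3 y : P (A `&` L @^-1` `]y, +oo[) = p%:E * Q (S @^-1` `]y, +oo[).
  have h1 : \int[P]_(w in A) (h y k (L w))%:E @[k --> \oo] -->
      \int[P]_(w in A) (\1_(`]y, +oo[) (L w))%:E.
    apply: (@bounded_cvg_integral _ _ P A mA (fun k w => h y k (L w))) => //.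
      by move=> n; exact: measurableT_comp.
  have h2 : p%:E * \int[Q]_w (h y k (S w))%:E @[k --> \oo] -->
      p%:E * \int[Q]_w (\1_(`]y, +oo[) (S w))%:E.
    apply: cvgeZl => //.
    apply: (@bounded_cvg_integral _ _ Q setT measurableT (fun k w => h y k (S w))) => //.
      by move=> n; exact: measurableT_comp.
  have : \int[P]_(w in A) (\1_(`]y, +oo[) (L w))%:E =
         p%:E * \int[Q]_w (\1_(`]y, +oo[) (S w))%:E.
    apply: (cvg_unique _ h1); first exact: ereal_hausdorff.
    rewrite (_ : (fun k => _) = fun k => p%:E * \int[Q]_w (h y k (S w))%:E)//.
    by apply/funext => n; rewrite step2.
  have mLy : measurable (L @^-1` `]y, +oo[).
    by rewrite -[X in measurable X]setTI; exact: mL.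
  have mSy : measurable (S @^-1` `]y, +oo[).
    by rewrite -[X in measurable X]setTI; exact: mS'.
  rewrite (_ : (fun w => _) = EFin \o \1_(L @^-1` `]y, +oo[))//.
  rewrite [X in _ * X](_ : _ = \int[Q]_w (\1_(S @^-1` `]y, +oo[) w)%:E)//.
  by rewrite !integral_indic// setIT setIC.
move=> D mD; rewrite setIC.
apply: (@eq_measure_rays _ (law (mrestr P mA) mL)
  (mscale (NngNum p0) (law Q mS'))) => //.
  by rewrite lawE preimage_setT /= /mrestr setTI ltey_eq fin_num_measure.
by move=> y; have := step3 y; rewrite setIC.
Unshelve. all: by end_near.
Qed.

End limit_law.

(** * Gaussian laws *)

Section normal_laws.
Local Open Scope ereal_scope.
Context (R : realType).
Notation mu := (@lebesgue_measure R).
Implicit Types (s r : R) (f g : R -> \bar R).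

(** The Radon-Nikodym derivative agrees with [normal_pdf] almost everywhere, because both have the
    same integral over every measurable set. *)
Lemma integral_normal_prob (m s : R) f : measurable_fun setT f ->
  (forall x, 0 <= f x) ->
  \int[normal_prob m s]_x f x = \int[mu]_x (f x * (normal_pdf m s x)%:E).
Proof.
move=> mf f0; have dom := @normal_prob_dominates R m s.
rewrite -(Radon_Nikodym_SigmaFinite.change_of_variables dom)//.
have mRN : measurable_fun setT
    (Radon_Nikodym_SigmaFinite.f (normal_prob m s) mu).
  exact: measurable_int (Radon_Nikodym_SigmaFinite.f_integrable dom).
have mpdf : measurable_fun [set: R] (EFin \o normal_pdf m s).
  by apply/measurable_EFinP; exact: measurable_normal_pdf.
apply: ge0_ae_eq_integral => //=.
- exact: emeasurable_funM.
- exact: emeasurable_funM.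
- by move=> x _; rewrite mule_ge0// Radon_Nikodym_SigmaFinite.f_ge0.
- by move=> x _; rewrite mule_ge0// lee_fin normal_pdf_ge0.
apply: ae_eqe_mul2l; apply: integral_ae_eq => //.
- exact: Radon_Nikodym_SigmaFinite.f_integrable.
- move=> E _ mE; rewrite -Radon_Nikodym_SigmaFinite.f_integral//.
Qed.

Lemma normal_pdf0E s x : (0 < s)%R ->
  normal_pdf 0 s x = ((s * Num.sqrt (pi *+ 2))^-1 * expR (- (x ^+ 2 / (s ^+ 2 * 2))))%R.
Proof.
move=> s0; rewrite normal_pdfE ?lt0r_neq0// /normal_peak /normal_fun subr0.
congr (_^-1 * expR _)%R; last by rewrite mulr_natr mulNr.
by rewrite -mulrnAr sqrtrM ?sqr_ge0// sqrtr_sqr gtr0_norm.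
Qed.

Lemma normal_pdf0N s x : (0 < s)%R -> normal_pdf 0 s (- x) = normal_pdf 0 s x.
Proof. by move=> s0; rewrite !normal_pdf0E// sqrrN. Qed.

Lemma ge0_integral_normalN s f : (0 < s)%R -> measurable_fun setT f ->
  (forall x, 0 <= f x) ->
  \int[normal_prob 0 s]_x f (- x)%R = \int[normal_prob 0 s]_x f x.
Proof.
move=> s0 mf f0.
have mN : measurable_fun setT (-%R : R -> R) by exact: oppr_measurable.
rewrite !integral_normal_prob//; last exact: measurableT_comp.
pose h x := f x * (normal_pdf 0 s x)%:E.
transitivity (\int[mu]_x h (- x)%R).
  by apply: eq_integral => x _; rewrite /h normal_pdf0N.
have mh : measurable_fun setT h.
  by apply: emeasurable_funM => //; apply/measurable_EFinP; exact: measurable_normal_pdf.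
transitivity (\int[pushforward mu (-%R : measurableTypeR R -> measurableTypeR R)]_x h x).
  rewrite ge0_integral_pushforward//=.
  by move=> x _; rewrite /h mule_ge0// lee_fin normal_pdf_ge0.
apply: eq_measure_integral => A mA _; exact: lebesgue_measureN.
Qed.

(** Change of variables u = a x + b y, w = c x + e y in the plane. The third equation says that u
    and w are uncorrelated, which makes the quadratic form in the exponent diagonal in (u, w). The
    map is performed as two one-dimensional affine substitutions with positive slopes, hence the
    signs required of [b] and of the determinant. *)
Lemma normal_linear_map s r s' r' (a b c e : R) (D E : set R) :
  (0 < s)%R -> (0 < r)%R -> (0 < s')%R -> (0 < r')%R ->
  (s' ^+ 2 = a ^+ 2 * s ^+ 2 + b ^+ 2 * r ^+ 2)%R ->
  (r' ^+ 2 = c ^+ 2 * s ^+ 2 + e ^+ 2 * r ^+ 2)%R ->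
  (a * c * s ^+ 2 + b * e * r ^+ 2 = 0)%R ->
  (0 < b)%R -> (0 < b * c - a * e)%R -> measurable D -> measurable E ->
  \int[normal_prob 0 s]_x \int[normal_prob 0 r]_y
     (\1_D (a * x + b * y) * \1_E (c * x + e * y))%R%:E =
  normal_prob 0 s' D * normal_prob 0 r' E.
Proof.
move=> s0 r0 s'0 r'0 s'E r'E ort b0 det0 mD mE.
pose det := (b * c - a * e)%R.
(* Lagrange's identity for the two variances, whose cross term vanishes by [ort]: the Jacobian is
   the ratio of the products of standard deviations. *)
have srE : (s' * r' = det * s * r)%R.
  apply/eqP; rewrite -(@eqrXn2 _ 2)//; last 2 first.
  - by rewrite mulr_ge0 ?ltW.
  - by rewrite !mulr_ge0 ?ltW.
  rewrite !exprMn s'E r'E; apply/eqP.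
  have -> : ((a ^+ 2 * s ^+ 2 + b ^+ 2 * r ^+ 2) *
    (c ^+ 2 * s ^+ 2 + e ^+ 2 * r ^+ 2) =
    det ^+ 2 * s ^+ 2 * r ^+ 2 + (a * c * s ^+ 2 + b * e * r ^+ 2) ^+ 2)%R.
    by rewrite /det; ring.
  by rewrite ort expr0n/= addr0.
have mp m : measurable_fun setT (fun x => normal_pdf 0 m x : R).
  exact: measurable_normal_pdf.
have mD' : measurable_fun setT (\1_D : R -> R) by exact: measurable_indic.
have mE' : measurable_fun setT (\1_E : R -> R) by exact: measurable_indic.
have i0 (F : set R) x : (0 <= \1_F x :> R)%R by rewrite indicE.
pose k (x y : R) : R :=
  (\1_D (a * x + b * y) * \1_E (c * x + e * y) *
  (normal_pdf 0 s x * normal_pdf 0 r y))%R.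
have k0 x y : (0 <= k x y)%R by rewrite /k !mulr_ge0// ?i0 ?normal_pdf_ge0.
have mlin (p q : R) d (T : measurableType d) (u v : T -> R) :
    measurable_fun setT u -> measurable_fun setT v ->
    measurable_fun setT (fun x => (p * u x + q * v x)%R).
  by move=> mu_ mv; apply: measurable_funD; apply: measurable_funM.
have mlin1 p q x : measurable_fun [set: R] (fun y : R => (p * x + q * y)%R).
  by apply: (mlin p q _ _ (cst x) id).
have mlin2 p q : measurable_fun [set: R * R] (fun z => (p * z.1 + q * z.2)%R).
  by apply: (mlin p q _ _ fst snd).
have mk d (T : measurableType d) (u v : T -> R) :
    measurable_fun setT u -> measurable_fun setT v ->
    measurable_fun setT (fun x => k (u x) (v x)).
  move=> mu_ mv; apply: measurable_funM; apply: measurable_funM.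
  - exact: (measurableT_comp mD' (mlin _ _ _ _ _ _ mu_ mv)).
  - exact: (measurableT_comp mE' (mlin _ _ _ _ _ _ mu_ mv)).
  - exact: (measurableT_comp (mp s) mu_).
  - exact: (measurableT_comp (mp r) mv).
have mEk d (T : measurableType d) (u v : T -> R) :
    measurable_fun setT u -> measurable_fun setT v ->
    measurable_fun setT (fun x => (k (u x) (v x))%:E).
  by move=> *; apply/measurable_EFinP; exact: mk.
have mDE (x : R) : measurable_fun [set: R]
    (fun y : R => (\1_D (a * x + b * y) * \1_E (c * x + e * y))%:E : \bar R).
  apply/measurable_EFinP; apply: measurable_funM.
  - exact: (measurableT_comp mD' (mlin1 a b x)).
  - exact: (measurableT_comp mE' (mlin1 c e x)).
transitivity (\int[mu]_x \int[mu]_y (k x y)%:E).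
  rewrite integral_normal_prob; last 2 first.
  - pose F (z : R * R) := (\1_D (a * z.1 + b * z.2) * \1_E (c * z.1 + e * z.2))%:E : \bar R.
    have mF : measurable_fun setT F.
      apply/measurable_EFinP; apply: measurable_funM.
      * exact: (measurableT_comp mD' (mlin2 a b)).
      * exact: (measurableT_comp mE' (mlin2 c e)).
    have F0 z : 0 <= F z by rewrite lee_fin mulr_ge0.
    exact: (measurable_fun_fubini_tonelli_F (m2 := normal_prob 0 r) F mF F0).
  - by move=> x; apply: integral_ge0 => y _; rewrite lee_fin mulr_ge0.
  apply: eq_integral => x _.
  rewrite integral_normal_prob//.
  rewrite muleC -ge0_integralZl//=.
  - by apply: eq_integral => y _; rewrite -!EFinM; congr EFin; rewrite /k; ring.
  - by apply: emeasurable_funM; [exact: mDE|apply/measurable_EFinP; exact: mp].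
  - by move=> y _; rewrite -EFinM lee_fin !mulr_ge0// ?normal_pdf_ge0.
  - by rewrite lee_fin normal_pdf_ge0.
(* First substitution, with x fixed: y = (u - a x) / b. *)
transitivity (\int[mu]_x \int[mu]_u
    ((b^-1)%:E * (k x (b^-1 * u + - (a * x / b)))%:E)).
  apply: eq_integral => x _.
  have bV0 : (0 < b^-1)%R by rewrite invr_gt0.
  rewrite ge0_integralZl//=.
  - rewrite (ge0_integral_affine _ (f := fun y => (k x y)%:E))//.
    + by rewrite invrK muleA -EFinM mulVf ?mul1e// lt0r_neq0.
    + by apply: (mEk _ _ (cst x) id).
    + by move=> y; rewrite lee_fin.
  - apply: (mEk _ _ (cst x) (fun u => b^-1 * u + - (a * x / b))%R) => //.
    by apply: measurable_funD => //; exact: measurable_funM.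
  - by move=> y _; rewrite lee_fin.
  - by rewrite lee_fin ltW.
rewrite (fubini_tonelli (m1 := mu) (m2 := mu)
  (fun z => (b^-1)%:E * (k z.1 (b^-1 * z.2 + - (a * z.1 / b)))%:E)); last 2 first.
- apply: emeasurable_funM => //; apply: (mEk _ _ fst (fun z => b^-1 * z.2 + - (a * z.1 / b))%R) => //.
  apply: measurable_funD => //; first exact: measurable_funM.
  apply: measurableT_comp => //; apply: measurable_funM => //.
  exact: measurable_funM.
- by move=> z; rewrite mule_ge0// lee_fin// invr_ge0 ltW.
(* Second substitution, with u fixed: after the exchange of integrals, w is affine in x with slope
   [det / b], so x = (b w - e u) / [det]. *)
transitivity (\int[mu]_u \int[mu]_w
   ((\1_D u * normal_pdf 0 s' u) * (\1_E w * normal_pdf 0 r' w))%:E).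
  apply: eq_integral => u _.
  have q0 : (0 < b / det)%R by rewrite divr_gt0.
  pose h x := (b^-1)%:E * (k x (b^-1 * u + - (a * x / b)))%:E.
  have mh : measurable_fun setT h.
    apply: emeasurable_funM => //; apply: (mEk _ _ id (fun x => b^-1 * u + - (a * x / b))%R) => //.
    apply: measurable_funD => //; apply: measurableT_comp => //.
    by apply: measurable_funM => //; exact: measurable_funM.
  have h0 x : 0 <= h x by rewrite mule_ge0// lee_fin// invr_ge0 ltW.
  transitivity (\int[mu]_w ((b / det)%:E * h ((b / det) * w + - (e * u / det))%R)).
    rewrite -[LHS]/(\int[mu]_x h x) [RHS]ge0_integralZl//.
    - rewrite (ge0_integral_affine _ (f := h))// muleA -EFinM divff ?mul1e//.
      exact: lt0r_neq0.
    - by apply: measurableT_comp => //; apply: measurable_funD => //; exact: measurable_funM.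
    - by rewrite lee_fin ltW.
  apply: eq_integral => w _; rewrite /h -!EFinM; congr EFin.
  have bn0 : (b != 0)%R by rewrite lt0r_neq0.
  have dn0 : (det != 0)%R by rewrite lt0r_neq0.
  set x := (_ * w + _)%R; set y := (_ * u + _)%R.
  have -> : k x y = (\1_D u * \1_E w * (normal_pdf 0 s x * normal_pdf 0 r y))%R.
    rewrite /k; congr (\1_D _ * \1_E _ * _)%R; rewrite /y /x.
      by field; rewrite ?bn0 ?dn0.
    by rewrite /det in dn0 *; field; rewrite ?bn0 ?dn0.
  have xE : (x = (b * w - e * u) / det)%R by rewrite /x; field; rewrite ?dn0.
  have yE : (y = (c * u - a * w) / det)%R.
    by rewrite /y xE /det in dn0 *; field; rewrite bn0 dn0.
  suff -> : (normal_pdf 0 s x * normal_pdf 0 r y =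
      det * (normal_pdf 0 s' u * normal_pdf 0 r' w))%R by field; rewrite bn0 dn0.
  rewrite !normal_pdf0E//.
  have sn0 := lt0r_neq0 s0; have rn0 := lt0r_neq0 r0.
  have s'n0 := lt0r_neq0 s'0; have r'n0 := lt0r_neq0 r'0.
  have pn0 : (Num.sqrt (pi *+ 2) != 0 :> R)%R.
    by rewrite lt0r_neq0// sqrtr_gt0 mulrn_wgt0// pi_gt0.
  rewrite mulrACA -expRD -invfM [in RHS]mulrACA -expRD -invfM.
  rewrite [X in (X^-1 * expR _)%R](_ : _ = s * r * Num.sqrt (pi *+ 2) ^+ 2)%R; last by ring.
  rewrite [X in (_ * (X^-1 * _))%R](_ : _ = s' * r' * Num.sqrt (pi *+ 2) ^+ 2)%R; last by ring.
  rewrite srE mulrA; congr (_ * expR _)%R.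
    by field; rewrite dn0 sn0 rn0 pn0.
  have -> : (- (x ^+ 2 / (s ^+ 2 * 2)) - y ^+ 2 / (r ^+ 2 * 2) =
     - ((x * r) ^+ 2 + (y * s) ^+ 2) / ((s * r) ^+ 2 * 2))%R by field; rewrite sn0 rn0.
  have -> : (- (u ^+ 2 / (s' ^+ 2 * 2)) - w ^+ 2 / (r' ^+ 2 * 2) =
     - ((u ^+ 2 * r' ^+ 2) + (w ^+ 2 * s' ^+ 2)) / ((s' * r') ^+ 2 * 2))%R.
    by field; rewrite s'n0 r'n0.
  rewrite srE s'E r'E xE yE.
  have -> : (((b * w - e * u) / det * r) ^+ 2 + ((c * u - a * w) / det * s) ^+ 2 =
     (u ^+ 2 * (c ^+ 2 * s ^+ 2 + e ^+ 2 * r ^+ 2) +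
      w ^+ 2 * (a ^+ 2 * s ^+ 2 + b ^+ 2 * r ^+ 2) -
      2 * u * w * (a * c * s ^+ 2 + b * e * r ^+ 2)) / det ^+ 2)%R by field; rewrite ?dn0.
  rewrite ort mulr0 subr0.
  by field; rewrite dn0 sn0 rn0.
have Nint m F : measurable F -> (0 < m)%R ->
    \int[mu]_w (\1_F w * normal_pdf 0 m w)%:E = normal_prob 0 m F.
  move=> mF m0; rewrite /normal_prob [RHS]integral_mkcond.
  apply: eq_integral => w _; rewrite indicE patchE.
  by case: ifPn => _; rewrite ?mul1r ?mul0r.
under eq_integral => u _.
  under eq_integral do rewrite EFinM.
  rewrite ge0_integralZl//=; last 3 first.
  - by apply/measurable_EFinP; apply: measurable_funM => //; exact: mp.
  - by move=> w _; rewrite lee_fin mulr_ge0// normal_pdf_ge0.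
  - by rewrite lee_fin mulr_ge0// normal_pdf_ge0.
  rewrite Nint// muleC.
  over.
rewrite ge0_integralZl//=.
- by rewrite Nint// muleC.
- by apply/measurable_EFinP; apply: measurable_funM => //; exact: mp.
- by move=> w _; rewrite lee_fin mulr_ge0// normal_pdf_ge0.
Qed.

End normal_laws.

Lemma integral_is_derive (R : realType) (F f : R -> R) (a b : R) : a < b ->
  {in `[a, b], forall x, is_derive x (1 : R) F (f x)} ->
  {within `[a, b], continuous f} ->
  (\int[lebesgue_measure]_(x in `[a, b]) (f x)%:E = (F b - F a)%:E)%E.
Proof.
move=> ab Ff cf.
have cF x : x \in `[a, b] -> {for x, continuous F}.
  by move=> /Ff[dF _]; exact/differentiable_continuous/derivable1_diffP.
have aab : a \in `[a, b] by rewrite in_itv/= lexx ltW.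
have bab : b \in `[a, b] by rewrite in_itv/= lexx ltW.
rewrite EFinB; apply: continuous_FTC2 => //.
- split.
  + by move=> x xab; have [] := Ff x (subset_itv_oo_cc xab).
  + exact: cvg_at_right_filter (cF a aab).
  + exact: cvg_at_left_filter (cF b bab).
- by move=> x xab; have := Ff x (subset_itv_oo_cc xab) => ?; rewrite derive1E derive_val.
Qed.

(** * Even moments of centred Gaussian laws *)

Section normal_moments.
Local Open Scope ereal_scope.
Context (R : realType).
Notation mu := (@lebesgue_measure R).
Variables (s : R) (s0 : (0 < s)%R).

Let e : R -> R := normal_pdf 0 s.

Let is_derive_e (x : R) : is_derive x (1 : R)%R e (- x / s ^+ 2 * e x)%R.
Proof.
have -> : e = (fun x => (s * Num.sqrt (pi *+ 2))^-1 *
    expR (- (x ^+ 2 / (s ^+ 2 * 2))))%R.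
  by apply/funext => y; rewrite /e normal_pdf0E.
have sn0 : s != 0%R by rewrite lt0r_neq0.
apply: is_derive_eq; rewrite /= !scaler1 /GRing.scale/=.
set E := expR _; set c := (_^-1)%R.
by field; exact: sn0.
Qed.

(** The integral of the derivative of [F j] over a symmetric interval is a boundary term that tends
    to 0; its two summands give the recursion between consecutive even moments. *)
Let F j x := (x ^+ j.*2.+1 * e x)%R.
Let f j x := (j.*2.+1%:R * x ^+ j.*2 * e x - x ^+ j.+1.*2 / s ^+ 2 * e x)%R.

Let is_derive_F j (x : R) : is_derive x (1 : R)%R (F j) (f j x).
Proof.
have De := is_derive_e x.
have Dp : is_derive x (1 : R)%R (fun y : R => y ^+ j.*2.+1)%R
    (j.*2.+1%:R * x ^+ j.*2)%R.
  apply: DeriveDef; first exact: exprn_derivable.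
  by rewrite exp_derive /GRing.scale/= mulr1.
have := is_deriveM Dp De; rewrite /F /f => D.
apply: (is_derive_eq D); rewrite /GRing.scale/= doubleS !exprS.
have sn0 : s != 0%R by rewrite lt0r_neq0.
by field; exact: sn0.
Qed.

Let ce : continuous e.
Proof. by apply: continuous_normal_pdf; rewrite lt0r_neq0. Qed.

Let cf j : continuous (f j).
Proof.
move=> x; apply: cvgB; apply: cvgM; try exact: ce.
  by apply: cvgM; [exact: cvg_cst|exact: exprn_continuous].
by apply: cvgM; [exact: exprn_continuous|exact: cvg_cst].
Qed.

(** The term of order j + 1 in the exponential series at n^2 / (2 s^2) beats n^(2 j + 1) by one
    factor n. *)
Let F_cvg0 j : F j n%:R @[n --> \oo] --> 0%R.
Proof.
pose C := ((s * Num.sqrt (pi *+ 2))^-1 * (j.+1`!%:R * (s ^+ 2 * 2) ^+ j.+1))%R.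
have c0 : (0 <= (s * Num.sqrt (pi *+ 2))^-1)%R.
  by rewrite invr_ge0 mulr_ge0 ?ltW// sqrtr_gt0 mulrn_wgt0// pi_gt0.
apply: (@squeeze_cvgr _ _ _ _ (cst 0%R) (fun n : nat => C * (n%:R)^-1)%R).
- near=> n.
  have n0 : (0 < n%:R :> R)%R by near: n; exact: nbhs_infty_gtr.
  apply/andP; split; first by rewrite mulr_ge0 ?normal_pdf_ge0// exprn_ge0// ltW.
  rewrite /F /e normal_pdf0E// mulrCA /C -[leRHS]mulrA ler_wpM2l// expRN.
  rewrite ler_pdivrMr ?expR_gt0//.
  set y := (n%:R ^+ 2 / (s ^+ 2 * 2))%R.
  have y0 : (0 <= y)%R by rewrite divr_ge0 ?sqr_ge0// mulr_ge0 ?sqr_ge0.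
  have H := expR_ge1Dxn j y0.
  have {}H : (y ^+ j.+1 / j.+1`!%:R <= expR y)%R by rewrite (le_trans _ H)// lerDr.
  apply: (le_trans _ (ler_wpM2l _ H)); last first.
    rewrite !mulr_ge0// ?invr_ge0 ?(ltW n0)// exprn_ge0// mulr_ge0//.
    by rewrite exprn_ge0// ltW.
  rewrite /y expr_div_n.
  have sn0 : s != 0%R by rewrite lt0r_neq0.
  have -> : (n%:R ^+ 2 ^+ j.+1 = n%:R ^+ j.*2.+1 * n%:R :> R)%R.
    by rewrite -exprM -exprSr mul2n.
  have d0 : ((s ^+ 2 * 2) ^+ j.+1 != 0)%R.
    by rewrite expf_neq0// mulf_neq0// expf_neq0.
  have fn0 : (j.+1`!%:R != 0 :> R)%R by rewrite pnatr_eq0 -lt0n fact_gt0.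
  rewrite le_eqVlt; apply/orP; left; apply/eqP.
  move: (_ ^+ j.+1)%R d0 => p d0; move: (n%:R ^+ _)%R => q.
  by field; rewrite fn0 d0 lt0r_neq0.
- exact: cvg_cst.
- rewrite -(mulr0 C); apply: cvgM; first exact: cvg_cst.
  apply/gtr0_cvgV0; last exact: cvgr_idn. exact: nbhs_infty_gtr.
Unshelve. all: by end_near.
Qed.

Let itv (n : nat) : set R := `[(- n.+1%:R)%R, n.+1%:R]%classic.

Let bigcup_itv : \bigcup_n itv n = setT.
Proof.
rewrite -subTset => x _; exists (Num.bound `|x|) => //=.
rewrite /itv/= in_itv/= -ler_norml ltW// (lt_le_trans (archi_boundP _))//.
by rewrite ler_nat.
Qed.

Let itv_cvg (g : R -> R) : continuous g -> (forall x, 0 <= g x)%R ->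
  \int[mu]_(x in itv n) (g x)%:E @[n --> \oo] --> \int[mu]_x (g x)%:E.
Proof.
move=> cg g0; rewrite -bigcup_itv; apply: ge0_nondecreasing_set_cvg_integral.
- move=> m n mn; rewrite subsetEset; apply: subset_itv; rewrite bnd_simp.
    by rewrite lerN2 ler_nat ltnS.
  by rewrite ler_nat ltnS.
- by move=> n; exact: measurable_itv.
- move=> n; apply/measurable_EFinP; apply: measurable_funTS.
  exact: continuous_measurable_fun.
- by move=> n x _; rewrite lee_fin.
Qed.

Let itv_integrable (g : R -> R) n : continuous g ->
  mu.-integrable (itv n) (EFin \o g).
Proof.
move=> cg; apply: continuous_compact_integrable; first exact: segment_compact.
exact: continuous_subspaceT.
Qed.

Let a j x := (j.*2.+1%:R * x ^+ j.*2 * e x)%R.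
Let b j x := (x ^+ j.+1.*2 / s ^+ 2 * e x)%R.

Let ca j : continuous (a j).
Proof.
move=> x; apply: cvgM; last exact: ce.
by apply: cvgM; [exact: cvg_cst|exact: exprn_continuous].
Qed.

Let cb j : continuous (b j).
Proof.
move=> x; apply: cvgM; last exact: ce.
by apply: cvgM; [exact: exprn_continuous|exact: cvg_cst].
Qed.

Let a_ge0 j x : (0 <= a j x)%R.
Proof.
by rewrite /a !mulr_ge0 ?normal_pdf_ge0// exprn_even_ge0// odd_double.
Qed.

Let b_ge0 j x : (0 <= b j x)%R.
Proof.
apply: mulr_ge0; last exact: normal_pdf_ge0.
apply: divr_ge0; last exact: sqr_ge0.
by rewrite exprn_even_ge0// odd_double.
Qed.

Let moment_parts j n : \int[mu]_(x in itv n) (b j x)%:E =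
  \int[mu]_(x in itv n) (a j x)%:E - (2 * F j n.+1%:R)%:E.
Proof.
have ab : ((- n.+1%:R)%R < n.+1%:R :> R)%R by rewrite gtrN.
have := @integral_is_derive _ (F j) (f j) _ _ ab (in1W (is_derive_F j)).
move=> /(_ (continuous_subspaceT (@cf j))).
rewrite -/(itv n).
under eq_integral do rewrite /f EFinB -/(a j _) -/(b j _).
rewrite integralB//=; last 3 first.
- exact: measurable_itv.
- exact: itv_integrable.
- exact: itv_integrable.
have -> : F j (- n.+1%:R)%R = (- F j n.+1%:R)%R.
  by rewrite /F /e normal_pdf0N// exprNn -signr_odd oddS odd_double expr1 mulN1r mulNr.
have -> : (F j n.+1%:R - - F j n.+1%:R = 2 * F j n.+1%:R)%R by ring.
move=> H; rewrite EFinN -H.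
have afin : \int[mu]_(x in itv n) (a j x)%:E \is a fin_num.
  by apply: integrable_fin_num => //; [exact: measurable_itv|exact: itv_integrable].
have bfin : \int[mu]_(x in itv n) (b j x)%:E \is a fin_num.
  by apply: integrable_fin_num => //; [exact: measurable_itv|exact: itv_integrable].
rewrite -(fineK afin) -(fineK bfin) -!EFinB; congr EFin; ring.
Qed.

Let I j := \int[mu]_x ((x ^+ j.*2)%R * e x)%:E.

Let IE (c : R) (g : R -> R) j : (0 <= c)%R ->
  (forall x, g x = c * (x ^+ j.*2 * e x))%R -> \int[mu]_x (g x)%:E = c%:E * I j.
Proof.
move=> c0 gE; rewrite -ge0_integralZl//=.
- by apply: eq_integral => x _; rewrite gE EFinM.
- apply/measurable_EFinP; apply: measurable_funM; first exact: measurable_funX.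
  exact: measurable_normal_pdf.
- move=> x _; rewrite lee_fin mulr_ge0 ?normal_pdf_ge0// exprn_even_ge0//.
  by rewrite odd_double.
Qed.

(** Finiteness of [I j] makes the limit of the difference in [moment_parts] meaningful; each
    application of the recursion supplies it for the next moment. *)
Let moment_rec j : I j \is a fin_num -> I j.+1 = ((s ^+ 2) * j.*2.+1%:R)%:E * I j.
Proof.
move=> Ij.
have Va : \int[mu]_x (a j x)%:E = j.*2.+1%:R%:E * I j.
  by apply: IE => // x; rewrite /a mulrA.
have Vb : \int[mu]_x (b j x)%:E = (s ^- 2)%:E * I j.+1.
  by apply: IE => [|x]; [rewrite invr_ge0 sqr_ge0|rewrite /b mulrAC [in RHS]mulrC].
have h1 := itv_cvg (@cb j) (b_ge0 j).
have h2 := itv_cvg (@ca j) (a_ge0 j).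
have F0 : (2 * F j n.+1%:R)%:E @[n --> \oo] --> (0%R)%:E.
  apply: cvg_EFin; first exact: nearW.
  rewrite -(mulr0 2%R); apply: cvgM; first exact: cvg_cst.
  by have := F_cvg0 j; rewrite -(cvg_shiftS (fun n => F j n%:R)).
have h3 : \int[mu]_(x in itv n) (b j x)%:E @[n --> \oo] --> \int[mu]_x (a j x)%:E.
  rewrite (_ : (fun n => _) = fun n => \int[mu]_(x in itv n) (a j x)%:E -
      (2 * F j n.+1%:R)%:E); last by apply/funext => n; exact: moment_parts.
  rewrite -(sube0 (\int[mu]_x (a j x)%:E)).
  by apply: cvgeB => //; rewrite fin_num_adde_defl// fin_numN.
have sn0 : (s ^+ 2 != 0)%R by rewrite expf_neq0// lt0r_neq0.
have : \int[mu]_x (b j x)%:E = \int[mu]_x (a j x)%:E.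
  exact: (cvg_unique _ h1 h3).
rewrite Va Vb => /(congr1 (fun z => (s ^+ 2)%:E * z)).
by rewrite !muleA -!EFinM divff// mul1e.
Qed.

Let I0 : I 0 = 1.
Proof.
rewrite -[RHS](@integral_normal_pdf R 0 s); apply: eq_integral => x _.
by rewrite expr0 mul1r.
Qed.

Let I1 : I 1 = (s ^+ 2)%:E.
Proof. by rewrite moment_rec I0// mulr1 mule1. Qed.

Let normal_momentE j : \int[normal_prob 0 s]_x (x ^+ j.*2)%:E = I j.
Proof.
rewrite integral_normal_prob//.
- by apply/measurable_EFinP; exact: measurable_funX.
- by move=> x; rewrite lee_fin exprn_even_ge0// odd_double.
Qed.

Lemma normal_moment2 : \int[normal_prob 0 s]_x (x ^+ 2)%:E = (s ^+ 2)%:E.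
Proof. by rewrite -I1 -normal_momentE. Qed.

Lemma normal_moment4 : \int[normal_prob 0 s]_x (x ^+ 4)%:E = (3 * s ^+ 4)%:E.
Proof.
rewrite (normal_momentE 2) moment_rec I1// -EFinM; congr EFin.
by rewrite -[1.*2.+1]/3%N; ring.
Qed.

End normal_moments.

(** * Integrals of functions of independent variables *)

Section independent_integrals.
Local Open Scope ereal_scope.
Context d (T : measurableType d) (R : realType) (P : probability T R).

Lemma ge0_integral_indep d' (U : measurableType d') (nu : probability U R)
    (A : set T) (Y : T -> U) (f : U -> \bar R) :
  measurable A -> measurable_fun setT Y ->
  (forall D, measurable D -> P (A `&` Y @^-1` D) = P A * nu D) ->
  measurable_fun setT f -> (forall x, 0 <= f x) ->
  \int[P]_(w in A) f (Y w) = P A * \int[nu]_y f y.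
Proof.
move=> mA mY AY mf f0.
rewrite (@ge0_integral_joint _ _ _ P _ unit _ U A mA (cst tt) Y nu _ mY _
  (fun z => f z.2))//.
- rewrite -[LHS]/(\int[P]_(w in A) cst (\int[nu]_y f y) w).
  by rewrite integral_cst// muleC.
- move=> D E _ mE; rewrite preimage_cst; case: ifPn => _.
    by rewrite setTI setIT AY.
  by rewrite set0I setI0 measure0 mul0e.
- by apply: measurableT_comp.
Qed.

(** The positive and negative parts of X g(Y) are disintegrated separately by Tonelli. With X
    frozen, their inner integrals coincide because g is centred, so the outer difference is zero. *)
Lemma integral_indep_mul d' (U : measurableType d') (nu : probability U R)
    (X : T -> R) (Y : T -> U) (g : U -> R) :
  measurable_fun setT X -> measurable_fun setT Y -> measurable_fun setT g ->
  (forall D E, measurable D -> measurable E ->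
    P (X @^-1` D `&` Y @^-1` E) = P (X @^-1` D) * nu E) ->
  P.-integrable setT (EFin \o X) -> nu.-integrable setT (EFin \o g) ->
  \int[nu]_y (g y)%:E = 0 ->
  P.-integrable setT (fun w => (X w * g (Y w))%:E) /\
  \int[P]_w (X w * g (Y w))%:E = 0.
Proof.
move=> mX mY mg XY iX ig g0.
have joint f : measurable_fun setT f -> (forall x, 0 <= f x) ->
    \int[P]_w f (X w, Y w) = \int[P]_w \int[nu]_y f (X w, y).
  move=> mf f0; apply: ge0_integral_joint => // D E mD mE.
  by rewrite !setTI XY.
have mh : measurable_fun [set: R * U] (fun z => (z.1 * g z.2)%R).
  apply: measurable_funM => //; exact: measurableT_comp.
have mXY : measurable_fun setT (fun w => (X w * g (Y w))%R).
  by apply: measurable_funM => //; exact: measurableT_comp.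
have ig' x : nu.-integrable setT (fun y => (x * g y)%:E).
  have := integrableZl measurableT x ig.
  by apply: eq_integrable => // y _; rewrite /= EFinM.
have iXY : P.-integrable setT (fun w => (X w * g (Y w))%:E).
  apply/integrableP; split; first exact/measurable_EFinP.
  rewrite (joint (fun z => `|(z.1 * g z.2)%:E|)); last 2 first.
  - by apply: measurableT_comp => //; exact/measurable_EFinP.
  - by [].
  under eq_integral => w _.
    under eq_integral do rewrite /= normrM EFinM.
    rewrite ge0_integralZl//=; last first.
      by apply/measurable_EFinP; exact: measurableT_comp.
    over.
  rewrite /= ge0_integralZr//.
  - apply: lte_mul_pinfty; first exact: integral_ge0.
      rewrite ge0_fin_numE ?integral_ge0//.
      by move/integrableP : iX => [].
    by move/integrableP : ig => [].
  - by apply/measurable_EFinP; exact: measurableT_comp.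
  - exact: integral_ge0.
split => //.
rewrite integralE.
have mp : measurable_fun setT (fun z : R * U => (z.1 * g z.2)%:E : \bar R).
  exact/measurable_EFinP.
have jpos : \int[P]_w ((fun w => (X w * g (Y w))%:E) ^\+ w) =
          \int[P]_w \int[nu]_y ((fun y => (X w * g y)%:E) ^\+ y).
  pose h := (fun z : R * U => (z.1 * g z.2)%:E : \bar R)^\+.
  transitivity (\int[P]_w h (X w, Y w)).
    by apply: eq_integral => w _; rewrite /h !funeposE.
  rewrite (joint h); [|exact: measurable_funepos|by move=> z; rewrite /h funeposE le_max lexx orbT].
  by apply: eq_integral => w _; apply: eq_integral => y _; rewrite /h !funeposE.
have jneg : \int[P]_w ((fun w => (X w * g (Y w))%:E) ^\- w) =
          \int[P]_w \int[nu]_y ((fun y => (X w * g y)%:E) ^\- y).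
  pose h := (fun z : R * U => (z.1 * g z.2)%:E : \bar R)^\-.
  transitivity (\int[P]_w h (X w, Y w)).
    by apply: eq_integral => w _; rewrite /h !funenegE.
  rewrite (joint h); [|exact: measurable_funeneg|by move=> z; rewrite /h funenegE le_max lexx orbT].
  by apply: eq_integral => w _; apply: eq_integral => y _; rewrite /h !funenegE.
rewrite jpos jneg.
suff H w : \int[nu]_y ((fun y => (X w * g y)%:E) ^\+ y) =
         \int[nu]_y ((fun y => (X w * g y)%:E) ^\- y).
  under eq_integral do rewrite H.
  rewrite subee//.
  rewrite -jneg.
  rewrite ge0_fin_numE ?integral_ge0//.
  exact: integral_funeneg_lt_pinfty.
have : \int[nu]_y (X w * g y)%:E = 0.
  under eq_integral do rewrite EFinM.
  by rewrite integralZl// g0 mule0.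
have pf := integrable_pos_fin_num measurableT (ig' (X w)).
have nf := integrable_neg_fin_num measurableT (ig' (X w)).
rewrite integralE -(fineK pf) -(fineK nf) -EFinB => -[/eqP].
by rewrite subr_eq0 => /eqP ->.
Qed.

End independent_integrals.

Section normal_combination.
Local Open Scope ereal_scope.
Context d (T : measurableType d) (R : realType) (P : probability T R).
Variables (A : set T) (mA : measurable A) (X Y : T -> R) (s r : R).
Hypotheses (mX : measurable_fun setT X) (mY : measurable_fun setT Y).
Hypotheses (s0 : (0 < s)%R) (r0 : (0 < r)%R).
Hypothesis XYE : forall D E, measurable D -> measurable E ->
  P (A `&` (X @^-1` D `&` Y @^-1` E)) =
  P A * normal_prob 0 s D * normal_prob 0 r E.

(** [normal_linear_map] for random variables, on an event [A]. Since [A] is arbitrary in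
    applications, independence of a Gaussian pair from a sigma-algebra is inherited by any pair of
    uncorrelated combinations. *)
Lemma normal_combination (a b c e s' r' : R) :
  (0 < s')%R -> (0 < r')%R ->
  (s' ^+ 2 = a ^+ 2 * s ^+ 2 + b ^+ 2 * r ^+ 2)%R ->
  (r' ^+ 2 = c ^+ 2 * s ^+ 2 + e ^+ 2 * r ^+ 2)%R ->
  (a * c * s ^+ 2 + b * e * r ^+ 2 = 0)%R ->
  (0 < b)%R -> (0 < b * c - a * e)%R ->
  forall D E, measurable D -> measurable E ->
  P (A `&` ((fun w => a * X w + b * Y w)%R @^-1` D `&`
            (fun w => c * X w + e * Y w)%R @^-1` E)) =
  P A * normal_prob 0 s' D * normal_prob 0 r' E.
Proof.
move=> s'0 r'0 s'E r'E ort b0 det0 D E mD mE.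
have AX D' : measurable D' -> P (A `&` X @^-1` D') = P A * normal_prob 0 s D'.
  move=> mD'; have := XYE mD' measurableT.
  by rewrite preimage_setT setIT probability_setT mule1.
have mlin (p q : R) d1 (T1 : measurableType d1) (u v : T1 -> R) :
    measurable_fun setT u -> measurable_fun setT v ->
    measurable_fun setT (fun x => (p * u x + q * v x)%R).
  by move=> mu_ mv; apply: measurable_funD; apply: measurable_funM.
have mpre d1 (T1 : measurableType d1) (f : T1 -> R) F : measurable_fun setT f ->
    measurable F -> measurable (f @^-1` F).
  by move=> mf mF; rewrite -[X in measurable X]setTI; exact: mf.
have mDE : measurable ((fun w => a * X w + b * Y w)%R @^-1` D `&`
            (fun w => c * X w + e * Y w)%R @^-1` E).
  by apply: measurableI; apply: mpre => //; exact: mlin.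
pose f (z : R * R) : \bar R :=
  (\1_D (a * z.1 + b * z.2) * \1_E (c * z.1 + e * z.2))%:E.
have mf : measurable_fun setT f.
  apply/measurable_EFinP; apply: measurable_funM.
  - have H := mlin a b _ _ _ _ (@measurable_fst _ _ R R) (@measurable_snd _ _ R R).
    by apply: (measurableT_comp _ H); exact: measurable_indic.
  - have H := mlin c e _ _ _ _ (@measurable_fst _ _ R R) (@measurable_snd _ _ R R).
    by apply: (measurableT_comp _ H); exact: measurable_indic.
have f0 z : 0 <= f z by rewrite lee_fin mulr_ge0// indicE.
rewrite setIC -(integral_indic _ mA mDE).
transitivity (\int[P]_(w in A) f (X w, Y w)).
  apply: eq_integral => w _; rewrite /f !indicE -natrM mulnb; congr (_%:R%:E).
  by rewrite in_setI.
rewrite (ge0_integral_joint (nu := normal_prob 0 r) mA mX mY _ mf f0); last first.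
  by move=> D' E' mD' mE'; rewrite XYE// AX.
rewrite (@ge0_integral_indep _ _ _ _ _ _ (normal_prob 0 s) A X
  (fun x => \int[normal_prob 0 r]_y f (x, y)))//.
- by rewrite (normal_linear_map s0 r0 s'0 r'0)// muleA.
- exact: (measurable_fun_fubini_tonelli_F (m2 := normal_prob 0 r) f mf f0).
- by move=> x; exact: integral_ge0.
Qed.

End normal_combination.

(** * Absolutely continuous paths and measurable processes *)

Lemma EFin_Rintegral d (T : measurableType d) (R : realType)
    (m : {measure set T -> \bar R}) (D : set T) (f : T -> R) : measurable D ->
  m.-integrable D (EFin \o f) ->
  (\int[m]_(x in D) (f x)%:E)%E = (\int[m]_(x in D) f x)%:E.
Proof. by move=> mD fi; rewrite /Rintegral fineK//; exact: integrable_fin_num. Qed.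

Section integrable_EFin.
Context d (T : measurableType d) (R : realType) (m : {measure set T -> \bar R}).
Variables (D : set T) (mD : measurable D).
Implicit Types (f g : T -> R).

Lemma integrable_EFinD f g : m.-integrable D (EFin \o f) ->
  m.-integrable D (EFin \o g) -> m.-integrable D (EFin \o (fun x => f x + g x)).
Proof. by move=> fi gi; apply: eq_integrable (integrableD mD fi gi). Qed.

Lemma integrable_EFinB f g : m.-integrable D (EFin \o f) ->
  m.-integrable D (EFin \o g) -> m.-integrable D (EFin \o (fun x => f x - g x)).
Proof. by move=> fi gi; apply: eq_integrable (integrableB mD fi gi). Qed.

Lemma integrable_EFinZ c f : m.-integrable D (EFin \o f) ->
  m.-integrable D (EFin \o (fun x => c * f x)).
Proof. by move=> fi; apply: eq_integrable (integrableZl mD c fi). Qed.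

End integrable_EFin.

(** * Integration by parts for absolutely continuous paths *)

Section product_rule.
Context (R : realType).
Notation mu := (@lebesgue_measure R).
Implicit Types (f g : R -> R) (t : R).

Lemma primitive_bounded f t s : mu.-integrable `[0, t] (EFin \o f) ->
  s \in `[0, t] ->
  `|\int[mu]_(x in `[0, s]) f x| <= \int[mu]_(x in `[0, t]) `|f x|.
Proof.
move=> fi; rewrite in_itv/= => /andP[s0 st].
have sub : `[0, s] `<=` `[0, t] by apply: subset_itvl; rewrite bnd_simp.
have fis : mu.-integrable `[0, s] (EFin \o f) by apply: integrableS fi.
apply: (le_trans (le_normr_Rintegral _ fis)) => //.
rewrite -lee_fin -!EFin_Rintegral//.
- apply: ge0_subset_integral => //.
  by apply/measurable_EFinP; apply: measurableT_comp => //; apply/measurable_EFinP; exact: measurable_int fi.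
- exact: integrable_norm fi.
- exact: integrable_norm fis.
Qed.

Lemma primitive_continuous f t : mu.-integrable `[0, t] (EFin \o f) ->
  {within `[0, t], continuous (fun s => \int[mu]_(x in `[0, s]) f x)}.
Proof.
move=> fi; have [t0|t0] := leP 0 t; first exact: parameterized_integral_continuous.
by rewrite set_itv_ge ?bnd_simp -?ltNge//; exact: continuous_subspace0.
Qed.

Lemma integrable_mul_primitive f g t :
  mu.-integrable `[0, t] (EFin \o f) -> mu.-integrable `[0, t] (EFin \o g) ->
  mu.-integrable `[0, t] (EFin \o (fun s => f s * \int[mu]_(x in `[0, s]) g x)).
Proof.
move=> fi gi.
pose G s := \int[mu]_(x in `[0, s]) g x.
have -> : EFin \o (fun s => f s * G s) = ((EFin \o f) \* (EFin \o G))%E.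
  by apply/funext => s /=; rewrite EFinM.
apply: integrableMl => //.
- apply: subspace_continuous_measurable_fun => //; exact: primitive_continuous.
- exists (\int[mu]_(x in `[0, t]) `|g x|); split; first exact: num_real.
  move=> M; set B := (X in X < M) => BM s /= st; rewrite (le_trans _ (ltW BM))//.
  exact: primitive_bounded.
Qed.

(** Fubini for f(x) g(y) on the triangle y <= x: the slices in y give f G, the slices in x give
    (F(t) - F) g. This avoids differentiating the primitives, which are only absolutely
    continuous. *)
Lemma Rintegral_mul_primitive f g t : 0 <= t ->
  mu.-integrable `[0, t] (EFin \o f) -> mu.-integrable `[0, t] (EFin \o g) ->
  \int[mu]_(s in `[0, t])
    (f s * (\int[mu]_(x in `[0, s]) g x) + (\int[mu]_(x in `[0, s]) f x) * g s) =
  (\int[mu]_(x in `[0, t]) f x) * (\int[mu]_(x in `[0, t]) g x).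
Proof.
move=> t0 fi gi.
pose F s := \int[mu]_(x in `[0, s]) f x.
pose G s := \int[mu]_(x in `[0, s]) g x.
pose f1 := f \_ `[0, t]; pose g1 := g \_ `[0, t].
have f1i : mu.-integrable setT (EFin \o f1).
  by rewrite /f1 -restrict_EFin; apply/integrable_restrict => //=; rewrite setTI.
have g1i : mu.-integrable setT (EFin \o g1).
  by rewrite /g1 -restrict_EFin; apply/integrable_restrict => //=; rewrite setTI.
have mf1 : measurable_fun setT f1 by apply/measurable_EFinP; exact: measurable_int f1i.
have mg1 : measurable_fun setT g1 by apply/measurable_EFinP; exact: measurable_int g1i.
pose S : set (R * R) := [set z | z.2 <= z.1].
have mS : measurable S.
  by rewrite -[S]setTI; apply: measurable_fun_le.
pose h (z : R * R) : \bar R := (f1 z.1 * g1 z.2 * \1_S z)%:E.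
have mh : measurable_fun setT h.
  apply/measurable_EFinP; apply: measurable_funM; last exact: measurable_indic.
  by apply: measurable_funM; exact: measurableT_comp.
have mhx (x : R) : measurable_fun [set: R] (fun y : R => h (x, y)).
  exact: (measurableT_comp mh (pair1_measurable x)).
have hi : (mu \x mu)%E.-integrable setT h.
  apply/integrable12ltyP; first exact: mh.
  apply: (@le_lt_trans _ _ (\int[mu]_x (`|f1 x|%:E * \int[mu]_y `|g1 y|%:E))%E).
    apply: ge0_le_integral => //=.
    - by move=> x _; exact: integral_ge0.
    - apply: (measurable_fun_fubini_tonelli_F (m2 := mu) (fun z => `|h z|%E)) => //.
      exact: measurableT_comp.
    - apply: emeasurable_funM => //; apply/measurable_EFinP; exact: measurableT_comp.
    - move=> x _; rewrite -ge0_integralZl//=.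
      + apply: ge0_le_integral => //=.
        * apply/measurable_EFinP; apply: measurableT_comp => //.
          by apply/measurable_EFinP; exact: mhx.
        * by apply: emeasurable_funM => //; apply/measurable_EFinP; exact: measurableT_comp.
        * move=> y _; rewrite -EFinM lee_fin !normrM ler_piMr ?mulr_ge0//.
          by rewrite indicE; case: (_ \in _); rewrite ?normr1 ?normr0.
      + by apply/measurable_EFinP; exact: measurableT_comp.
  rewrite ge0_integralZr//=.
  - apply: lte_mul_pinfty; first exact: integral_ge0.
      rewrite ge0_fin_numE ?integral_ge0//.
      by move/integrableP : f1i => [].
    by move/integrableP : g1i => [].
  - by apply/measurable_EFinP; exact: measurableT_comp.
  - exact: integral_ge0.
have sub s : s <= t -> `[0, s] `<=` `[0, t] by move=> st; apply: subset_itvl; rewrite bnd_simp.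
have SE (x y : R) : ((x, y) \in S) = (y <= x) by apply/idP/idP; rewrite inE.
have inner1 x : (\int[mu]_y h (x, y))%E = ((fun x => f x * G x) \_ `[0, t] x)%:E.
  rewrite patchE; case: ifPn => xt; last first.
    rewrite integral0_eq// => y _; rewrite /h/= /f1 patchE (negbTE xt).
    by rewrite !mul0r.
  have {xt} : x \in `[0, t] by rewrite inE in xt.
  rewrite in_itv/= => /andP[x0 xt].
  have gix : mu.-integrable `[0, x] (EFin \o g) by apply: integrableS gi => //; exact: sub.
  rewrite /G EFinM -EFin_Rintegral// -integralZl// [RHS]integral_mkcond/=.
  apply: eq_integral => y _; rewrite /h/= !patchE /f1 /g1 !patchE !indicE.
  rewrite SE !mem_setE !in_itv/= x0 xt /=.
  have [y0|y0] := leP 0 y => /=; last by rewrite mulr0 mul0r.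
  have [yx|xy] := leP y x; first by rewrite (le_trans yx xt) mulr1 EFinM.
  by rewrite mulr0.
have inner2 y : (\int[mu]_x h (x, y))%E =
    ((fun y => (F t - F y) * g y) \_ `[0, t] y)%:E.
  rewrite patchE; case: ifPn => yt; last first.
    rewrite integral0_eq// => x _; rewrite /h/= /g1 patchE (negbTE yt).
    by rewrite mulr0 mul0r.
  have {yt} : y \in `[0, t] by rewrite inE in yt.
  rewrite in_itv/= => /andP[y0 yt].
  have fiy : mu.-integrable `[y, t] (EFin \o f).
    by apply: integrableS fi => //; apply: subset_itvr; rewrite bnd_simp.
  rewrite /F Rintegral_itvB//.
  rewrite Rintegral_itv_obnd_cbnd; last first.
    by apply: integrableS fiy => //; apply: subset_itvr; rewrite bnd_simp.
  rewrite EFinM -EFin_Rintegral// muleC -integralZl// [RHS]integral_mkcond/=.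
  apply: eq_integral => x _; rewrite /h/= !patchE /f1 /g1 !patchE !indicE.
  rewrite SE !mem_setE !in_itv/= y0 yt /=.
  have [xt|xt] := leP x t; rewrite ?andbF ?andbT/= ?mul0r//.
  have [yx|xy] := leP y x; first by rewrite (le_trans y0 yx) mulr1 mulrC EFinM.
  by rewrite mulr0.
have fG : mu.-integrable `[0, t] (EFin \o (fun s => f s * G s)).
  exact: integrable_mul_primitive.
have Fg : mu.-integrable `[0, t] (EFin \o (fun s => F s * g s)).
  have := integrable_mul_primitive gi fi.
  by apply: eq_integrable => // s _; rewrite /= mulrC.
have := Fubini hi.
under eq_integral do rewrite inner1.
under [in RHS]eq_integral do rewrite inner2.
have Ftg : mu.-integrable `[0, t] (EFin \o (fun s => F t * g s)).
  exact: integrable_EFinZ.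
have E1 (k : R -> R) : mu.-integrable `[0, t] (EFin \o k) ->
    (\int[mu]_x (k \_ `[0, t] x)%:E)%E = (\int[mu]_(x in `[0, t]) k x)%:E.
  move=> ki; rewrite -EFin_Rintegral// [RHS]integral_mkcond; apply: eq_integral => x _.
  by rewrite !patchE; case: ifPn.
rewrite !E1//; last first.
  have := integrable_EFinB (measurable_itv _ : measurable (`[0, t]%classic : set (measurableTypeR R))) Ftg Fg.
  by apply: eq_integrable => // s _; rewrite /= mulrBl.
move=> [H]; rewrite RintegralD// H.
have -> : \int[mu]_(y in `[0, t]) ((F t - F y) * g y) =
    \int[mu]_(y in `[0, t]) (F t * g y - F y * g y).
  by apply: eq_Rintegral => s _; rewrite mulrBl.
by rewrite RintegralB// RintegralZl// subrK.
Qed.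

End product_rule.

Section primitives.
Context (R : realType).
Notation mu := (@lebesgue_measure R).
Implicit Types (f g F G : R -> R) (k l : R).

(** [path_primitive] with an arbitrary initial value, so that deterministic coefficients such as
    [resid] and [riccati] belong to the class and products stay inside it. *)
Definition primitive_from k f F :=
  mu.-integrable `[0, 1] (EFin \o f) /\
  forall t, t \in `[0, 1] -> F t = k + \int[mu]_(s in `[0, t]) f s.

Lemma path_primitiveE f F : path_primitive f F <-> primitive_from 0 f F.
Proof.
by split=> -[fi H]; split => // t t01; have := H t t01; rewrite add0r.
Qed.

Lemma integrable_sub01 f t : t \in `[0, 1] ->
  mu.-integrable `[0, 1] (EFin \o f) -> mu.-integrable `[0, t] (EFin \o f).
Proof.
rewrite in_itv/= => /andP[_ t1]; apply: integrableS => //.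
by apply: subset_itvl; rewrite bnd_simp.
Qed.

Lemma primitive_from_continuous k f F : primitive_from k f F ->
  {within `[0, 1], continuous F}.
Proof.
move=> [fi FE].
have : {within `[0, 1], continuous (fun t => k + \int[mu]_(s in `[0, t]) f s)}.
  by move=> x; apply: cvgD; [exact: cvg_cst|exact: primitive_continuous].
by apply: subspace_eq_continuous => t; rewrite inE => /FE.
Qed.

Lemma eq_primitive_from k f g F G : primitive_from k f F ->
  {in `[0, 1], f =1 g} -> {in `[0, 1], F =1 G} -> primitive_from k g G.
Proof.
move=> [fi FE] fg FG; split.
  by apply: eq_integrable fi => // x; rewrite inE => x01; rewrite /= fg.
move=> t t01; rewrite -FG// FE//; congr (_ + _); apply: eq_Rintegral => s.
rewrite inE/= => st; apply: fg; move: t01 st; rewrite !in_itv/=.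
by move=> /andP[_ t1] /andP[-> st]; rewrite (le_trans st).
Qed.

Lemma primitive_from_cst k : primitive_from k (cst 0) (cst k).
Proof.
split; first exact: integrable0.
by move=> t _; rewrite Rintegral_cst// mul0r addr0.
Qed.

Lemma primitive_fromD k l f g F G : primitive_from k f F -> primitive_from l g G ->
  primitive_from (k + l) (f \+ g) (F \+ G).
Proof.
move=> [fi FE] [gi GE]; split.
  exact: integrable_EFinD.
move=> t t01; rewrite /= RintegralD//; try exact: integrable_sub01.
by rewrite FE// GE// addrACA.
Qed.

Lemma primitive_fromZ (c : R) k f F : primitive_from k f F ->
  primitive_from (c * k) (fun s => c * f s) (fun s => c * F s).
Proof.
move=> [fi FE]; split.
  exact: integrable_EFinZ.
move=> t t01; rewrite RintegralZl//; last exact: integrable_sub01.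
by rewrite FE// mulrDr.
Qed.

(** [Rintegral_mul_primitive] treats the parts that vanish at 0; the initial values enter by
    bilinearity. *)
Lemma primitive_fromM k l f g F G : primitive_from k f F -> primitive_from l g G ->
  primitive_from (k * l) (fun s => f s * G s + F s * g s) (fun s => F s * G s).
Proof.
move=> Ff Gg; have [fi FE] := Ff; have [gi GE] := Gg.
pose F0 s := \int[mu]_(x in `[0, s]) f x.
pose G0 s := \int[mu]_(x in `[0, s]) g x.
have F00 : primitive_from 0 f F0 by split => // t _; rewrite add0r.
have G00 : primitive_from 0 g G0 by split => // t _; rewrite add0r.
have FG0 : primitive_from 0 (fun s => f s * G0 s + F0 s * g s) (fun s => F0 s * G0 s).
  split.
    have i1 := integrable_mul_primitive fi gi.
    have i2 := integrable_mul_primitive gi fi.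
    apply: integrable_EFinD => //.
    by apply: eq_integrable i2 => // s _; rewrite /= mulrC.
  move=> t t01; rewrite add0r Rintegral_mul_primitive//.
  - by move: t01; rewrite in_itv/= => /andP[].
  - exact: integrable_sub01.
  - exact: integrable_sub01.
have := primitive_fromD (primitive_fromD (primitive_from_cst (k * l)) FG0)
  (primitive_fromD (primitive_fromZ k G00) (primitive_fromZ l F00)).
rewrite !mulr0 !addr0 => H; apply: (eq_primitive_from H) => t t01 /=;
  by rewrite FE// GE// -/(F0 t) -/(G0 t); ring.
Qed.

Lemma primitive_from_is_derive (f F : R -> R) :
  {in `[0, 1], forall x, is_derive x (1 : R) F (f x)} ->
  {within `[0, 1], continuous f} -> primitive_from (F 0) f F.
Proof.
move=> Ff cf; split.
  by apply: continuous_compact_integrable => //; exact: segment_compact.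
move=> t; rewrite in_itv/= => /andP[]; rewrite le_eqVlt => /predU1P[<- _|t0 t1].
  by rewrite set_itv1 Rintegral_set1 addr0.
have sub : `[0, t] `<=` `[0, 1] by apply: subset_itvl; rewrite bnd_simp.
rewrite /Rintegral (@integral_is_derive _ F f)//=.
- by rewrite addrC subrK.
- by move=> x xt; apply: Ff; exact: sub.
- exact: continuous_subspaceW cf.
Qed.

(** Lebesgue differentiation of the primitive of f - g, which is identically 0. It lets an arbitrary
    trading rate of the equilibrium strategy be replaced by the explicit one. *)
Lemma primitive_from_uniq k f g F : primitive_from k f F -> primitive_from k g F ->
  {ae mu, forall x, x \in `[0, 1] -> f x = g x}.
Proof.
move=> [fi FE] [gi GE].
pose h := (fun x => f x - g x) \_ `[0, 1].
have hi0 : mu.-integrable `[0, 1] (EFin \o (fun x => f x - g x)).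
  exact: integrable_EFinB.
have hi : mu.-integrable setT (EFin \o h).
  by rewrite /h -restrict_EFin; apply/integrable_restrict => //=; rewrite setTI.
have hloc : locally_integrable setT h by exact: integrable_locally_restrict.
have hy (y : R) : mu.-integrable [set` Interval (BLeft 0) (BRight y)] (EFin \o h).
  exact: integrableS hi.
have H0 t : 0 <= t -> \int[mu]_(x in `[0, t]) h x = 0.
  move=> t0; pose u := Num.min t 1.
  have u01 : u \in `[0, 1] by rewrite in_itv/= le_min t0 ler01/= ge_min lexx orbT.
  transitivity (\int[mu]_(x in `[0, u]) (f x - g x)).
    rewrite Rintegral_mkcond [RHS]Rintegral_mkcond; congr Rintegral.
    apply/funext => x; rewrite /h !patchE.
    have -> : (x \in `[0, u]%classic) = (x \in `[0, t]%classic) && (x \in `[0, 1]%classic).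
      by rewrite !mem_setE !in_itv/= le_min; case: (0 <= x).
    by case: (_ \in _) => //=; case: (_ \in _).
  rewrite RintegralB//; try exact: integrable_sub01.
  by apply/eqP; rewrite subr_eq0; apply/eqP/(addrI k); rewrite -FE// -GE.
(* Differentiation is available at points strictly to the right of 0, and the single point 0 is
   negligible. *)
have ae0 : {ae mu, forall x : R, x != 0}.
  exists [set 0]; split => //; first exact: lebesgue_measure_set1.
  by move=> x /= /negP; rewrite negbK => /eqP.
move: ae0 (FTC1 hy hloc); apply: filterS2; first exact: (ae_filter_ringOfSetsType mu).
move=> x x0 H x01.
have x0' : 0 < x by move: x01; rewrite in_itv/= lt_def x0 => /andP[].
have [_] := H x0'.
rewrite derive1E (@near_eq_derive _ _ _ _ (cst 0)); last first.
  near=> y; apply: H0; near: y.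
  by apply: filterS (lt_nbhsr x0') => y /ltW.
rewrite derive_cst /h patchE mem_set//.
by move=> /esym/eqP; rewrite subr_eq0 => /eqP.
Unshelve. all: by end_near.
Qed.

End primitives.

Lemma within_continuous_cvg (R : realType) (A : set R) (f : R -> R) (u : nat -> R) x :
  {within A, continuous f} -> A x -> (forall n, A (u n)) ->
  u n @[n --> \oo] --> x -> f (u n) @[n --> \oo] --> f x.
Proof.
move=> cf Ax Au ux; have /subspace_continuousP/(_ x Ax) := cf.
apply: cvg_trans => U /= [e e0 eU].
have [N _ HN] : \forall n \near \oo, ball x e (u n).
  by apply: ux; exact: nbhsx_ballx.
by exists N => // n Nn; apply: eU; [exact: HN|exact: Au].
Qed.

(** * Joint measurability in time and scenario *)

Section processes_measurability.
Context d (T : measurableType d) (R : realType).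
Notation mu := (@lebesgue_measure R).
Implicit Types (X : R -> T -> R) (b : R).

(** The process is the limit of its samples on the grid of step 1 / (n + 1), each of which is
    measurable on countably many strips. Rounding down keeps the sampled time in [0, b]. As [T] is
    generic, the lemma also applies to the scenarios equipped with a smaller sigma-algebra; this is
    how adaptedness of path integrals is obtained. *)
Lemma measurable_process X b :
  (forall s, s \in `[0, b] -> measurable_fun setT (X s)) ->
  (forall w, {within `[0, b], continuous (fun s => X s w)}) ->
  measurable_fun (`[0, b]%classic `*` [set: T]) (fun p => X p.1 p.2).
Proof.
move=> mX cX.
pose q n (s : R) : R := (Num.truncn (s * n.+1%:R))%:R / n.+1%:R.
have qP n s : 0 <= s -> 0 <= q n s <= s /\ s - n.+1%:R^-1 <= q n s.
  move=> s0; have sn0 : 0 <= s * n.+1%:R by rewrite mulr_ge0.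
  have /andP[h1 h2] := truncn_itv sn0.
  rewrite /q; split.
    by rewrite divr_ge0//= ler_pdivrMr.
  rewrite lerBlDr -[X in _ + X]mul1r -mulrDl ler_pdivlMr//.
  by apply: ltW; rewrite natr1.
have mXn n : measurable_fun (`[0, b]%classic `*` [set: T]) (fun p => X (q n p.1) p.2).
  pose E k : set (R * T) :=
    (`[0, b] `&` `[k%:R / n.+1%:R, k.+1%:R / n.+1%:R[)%classic `*` [set: T].
  have -> : `[0, b]%classic `*` [set: T] = \bigcup_k E k.
    apply/seteqP; split => [[s w] /= [sb _]|[s w] [k _ [[]]]//].
    exists (Num.truncn (s * n.+1%:R)) => //; split => //; split => //=.
    have s0 : 0 <= s by move: sb; rewrite in_itv/= => /andP[].
    have sn0 : 0 <= s * n.+1%:R by rewrite mulr_ge0.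
    have /andP[h1 h2] := truncn_itv sn0.
    by rewrite in_itv/= ler_pdivrMr// h1 ltr_pdivlMr.
  apply/measurable_fun_bigcup => k.
    by apply: measurableX => //; exact: measurableI.
  have [kb|kb] := boolP ((k%:R / n.+1%:R : R) \in `[0, b]).
    apply: (eq_measurable_fun (fun p => X (k%:R / n.+1%:R) p.2)); last first.
      apply: measurable_funTS; apply: (measurableT_comp (mX _ kb)).
      exact: measurable_snd.
    move=> [s w]; rewrite inE => -[[/= sb]]; rewrite !in_itv/= => /andP[ks sk] _.
    rewrite /q; congr (X (_%:R / _) _); apply/esym/truncn_def.
    by rewrite -ler_pdivrMr// ks -ltr_pdivlMr.
  have -> : E k = set0; last exact: measurable_fun_set0.
  apply/seteqP; split => // -[s w] [[/= sb]]; rewrite in_itv/= => /andP[ks _] _.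
  move/negP: kb; apply; rewrite in_itv/= divr_ge0//=.
  by move: sb; rewrite in_itv/= => /andP[_]; exact: le_trans.
apply: (measurable_fun_cvg mXn) => -[s w] [/= sb _].
have s0 : 0 <= s by move: sb; rewrite in_itv/= => /andP[].
have qb n : `[0, b]%classic (q n s).
  have [/andP[q0 qs] _] := qP n s s0.
  by move: sb; rewrite /= !in_itv/= q0 => /andP[_]; exact: le_trans.
have qcvg : q n s @[n --> \oo] --> s.
  apply: (@squeeze_cvgr _ _ _ _ (fun n => s - n.+1%:R^-1) (cst s)).
  - by apply: nearW => n; have [/andP[_ ->] ->] := qP n s s0.
  - rewrite -[X in _ --> X]subr0; apply: cvgB; first exact: cvg_cst.
    exact: cvg_harmonic.
  - exact: cvg_cst.
exact: (within_continuous_cvg (cX w)).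
Qed.

Lemma measurable_integral_param (f : R * T -> \bar R) : measurable_fun setT f ->
  measurable_fun setT (fun w => \int[mu]_s f (s, w))%E.
Proof.
move=> mf.
have -> : (fun w => \int[mu]_s f (s, w))%E =
  (fun w => \int[mu]_s f^\+ (s, w) - \int[mu]_s f^\- (s, w))%E.
  apply/funext => w; rewrite integralE; congr (_ - _)%E; apply: eq_integral => s _.
    by rewrite !funeposE.
  by rewrite !funenegE.
apply: emeasurable_funB.
- have := measurable_fun_fubini_tonelli_G (m1 := mu) (f^\+)%E (measurable_funepos mf).
  by apply=> ?; exact: funepos_ge0.
- have := measurable_fun_fubini_tonelli_G (m1 := mu) (f^\-)%E (measurable_funeneg mf).
  by apply=> ?; exact: funeneg_ge0.
Qed.

Lemma patch_process U (z : U) (f : R -> T -> U) (D : set R) s w :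
  (if (s, w) \in D `*` [set: T] then f s w else z) =
  if s \in D then f s w else z.
Proof.
by rewrite (_ : ((s, w) \in D `*` setT) = (s \in D))//;
  apply/idP/idP; rewrite !inE//= => -[].
Qed.

Lemma measurable_integral_process (f : R -> T -> \bar R) b :
  measurable_fun (`[0, b]%classic `*` [set: T]) (fun p => f p.1 p.2) ->
  measurable_fun setT (fun w => \int[mu]_(s in `[0%R, b]) f s w)%E.
Proof.
move=> mf.
have mD : measurable (`[0, b]%classic `*` [set: T]) by exact: measurableX.
have /(measurable_restrictT _ mD)/measurable_integral_param := mf.
apply: eq_measurable_fun => w _; rewrite [RHS]integral_mkcond.
by apply: eq_integral => s _; rewrite !patchE patch_process.
Qed.

Lemma measurable_Rintegral_process (f : R -> T -> R) b :
  measurable_fun (`[0, b]%classic `*` [set: T]) (fun p => f p.1 p.2) ->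
  measurable_fun setT (fun w => \int[mu]_(s in `[0, b]) f s w).
Proof.
move=> mf; apply: measurableT_comp; first exact: fine_measurable.
apply: (@measurable_integral_process (fun s w => (f s w)%:E)).
exact/measurable_EFinP.
Qed.

End processes_measurability.

(** * Exchanging time and expectation *)

Section processes_fubini.
Local Open Scope ereal_scope.
Context d (T : measurableType d) (R : realType) (P : probability T R).
Notation mu := (@lebesgue_measure R).

Lemma tonelli_process (f : R -> T -> \bar R) (b : R) :
  measurable_fun (`[0%R, b]%classic `*` [set: T]) (fun p => f p.1 p.2) ->
  (forall s w, 0 <= f s w) ->
  \int[P]_w \int[mu]_(s in `[0%R, b]) f s w = \int[mu]_(s in `[0%R, b]) \int[P]_w f s w.
Proof.
move=> mf f0.
have mD : measurable (`[0%R, b]%classic `*` [set: T]) by exact: measurableX.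
pose F := (fun p => f p.1 p.2) \_ (`[0%R, b]%classic `*` [set: T]).
have mF : measurable_fun setT F by exact/(measurable_restrictT _ mD).
have F0 p : 0 <= F p by rewrite /F patchE; case: ifPn.
have FE s w : F (s, w) = (f^~ w \_ `[0%R, b]) s by rewrite /F !patchE patch_process.
transitivity (\int[P]_w \int[mu]_s F (s, w)).
  by apply: eq_integral => w _; rewrite integral_mkcond; apply: eq_integral => s _.
rewrite -(fubini_tonelli (m1 := mu) (m2 := P) F)// [RHS]integral_mkcond.
apply: eq_integral => s _; rewrite patchE; case: ifPn => sb.
  by apply: eq_integral => w _; rewrite FE patchE sb.
by apply: integral0_eq => w _; rewrite FE patchE (negbTE sb).
Qed.

(** Integrability of the double integral gives integrability of almost every path and at almost
    every time only; both exceptional sets appear in the conclusion. *)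
Lemma fubini_process (f : R -> T -> R) (b : R) :
  measurable_fun (`[0%R, b]%classic `*` [set: T]) (fun p => f p.1 p.2) ->
  \int[mu]_(s in `[0%R, b]) \int[P]_w `|(f s w)%:E| < +oo ->
  [/\ {ae P, forall w, mu.-integrable `[0%R, b] (EFin \o f^~ w)},
      {ae mu, forall s, s \in `[0%R, b] -> P.-integrable setT (EFin \o f s)},
      P.-integrable setT (fun w => (\int[mu]_(s in `[0%R, b]) f s w)%:E)%R &
      \int[P]_w (\int[mu]_(s in `[0%R, b]) f s w)%:E%R =
      \int[mu]_(s in `[0%R, b]) \int[P]_w (f s w)%:E].
Proof.
move=> mf foo.
have mD : measurable (`[0%R, b]%classic `*` [set: T]) by exact: measurableX.
pose F0 := (fun p => (f p.1 p.2)%:E) \_ (`[0%R, b]%classic `*` [set: T]).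
have mF0 : measurable_fun setT F0.
  by apply/(measurable_restrictT _ mD); exact/measurable_EFinP.
pose sw (z : T * R) := (z.2, z.1).
have msw : measurable_fun setT sw by exact: measurable_fun_pair.
pose F := F0 \o sw.
have mF : measurable_fun setT F by exact: (measurableT_comp mF0 msw).
have FE s w : F (w, s) = ((EFin \o f^~ w) \_ `[0%R, b]) s.
  by rewrite /F /F0 /= !patchE (patch_process _ (fun s w => (f s w)%:E)).
have Fi : (P \x mu).-integrable setT F.
  apply/integrable21ltyP; first exact: mF.
  rewrite (le_lt_trans _ foo)// [leRHS]integral_mkcond le_eqVlt; apply/orP; left.
  apply/eqP/eq_integral => s _; rewrite patchE; case: ifPn => sb.
    by apply: eq_integral => w _; rewrite FE patchE sb.
  by apply: integral0_eq => w _; rewrite FE patchE (negbTE sb) abse0.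
have GE w : \int[mu]_s F (w, s) = \int[mu]_(s in `[0%R, b]) (f s w)%:E.
  by rewrite [RHS]integral_mkcond; apply: eq_integral.
have aeG := ae_integrable1 Fi.
have aeF := ae_integrable2 Fi.
have iG := integrable_fubini_F Fi.
have h1 : {ae P, forall w, mu.-integrable `[0%R, b] (EFin \o f^~ w)}.
  apply: filterS aeG => w /=; rewrite (_ : (fun x => F (w, x)) = (EFin \o f^~ w) \_ `[0%R, b]).
    by move/integrable_restrict; rewrite setTI; apply.
  by apply/funext => s; rewrite FE.
(* The real-valued integral is [fine] of the extended one, so the two agree where the path is
   integrable, that is, almost surely. *)
have fineE : {ae P, forall w, (\int[mu]_(s in `[0%R, b]) f s w)%:E%R =
    \int[mu]_s F (w, s)}.
  by apply: filterS h1 => w wi; rewrite GE EFin_Rintegral.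
split => //.
- apply: filterS aeF => s + sb; apply: eq_integrable => // w _.
  by rewrite FE patchE mem_set.
- apply: le_integrable iG => //.
    by apply/measurable_EFinP; exact: measurable_Rintegral_process.
  move=> w _; rewrite /Rintegral /fubini_F /= GE.
  by case: (\int[mu]_(s in _) _) => [r| |]//=; rewrite ?normr0 ?leey ?lee_fin.
- rewrite (ae_integral_eq fineE).
  transitivity (\int[P]_w fubini_F mu F w); first by [].
  rewrite integral12_prod_meas1// -integral21_prod_meas1// [RHS]integral_mkcond.
  apply: eq_integral => s _; rewrite patchE /fubini_G; case: ifPn => sb.
    by apply: eq_integral => w _; rewrite FE patchE sb.
  by apply: integral0_eq => w _; rewrite FE patchE (negbTE sb).
Qed.

End processes_fubini.

(** * A Wiener integral along Brownian paths *)

(* [resid L t] is the conditional variance of the standardised value given the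
   demand up to time [t]. *)
Definition resid (R : realType) (L t : R) : R := 1 - t * L ^+ 2.

(* Integration by parts of the Wiener integral of [1 / resid L] against [b]. *)
Definition wiener_path (R : realType) (L : R) (b : R -> R) (t : R) : R :=
  b t / resid L t -
  L ^+ 2 * \int[lebesgue_measure]_(s in `[0, t]) (b s / resid L s ^+ 2).

Section wiener_path.
Context (R : realType).
Notation mu := (@lebesgue_measure R).
Variables (L : R) (L0 : 0 < L) (L1 : L < 1).
Notation a := (resid L).

Lemma resid_gt0 t : t <= 1 -> 0 < a t.
Proof.
move=> t1; rewrite /resid subr_gt0; have [t0|t0] := leP 0 t; last first.
  by apply: lt_trans ltr01; rewrite pmulr_llt0// exprn_gt0.
apply: (@le_lt_trans _ _ (L ^+ 2)); first by rewrite ler_piMl ?sqr_ge0.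
by rewrite expr_lt1// ltW.
Qed.

Lemma resid_neq0 t : t <= 1 -> a t != 0.
Proof. by move=> t1; rewrite lt0r_neq0// resid_gt0. Qed.

Lemma resid0 : a 0 = 1.
Proof. by rewrite /resid mul0r subr0. Qed.

Lemma resid_lt s t : s < t -> a t < a s.
Proof. by move=> st; rewrite /resid ltrD2l ltrN2 ltr_pM2r// exprn_gt0. Qed.

Lemma resid_min t : t <= 1 -> 1 - L ^+ 2 <= a t.
Proof.
by move=> t1; rewrite /resid lerD2l lerN2 ler_piMl// sqr_ge0.
Qed.

Lemma is_derive_resid (t : R) : is_derive t (1 : R) a (- L ^+ 2).
Proof.
rewrite /resid; apply: is_derive_eq.
by rewrite /GRing.scale/=; ring.
Qed.

Lemma is_derive_residV (t : R) : t <= 1 ->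
  is_derive t (1 : R) (fun u => (a u)^-1) (L ^+ 2 / a t ^+ 2).
Proof.
move=> t1; have an0 := resid_neq0 t1.
have H := is_derive_resid t.
have := is_deriveV an0 H.
by move/is_derive_eq; apply; rewrite /GRing.scale/= mulrNN mulrC.
Qed.

Lemma continuous_resid : continuous a.
Proof.
move=> t; have [/derivable1_diffP/differentiable_continuous] := is_derive_resid t.
by [].
Qed.

Lemma continuous_residV (D : set R) : (forall t, D t -> t <= 1) ->
  {within D, continuous (fun t => (a t)^-1)}.
Proof.
move=> D1; apply: continuous_in_subspaceT => t; rewrite inE => /D1 t1.
by apply: cvgV; [exact: resid_neq0|exact: continuous_resid].
Qed.

Lemma continuous_residV2 (D : set R) : (forall t, D t -> t <= 1) ->
  {within D, continuous (fun t => (a t ^+ 2)^-1)}.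
Proof.
move=> D1; apply: continuous_in_subspaceT => t; rewrite inE => /D1 t1.
apply: cvgV; first by rewrite expf_neq0// resid_neq0.
by under eq_fun do rewrite expr2; rewrite expr2; apply: cvgM; exact: continuous_resid.
Qed.

Lemma integral_residV2 u v : u < v -> v <= 1 ->
  \int[mu]_(s in `[u, v]) (L ^+ 2 / a s ^+ 2) = (a v)^-1 - (a u)^-1.
Proof.
move=> uv v1; rewrite /Rintegral (@integral_is_derive _ (fun u => (a u)^-1))//.
  move=> x; rewrite in_itv/= => /andP[_ xv]; apply: is_derive_residV.
  exact: le_trans v1.
move=> x; apply: cvgM; first exact: cvg_cst.
apply: continuous_residV2 => t /=; rewrite in_itv/= => /andP[_ tv].
exact: le_trans v1.
Qed.

Variables (b : R -> R) (cb : {within `[0, 1], continuous b}).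

Lemma continuous_path_residV2 : {within `[0, 1], continuous (fun s => b s / a s ^+ 2)}.
Proof.
move=> x; apply: cvgM; first exact: cb.
by apply: continuous_residV2 => t /=; rewrite in_itv/= => /andP[].
Qed.

Lemma integrable_continuous01 (f : R -> R) : {within `[0, 1], continuous f} ->
  mu.-integrable `[0, 1] (EFin \o f).
Proof.
by move=> cf; apply: continuous_compact_integrable => //; exact: segment_compact.
Qed.

(** Two errors are made on a step: replacing the weight 1 / a(v) by an intermediate one, and
    freezing [b] at [b u] under the integral. Each costs at most [eps] times the increase of 1 /
    a. *)
Lemma wiener_path_step u v eps : 0 <= u -> u < v -> v <= 1 ->
  (forall x, u <= x <= v -> `|b x - b u| <= eps) ->
  `| (Num.sqrt (a u * a v))^-1 * (b v - b u) -
     (wiener_path L b v - wiener_path L b u) | <=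
  2 * eps * ((a v)^-1 - (a u)^-1).
Proof.
move=> u0 uv v1 beps.
have u1 : u <= 1 by exact: le_trans (ltW uv) v1.
have av0 := resid_gt0 v1; have au0 := resid_gt0 u1.
have auv := resid_lt uv.
have eps0 : 0 <= eps by rewrite (le_trans _ (beps v _))// lexx ltW.
have D0 : 0 <= (a v)^-1 - (a u)^-1 by rewrite subr_ge0 lef_pV2 ?posrE// ltW.
set e := (Num.sqrt _)^-1.
have eD : `|e - (a v)^-1| <= (a v)^-1 - (a u)^-1.
  have ua : a v <= Num.sqrt (a u * a v).
    rewrite -[leLHS]ger0_norm ?(ltW av0)// -sqrtr_sqr ler_sqrt ?sqr_ge0//.
      by rewrite expr2 ler_pM2r// ltW.
    by rewrite mulr_ge0 ?ltW.
  have va : Num.sqrt (a u * a v) <= a u.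
    rewrite -[leRHS]ger0_norm ?(ltW au0)// -sqrtr_sqr ler_sqrt ?sqr_ge0//.
    by rewrite expr2 ler_pM2l// ltW.
  have s0 : 0 < Num.sqrt (a u * a v) by exact: lt_le_trans ua.
  rewrite ler0_norm ?subr_le0 ?lef_pV2 ?posrE// opprB lerD2l lerN2.
  by rewrite /e lef_pV2 ?posrE.
have sub : `[u, v] `<=` `[0, 1].
  by apply: subset_itv; rewrite bnd_simp.
have iF := integrable_continuous01 continuous_path_residV2.
have iF0 : mu.-integrable `[0, v] (EFin \o (fun s => b s / a s ^+ 2)).
  by apply: integrableS iF => //; apply: subset_itvl; rewrite bnd_simp.
have iFuv : mu.-integrable `[u, v] (EFin \o (fun s => b s / a s ^+ 2)).
  exact: integrableS iF.
have iG : mu.-integrable `[u, v] (EFin \o (fun s => L ^+ 2 / a s ^+ 2)).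
  apply: continuous_compact_integrable; first exact: segment_compact.
  move=> x; apply: cvgM; first exact: cvg_cst.
  by apply: continuous_residV2 => t /=; rewrite in_itv/= => /andP[_ /le_trans]; exact.
have -> : wiener_path L b v - wiener_path L b u =
    (b v - b u) / a v + b u * ((a v)^-1 - (a u)^-1) -
    L ^+ 2 * \int[mu]_(s in `[u, v]) (b s / a s ^+ 2).
  rewrite -Rintegral_itv_obnd_cbnd; last first.
    by apply: integrableS iFuv => //; apply: subset_itvr; rewrite bnd_simp.
  rewrite -(@Rintegral_itvB _ _ (BLeft 0))//; last by rewrite bnd_simp ltW.
  by rewrite /wiener_path; ring.
have -> : L ^+ 2 * \int[mu]_(s in `[u, v]) (b s / a s ^+ 2) =
    b u * ((a v)^-1 - (a u)^-1) +
    \int[mu]_(s in `[u, v]) (L ^+ 2 / a s ^+ 2 * (b s - b u)).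
  rewrite -integral_residV2// -RintegralZl// -RintegralZl// -RintegralD//.
  - by apply: eq_Rintegral => x _; ring.
  - exact: integrable_EFinZ.
  - have := integrable_EFinB (measurable_itv _ : measurable (`[u, v]%classic : set (measurableTypeR R))) (integrable_EFinZ (measurable_itv _ : measurable (`[u, v]%classic : set (measurableTypeR R))) (L ^+ 2) iFuv) (integrable_EFinZ (measurable_itv _ : measurable (`[u, v]%classic : set (measurableTypeR R))) (b u) iG).
    by apply: eq_integrable => // x _ /=; congr EFin; ring.
set I := \int[mu]_(s in _) _.
have HI : `|I| <= eps * ((a v)^-1 - (a u)^-1).
  have iI : mu.-integrable `[u, v] (EFin \o (fun s => L ^+ 2 / a s ^+ 2 * (b s - b u))).
    have := integrable_EFinB (measurable_itv _ : measurable (`[u, v]%classic : set (measurableTypeR R))) (integrable_EFinZ (measurable_itv _ : measurable (`[u, v]%classic : set (measurableTypeR R))) (L ^+ 2) iFuv) (integrable_EFinZ (measurable_itv _ : measurable (`[u, v]%classic : set (measurableTypeR R))) (b u) iG).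
    by apply: eq_integrable => // x _ /=; congr EFin; ring.
  apply: (le_trans (le_normr_Rintegral _ iI)) => //.
  rewrite -integral_residV2// -RintegralZl//.
  apply: le_Rintegral => //.
  - exact: integrable_norm iI.
  - exact: integrable_EFinZ.
  move=> x /=; rewrite in_itv/= => uxv.
  rewrite normrM ger0_norm ?divr_ge0 ?sqr_ge0// mulrC ler_wpM2r//.
    by rewrite divr_ge0 ?sqr_ge0.
  exact: beps.
have -> : e * (b v - b u) - ((b v - b u) / a v + b u * ((a v)^-1 - (a u)^-1) -
   (b u * ((a v)^-1 - (a u)^-1) + I)) = (e - (a v)^-1) * (b v - b u) + I by ring.
apply: (le_trans (ler_normD _ _)).
have -> : 2 * eps * ((a v)^-1 - (a u)^-1) =
  ((a v)^-1 - (a u)^-1) * eps + eps * ((a v)^-1 - (a u)^-1) by ring.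
by rewrite lerD// normrM ler_pM// beps// lexx ltW.
Qed.

Lemma uniform_continuity01 (eps : R) : 0 < eps ->
  exists2 dl, 0 < dl & forall x y, x \in `[0, 1] -> y \in `[0, 1] ->
    `|x - y| < dl -> `|b x - b y| <= eps.
Proof.
move=> eps0.
have cK : near_covering (`[0, 1]%classic : set R).
  by apply/compact_near_coveringP; exact: segment_compact.
have : \forall dl \near (0 : R)^'+, `[0, 1]%classic `<=` [set x | forall y,
    y \in `[0, 1] -> `|x - y| < dl -> x \in `[0, 1] -> `|b x - b y| <= eps].
  apply: cK => x x01.
  have eps20 : 0 < eps / 2 by rewrite divr_gt0.
  have /subspace_continuousP/(_ x x01)/cvgrPdist_lt/(_ _ eps20) := cb.
  rewrite /= /within/= => -[r /= r0 rb].
  have r20 : 0 < r / 2 by rewrite divr_gt0.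
  exists (ball x (r / 2), [set dl | dl < r / 2]).
    split; first exact: nbhsx_ballx.
    exact: nbhs_right_lt.
  move=> [x' dl] [/= xx' dlr] y y01 x'y x'01.
  have h1 : `|b x - b x'| < eps / 2.
    apply: rb => //=; rewrite /ball/= (lt_trans xx')// ltr_pdivrMr//.
    by rewrite ltr_pMr// ltr1n.
  have h2 : `|b x - b y| < eps / 2.
    apply: rb => //=; rewrite /ball/=.
    have -> : x - y = (x - x') + (x' - y) by ring.
    rewrite (le_lt_trans (ler_normD _ _))// (splitr r) ltrD//.
    exact: lt_trans dlr.
  have -> : b x' - b y = (b x - b y) - (b x - b x') by ring.
  rewrite (le_trans (ler_normB _ _))// (splitr eps) ltW// ltrD//.
move=> H; have [dl [dl0 Hdl]] : exists dl, 0 < dl /\ `[0, 1]%classic `<=` [set x | forall y,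
    y \in `[0, 1] -> `|x - y| < dl -> x \in `[0, 1] -> `|b x - b y| <= eps].
  have := @filter_ex _ _ _ _ (filterI (nbhs_right_gt 0) H).
  by move=> -[dl [? ?]]; exists dl.
by exists dl => // x y x01 y01 xy; apply: (Hdl x x01).
Qed.

(** Riemann sum for the integral of db / a. The weight uses the geometric mean of the values of a at
    both ends: its square times [h] is then exactly (1 / a(v) - 1 / a(u)) / L^2, so variances
    telescope and every sum has precisely the law of the limit. *)
Definition wiener_sum (s h : R) (n : nat) : R :=
  \sum_(0 <= j < n) (Num.sqrt (a (s + j%:R * h) * a (s + j.+1%:R * h)))^-1 *
     (b (s + j.+1%:R * h) - b (s + j%:R * h)).

Lemma wiener_sum_cvg s t : 0 <= s -> s < t -> t <= 1 ->
  wiener_sum s ((t - s) / n.+1%:R) n.+1 @[n --> \oo] -->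
  wiener_path L b t - wiener_path L b s.
Proof.
move=> s0 st t1; apply/cvgrPdist_le => /= e e0.
have t10 := resid_gt0 t1.
have s1 : s <= 1 by exact: le_trans (ltW st) t1.
pose K := (a t)^-1 - (a s)^-1.
have K0 : 0 < K by rewrite subr_gt0 ltf_pV2 ?posrE ?resid_gt0 ?resid_lt.
(* The errors of the steps telescope to 2 eps K, with K the total increase of 1 / a; hence this
   oscillation bound. *)
have [dl dl0 Hdl] := @uniform_continuity01 (e / (2 * K)) (divr_gt0 e0 (mulr_gt0 (ltr0Sn _ 1) K0)).
near=> n.
set h := (t - s) / n.+1%:R.
have h0 : 0 < h by rewrite divr_gt0// subr_gt0.
have hdl : h < dl.
  rewrite /h ltr_pdivrMr// mulrC -ltr_pdivrMr//.
  apply: (@lt_le_trans _ _ n%:R); last by rewrite ler_nat.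
  by near: n; exact: nbhs_infty_gtr.
have hE : s + n.+1%:R * h = t by rewrite /h; field; rewrite ?pnatr_eq0 -?natr1.
have pt j : (j <= n.+1)%N -> s <= s + j%:R * h <= t.
  move=> jn; rewrite lerDl mulr_ge0 ?(ltW h0)//= -[leRHS]hE lerD2l ler_pM2r//.
  by rewrite ler_nat.
have step k : (k <= n.+1)%N ->
  `| wiener_path L b (s + k%:R * h) - wiener_path L b s - wiener_sum s h k | <=
    2 * (e / (2 * K)) * ((a (s + k%:R * h))^-1 - (a s)^-1).
  elim: k => [_|k IH kn].
    by rewrite /wiener_sum big_geq// mul0r addr0 !subrr mulr0 normr0.
  have /andP[su ut] := pt k (ltnW kn).
  have /andP[sv vt] := pt k.+1 kn.
  set u := s + k%:R * h in su ut *; set v := s + k.+1%:R * h in sv vt *.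
  have uv : v = u + h by rewrite /u /v -natr1; ring.
  have vu : u < v by rewrite uv ltrDl.
  have := @wiener_path_step u v (e / (2 * K)) (le_trans s0 su) vu (le_trans vt t1).
  move=> /(_ _)/wrap[].
    move=> x /andP[ux xv]; apply: Hdl.
    - by rewrite in_itv/= (le_trans (le_trans s0 su))// (le_trans xv)// (le_trans vt).
    - by rewrite in_itv/= (le_trans s0 su)// (le_trans ut).
    - by rewrite ger0_norm ?subr_ge0// (le_lt_trans _ hdl)// lerBlDl -uv.
  rewrite /wiener_sum big_nat_recr//= -/(wiener_sum s h k) -/u -/v => Hk.
  have {}IH := IH (ltnW kn); rewrite -/u in IH.
  set q := _^-1 * _ in Hk *.
  have -> : wiener_path L b v - wiener_path L b s - (wiener_sum s h k + q) =
    (wiener_path L b u - wiener_path L b s - wiener_sum s h k) -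
    (q - (wiener_path L b v - wiener_path L b u)) by ring.
  apply: (le_trans (ler_normB _ _)); apply: (le_trans (lerD IH Hk)).
  by rewrite le_eqVlt; apply/orP; left; apply/eqP; ring.
have := step n.+1 (leqnn _); rewrite hE => /le_trans; apply.
rewrite -/K le_eqVlt; apply/orP; left; apply/eqP; field.
by rewrite lt0r_neq0.
Unshelve. all: by end_near.
Qed.

End wiener_path.

Section generated_measurability.
Context (T : pointedType) (R : realType).
Implicit Types (G S : set_system T).

Lemma sub_sigma G S : G `<=` S -> <<s G>> `<=` <<s S>>.
Proof. exact: sub_smallest2r. Qed.

Lemma g_sigma_sub G S : sigma_algebra setT S -> G `<=` S -> <<s G>> `<=` S.
Proof. by move=> *; exact: smallest_sub. Qed.

Lemma measurable_fun_g_sigma G (f : T -> R) :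
  (forall D, measurable D -> <<s G>> (f @^-1` D)) ->
  measurable_fun [set: g_sigma_algebraType G] (f : g_sigma_algebraType G -> R).
Proof. by move=> H _ D mD; rewrite setTI; exact: H. Qed.

Lemma g_sigma_measurable_fun G (f : T -> R) :
  measurable_fun [set: g_sigma_algebraType G] (f : g_sigma_algebraType G -> R) ->
  forall D, measurable D -> <<s G>> (f @^-1` D).
Proof. by move=> mf D mD; rewrite -[X in _ X]setTI; exact: mf. Qed.

Lemma measurable_fun_sub_sigma G S (f : T -> R) : <<s G>> `<=` <<s S>> ->
  measurable_fun [set: g_sigma_algebraType G] (f : g_sigma_algebraType G -> R) ->
  measurable_fun [set: g_sigma_algebraType S] (f : g_sigma_algebraType S -> R).
Proof.
move=> GS mf; apply: measurable_fun_g_sigma => D mD; apply: GS.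
exact: g_sigma_measurable_fun.
Qed.

Lemma g_sigmaI G (A C : set T) : <<s G>> A -> <<s G>> C -> <<s G>> (A `&` C).
Proof. exact: (@measurableI _ (g_sigma_algebraType G)). Qed.

Lemma g_sigmaT G : <<s G>> setT.
Proof. exact: (@measurableT _ (g_sigma_algebraType G)). Qed.

End generated_measurability.

Lemma g_sigma_sub_measurable d (T : measurableType d) (G : set_system T) :
  G `<=` measurable -> <<s G>> `<=` measurable.
Proof. by move=> Gm; apply: g_sigma_sub => //; exact: sigma_algebra_measurable. Qed.

Lemma measurable_preimage d (T : measurableType d) (R : realType) (f : T -> R) D :
  measurable_fun setT f -> measurable D -> measurable (f @^-1` D).
Proof. by move=> mf mD; rewrite -[X in measurable X]setTI; exact: mf. Qed.

Lemma normal_pdf_shift (R : realType) (m s x : R) : 0 < s ->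
  normal_pdf m s x = normal_pdf 0 s (x - m).
Proof.
by move=> s0; rewrite !normal_pdfE ?lt0r_neq0// /normal_fun subr0.
Qed.

Lemma normal_prob_affine (R : realType) (e b r : R) (D : set R) : 0 < e -> 0 < r ->
  measurable D ->
  normal_prob 0 r ((fun y => e * y + b) @^-1` D) = normal_prob b (e * r) D.
Proof.
move=> e0 r0 mD.
have mlin : measurable_fun [set: R] (fun x : R => e * x + b).
  by apply: measurable_funD => //; exact: measurable_funM.
have mDe : measurable ((fun y : R => e * y + b) @^-1` D) by exact: measurable_preimage.
have en0 := lt0r_neq0 e0.
pose f x : \bar R := (\1_D x * normal_pdf b (e * r) x)%:E.
have mf : measurable_fun setT f.
  apply/measurable_EFinP; apply: measurable_funM; first exact: measurable_indic.
  exact: measurable_normal_pdf.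
have f0 x : (0 <= f x)%E by rewrite lee_fin mulr_ge0 ?normal_pdf_ge0// indicE.
have -> : normal_prob b (e * r) D = (\int[lebesgue_measure]_x f x)%E.
  rewrite /normal_prob integral_mkcond; apply: eq_integral => x _.
  by rewrite patchE /f indicE; case: ifPn => _; rewrite ?mul1r ?mul0r.
have := ge0_integral_affine b e0 mf f0.
move=> /(congr1 (fun z => e%:E * z)%E); rewrite muleA -EFinM divff// mul1e => <-.
rewrite -ge0_integralZl//.
- rewrite /normal_prob [LHS]integral_mkcond; apply: eq_integral => x _.
  rewrite patchE /f indicE -EFinM.
  rewrite (_ : (x \in (fun y => e * y + b) @^-1` D) = (e * x + b \in D))//.
  case: ifPn => _; rewrite ?mul1r ?mul0r ?mulr0//; congr EFin.
  rewrite (normal_pdf_shift b) ?mulr_gt0// addrK.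
  rewrite !normal_pdf0E// ?mulr_gt0//.
  have rn0 := lt0r_neq0 r0.
  have pn0 : (Num.sqrt (pi *+ 2) != 0 :> R)%R.
    by rewrite lt0r_neq0// sqrtr_gt0 mulrn_wgt0// pi_gt0.
  have -> : (e * x) ^+ 2 / ((e * r) ^+ 2 * 2) = x ^+ 2 / (r ^+ 2 * 2).
    by field; rewrite en0 rn0.
  by field; rewrite pn0 en0 rn0.
- exact: (measurableT_comp mf mlin).
- by rewrite lee_fin ltW.
Qed.

Lemma indep_law_scale d (T : measurableType d) (R : realType) (P : probability T R)
    (G : set_system T) (Y : T -> R) (e r : R) : 0 < e -> 0 < r ->
  indep_law P G Y (normal_prob 0 r) ->
  indep_law P G (fun w => e * Y w) (normal_prob 0 (e * r)).
Proof.
move=> e0 r0 GY A GA D mD; rewrite -(normal_prob_affine 0 e0 r0 mD) -GY//.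
  by congr (P (_ `&` _)); apply/funext => w; rewrite /preimage/= addr0.
apply: measurable_preimage => //.
by apply: measurable_funD => //; exact: measurable_funM.
Qed.

(** * Independent increments in the insider's history *)

Section brownian.
Context (R : realType) d (T : measurableType d) (Q : probability T R).
Variables (B : R -> T -> R) (V : T -> R).
Hypotheses (HB : is_brownian Q B) (mV : measurable_fun setT V).
Hypothesis VB : forall A, <<s history B 1>> A -> forall D, measurable D ->
  Q (A `&` V @^-1` D) = (Q A * Q (V @^-1` D))%E.
Notation mu := (@lebesgue_measure R).

Definition full_history (X : R -> T -> R) (U : T -> R) (s : R) : set_system T :=
  history X s `|` g_sigma_algebra_preimage U.

Notation Hs s := (<<s full_history B V s>>).

Lemma history_le (X : R -> T -> R) s t : s <= t -> history X s `<=` history X t.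
Proof.
move=> st A [u /= us XA]; exists u => //=; move: us; rewrite !in_itv/=.
by move=> /andP[-> us]; exact: le_trans st.
Qed.

Lemma history_measurable s : s <= 1 -> history B s `<=` measurable.
Proof.
move=> s1 A [u /= us [D mD <-]]; have [mB _ _ _ _] := HB; apply: mB => //.
by move: us; rewrite !in_itv/= => /andP[-> us]; exact: le_trans s1.
Qed.

Lemma full_history_measurable s : s <= 1 -> full_history B V s `<=` measurable.
Proof.
move=> s1 A [/(history_measurable s1)//|[D mD <-]]; exact: mV.
Qed.

Lemma full_history_sub s : s <= 1 -> Hs s `<=` measurable.
Proof. by move=> s1; apply: g_sigma_sub_measurable; exact: full_history_measurable. Qed.

Lemma full_history_le s t : s <= t -> Hs s `<=` Hs t.
Proof. by move=> st; apply: sub_sigma; apply: setSU; exact: history_le. Qed.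

Lemma full_history_V s : measurable_fun [set: g_sigma_algebraType (full_history B V s)]
  (V : g_sigma_algebraType _ -> R).
Proof.
apply: measurable_fun_g_sigma => D mD; apply: sub_sigma_algebra; right.
by exists D => //; rewrite setTI.
Qed.

Lemma full_history_B u s : 0 <= u -> u <= s ->
  measurable_fun [set: g_sigma_algebraType (full_history B V s)]
  (B u : g_sigma_algebraType _ -> R).
Proof.
move=> u0 us; apply: measurable_fun_g_sigma => D mD.
apply: sub_sigma_algebra; left; exists u; first by rewrite /= in_itv/= u0.
by exists D => //; rewrite setTI.
Qed.

Lemma measurable_B u : u \in `[0, 1] -> measurable_fun setT (B u).
Proof. by move=> u01; have [mB _ _ _ _] := HB; exact: mB. Qed.

Definition increment s t (w : T) := B t w - B s w.

Lemma measurable_increment s t : 0 <= s -> s <= t -> t <= 1 ->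
  measurable_fun setT (increment s t).
Proof.
move=> s0 st t1; apply: measurable_funB; apply: measurable_B; rewrite in_itv/=.
  by rewrite t1 (le_trans s0 st).
by rewrite s0 (le_trans st).
Qed.

(** The intersections of a past event of [B] with an event of [V] form a pi-system. On it [V] is
    split off first, being independent of the whole noise path, and the Brownian increment
    second. *)
Lemma increment_indep s t : 0 <= s -> s < t -> t <= 1 ->
  indep_law Q (Hs s) (increment s t) (normal_prob 0 (Num.sqrt (t - s))).
Proof.
move=> s0 st t1; have [mB _ _ lawB indB] := HB.
have s1 : s <= 1 by exact: le_trans (ltW st) t1.
have mI : measurable_fun setT (increment s t) by exact: measurable_increment (ltW st) _.
pose G := [set A | exists A1 E, [/\ <<s history B s>> A1, measurable E & A = A1 `&` V @^-1` E]].
have hm : <<s history B s>> `<=` measurable.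
  by apply: g_sigma_sub_measurable; exact: history_measurable.
have Gm : G `<=` measurable.
  by move=> _ [A1 [E [hA mE ->]]]; apply: measurableI; [exact: hm|exact: measurable_preimage].
have setIh A C : <<s history B s>> A -> <<s history B s>> C -> <<s history B s>> (A `&` C).
  by move=> hA hC; exact: (@measurableI _ (g_sigma_algebraType (history B s))).
have hT : <<s history B s>> setT.
  exact: (@measurableT _ (g_sigma_algebraType (history B s))).
have GI : setI_closed G.
  move=> _ _ [A1 [E1 [h1 m1 ->]]] [A2 [E2 [h2 m2 ->]]].
  exists (A1 `&` A2), (E1 `&` E2); split; [exact: setIh|exact: measurableI|].
  by rewrite preimage_setI setIACA.
have GT : G setT by exists setT, setT; split => //; rewrite preimage_setT setIT.
have : indep_law Q <<s G>> (increment s t) (normal_prob 0 (Num.sqrt (t - s))).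
  apply: (indep_law_sigma (nu := normal_prob 0 (Num.sqrt (t - s)))) => // _ [A1 [E [h1 mE ->]]] D mD.
  have h1D : <<s history B 1>> (A1 `&` (increment s t) @^-1` D).
    have m1 := @measurableI _ (g_sigma_algebraType (history B 1)); apply: m1.
      by apply: sub_sigma h1; exact: history_le.
    apply: g_sigma_measurable_fun => //; apply: measurable_funB;
      apply: measurable_fun_g_sigma => F mF; apply: sub_sigma_algebra.
      by exists t; [rewrite /= in_itv/= t1 (le_trans s0 (ltW st))|exists F => //; rewrite setTI].
    by exists s; [rewrite /= in_itv/= s0 s1|exists F => //; rewrite setTI].
  rewrite setIAC VB// indB// lawB// VB//; last by apply: sub_sigma h1; exact: history_le.
  by rewrite muleAC.
apply: sub_indep_law; apply: g_sigma_sub; first exact: smallest_sigma_algebra.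
move=> A [hA|[D mD <-]]; apply: sub_sigma_algebra.
  exists A, setT; split => //; [exact: sub_sigma_algebra|].
  by rewrite preimage_setT setIT.
by exists setT, D; split.
Qed.

(* The Brownian path started exactly (and not only almost surely) at [0]. *)
Definition bpath t (w : T) := B t w - B 0 w.

Lemma bpath_continuous w : {within `[0, 1], continuous (fun t => bpath t w)}.
Proof.
have [_ _ cB _ _] := HB.
by move=> x; apply: cvgB; [exact: cB|exact: cvg_cst].
Qed.

Lemma bpath0 w : bpath 0 w = 0. Proof. exact: subrr. Qed.

Lemma bpathB s t w : bpath t w - bpath s w = increment s t w.
Proof. by rewrite /bpath /increment; ring. Qed.

Lemma bpath_history u s : 0 <= u -> u <= s ->
  measurable_fun [set: g_sigma_algebraType (full_history B V s)]
  (bpath u : g_sigma_algebraType _ -> R).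
Proof.
move=> u0 us; apply: measurable_funB; apply: full_history_B => //.
exact: le_trans us.
Qed.

Lemma bpath_ae : {ae Q, forall w, forall t, bpath t w = B t w}.
Proof.
have [_ B0 _ _ _] := HB.
by apply: filterS B0 => w B0w t; rewrite /bpath B0w subr0.
Qed.

Variables (L : R) (L0 : 0 < L) (L1 : L < 1).
Notation a := (resid L).

Definition wiener t (w : T) := wiener_path L (fun s => bpath s w) t.

Lemma wiener0 w : wiener 0 w = 0.
Proof.
by rewrite /wiener /wiener_path bpath0 mul0r set_itv1 Rintegral_set1 mulr0 subrr.
Qed.

Lemma wiener_history u s : 0 <= u -> u <= s -> u <= 1 ->
  measurable_fun [set: g_sigma_algebraType (full_history B V s)]
  (wiener u : g_sigma_algebraType _ -> R).
Proof.
move=> u0 us u1; apply: measurable_funB.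
  by apply: measurable_funM => //; exact: bpath_history.
apply: measurable_funM => //.
apply: (@measurable_Rintegral_process _ (g_sigma_algebraType (full_history B V s)) R
  (fun s w => bpath s w / a s ^+ 2) u).
apply: (@measurable_process _ (g_sigma_algebraType (full_history B V s)) R
  (fun s w => bpath s w / a s ^+ 2) u).
- move=> v; rewrite in_itv/= => /andP[v0 vu]; apply: measurable_funM => //.
  by apply: bpath_history => //; exact: le_trans us.
- move=> w; have H := continuous_path_residV2 L0 L1 (@bpath_continuous w).
  apply: (continuous_subspaceW _ H); apply: subset_itvl; rewrite bnd_simp//.
Qed.

(** The variance of the Wiener integral of 1 / a over [s, t], that is, the integral of 1 / a^2 in
    closed form. *)
Definition var_between s t := (((a t)^-1 - (a s)^-1) / L ^+ 2).

Lemma var_between_gt0 s t : s < t -> t <= 1 -> 0 < var_between s t.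
Proof.
move=> st t1; rewrite divr_gt0 ?exprn_gt0// subr_gt0 ltf_pV2 ?posrE ?resid_gt0//.
  exact: resid_lt.
by rewrite (le_trans (ltW st)).
Qed.

(** Induction on the number of steps: the next increment is independent of the history in which the
    partial sum is measurable, and [normal_combination] adds it. Measurability in that history is
    therefore part of the statement. *)
Let wiener_sum_law s h n : 0 <= s -> 0 < h -> s + n.+1%:R * h <= 1 ->
  (forall A, Hs s A -> forall D, measurable D ->
    Q (A `&` (fun w => wiener_sum L (fun t => bpath t w) s h n.+1) @^-1` D) =
    (Q A * normal_prob 0 (Num.sqrt (var_between s (s + n.+1%:R * h))) D)%E) /\
  measurable_fun [set: g_sigma_algebraType (full_history B V (s + n.+1%:R * h))]
    ((fun w => wiener_sum L (fun t => bpath t w) s h n.+1)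
       : g_sigma_algebraType _ -> R).
Proof.
move=> s0 h0.
pose tt k := s + k%:R * h.
have tt_lt k : tt k < tt k.+1 by rewrite /tt ltrD2l ltr_pM2r// ltr_nat.
have tt_le k m : (k <= m)%N -> tt k <= tt m.
  by move=> km; rewrite /tt lerD2l ler_pM2r// ler_nat.
have tt0 k : 0 <= tt k by rewrite /tt addr_ge0// mulr_ge0// ltW.
have tt00 : tt 0%N = s by rewrite /tt mul0r addr0.
pose e k := (Num.sqrt (a (tt k) * a (tt k.+1)))^-1.
have apos k : tt k <= 1 -> 0 < a (tt k) by exact: resid_gt0.
have e0 k : tt k.+1 <= 1 -> 0 < e k.
  move=> k1; rewrite invr_gt0 sqrtr_gt0 mulr_gt0// apos//.
  by rewrite (le_trans (ltW (tt_lt k))).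
have e2 k : tt k.+1 <= 1 -> e k ^+ 2 * h = var_between (tt k) (tt k.+1).
  move=> k1; have k1' : tt k <= 1 by rewrite (le_trans (ltW (tt_lt k))).
  have n1 := lt0r_neq0 (apos _ k1); have n2 := lt0r_neq0 (apos _ k1').
  rewrite /e exprVn sqr_sqrtr ?mulr_ge0 ?ltW ?apos// /var_between.
  have hE : h = (a (tt k) - a (tt k.+1)) / L ^+ 2.
    rewrite /resid /tt -natr1; field; exact: lt0r_neq0.
  by rewrite hE; field; rewrite n1 n2 lt0r_neq0.
pose S k w := wiener_sum L (fun t => bpath t w) s h k.
have SS k w : S k.+1 w = S k w + e k * increment (tt k) (tt k.+1) w.
  by rewrite /S /wiener_sum big_nat_recr//= bpathB.
have mS k : measurable_fun [set: g_sigma_algebraType (full_history B V (tt k))]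
    (S k : g_sigma_algebraType _ -> R).
  elim: k => [|k IH].
    rewrite (_ : S 0%N = cst 0); first exact: measurable_cst.
    by apply/funext => w; rewrite /S /wiener_sum big_geq.
  rewrite (_ : S k.+1 = fun w => S k w + e k * increment (tt k) (tt k.+1) w); last first.
    by apply/funext => w; rewrite SS.
  apply: measurable_funD.
    by apply: measurable_fun_sub_sigma IH; exact: full_history_le (ltW (tt_lt k)).
  apply: measurable_funM => //; apply: measurable_funB; apply: full_history_B => //.
  exact: ltW.
move=> n1; split; last exact: mS.
rewrite -/(tt n.+1) in n1 *.
suff H k : tt k.+1 <= 1 ->
    indep_law Q (Hs s) (S k.+1) (normal_prob 0 (Num.sqrt (var_between s (tt k.+1)))).
  exact: H.
elim: k => [|k IH] k1.
  have -> : S 1%N = fun w => e 0%N * increment s (tt 1%N) w.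
    apply/funext => w; rewrite SS tt00 [S 0%N w](_ : _ = 0) ?add0r//.
    by rewrite /S /wiener_sum big_geq.
  have -> : Num.sqrt (var_between s (tt 1%N)) = e 0%N * Num.sqrt (tt 1%N - s).
    rewrite -[in LHS]tt00 -e2// sqrtrM ?sqr_ge0// sqrtr_sqr ger0_norm ?(ltW (e0 _ _))//.
    by rewrite /tt mul1r addrC addKr.
  apply: indep_law_scale; first exact: e0.
    by rewrite sqrtr_gt0 subr_gt0 -[ltLHS]tt00.
  by apply: increment_indep => //; rewrite -[ltLHS]tt00.
have k1' : tt k.+1 <= 1 by rewrite (le_trans (ltW (tt_lt _))).
have sk : s < tt k.+1.
  by rewrite -[ltLHS]tt00 (le_lt_trans (tt_le 0%N k _)).
have {}IH := IH k1'.
move=> A hA D mD.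
have s1 : s <= 1 by rewrite (le_trans (ltW sk)).
have mA : measurable A by exact: full_history_sub s1 _ hA.
have mSk m : tt m <= 1 -> measurable_fun setT (S m).
  move=> m1 _ E mE; rewrite setTI; apply: (full_history_sub m1).
  exact: g_sigma_measurable_fun.
(* [normal_combination] produces a pair. The partner of the new sum X + e Y is e h X - v Y, with v
   and h the variances of X and Y; it is uncorrelated with the sum and has variance r'^2. *)
pose r' := Num.sqrt ((e k.+1 * h) ^+ 2 * var_between s (tt k.+1) +
   (var_between s (tt k.+1)) ^+ 2 * h).
have v0 := var_between_gt0 sk k1'.
have sk2 : s < tt k.+2 by exact: lt_trans (tt_lt _).
have v20 := var_between_gt0 sk2 k1.
have ek := e0 _ k1.
have hE : tt k.+2 - tt k.+1 = h by rewrite /tt -(natr1 k.+1); ring.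
have := @normal_combination _ _ _ Q A mA (S k.+1) (increment (tt k.+1) (tt k.+2))
  (Num.sqrt (var_between s (tt k.+1))) (Num.sqrt h)
  (mSk _ k1') (measurable_increment (tt0 _) (ltW (tt_lt _)) k1).
rewrite !sqrtr_gt0 => /(_ v0 h0)/(_ _)/wrap[].
  move=> D' E' mD' mE'; rewrite setIA.
  have := increment_indep (tt0 k.+1) (tt_lt k.+1) k1.
  rewrite hE => ->//; first by rewrite IH.
  apply: g_sigmaI; first by apply: full_history_le hA; exact: ltW.
  exact: g_sigma_measurable_fun (mS k.+1) _ mD'.
move=> /(_ 1 (e k.+1) (e k.+1 * h) (- var_between s (tt k.+1))
  (Num.sqrt (var_between s (tt k.+2))) r').
have r'0 : 0 < (e k.+1 * h) ^+ 2 * var_between s (tt k.+1) +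
   (var_between s (tt k.+1)) ^+ 2 * h.
  by rewrite addr_gt0// mulr_gt0// exprn_gt0// mulr_gt0.
rewrite !sqrtr_gt0 /r' !sqr_sqrtr ?(ltW _)// => /(_ v20 r'0).
move=> /(_ _)/wrap[].
  rewrite expr1n mul1r e2// /var_between; ring.
move=> /(_ _)/wrap[]; first by rewrite sqrrN.
move=> /(_ _)/wrap[]; first by ring.
move=> /(_ ek)/(_ _)/wrap[].
  by rewrite mul1r opprK addr_gt0// !mulr_gt0.
move=> /(_ D setT mD measurableT).
rewrite preimage_setT setIT probability_setT mule1 => <-; congr (Q (_ `&` _)).
by apply/funext => w; rewrite /preimage /= SS mul1r.
Qed.

(** All approximating sums have the same law as the limit, so the reference variables of
    [limit_joint_law] are constant in [n]: the identity under that normal law. *)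
Lemma wiener_indep s t : 0 <= s -> s < t -> t <= 1 ->
  indep_law Q (Hs s) (fun w => wiener t w - wiener s w)
    (normal_prob 0 (Num.sqrt (var_between s t))).
Proof.
move=> s0 st t1 A hA D mD.
have s1 : s <= 1 by exact: le_trans (ltW st) t1.
have mA : measurable A by exact: full_history_sub s1 _ hA.
pose h n : R := (t - s) / n.+1%:R.
have h0 n : 0 < h n by rewrite divr_gt0// subr_gt0.
have hE n : s + n.+1%:R * h n = t by rewrite /h; field; rewrite ?pnatr_eq0 -?natr1.
have t1' n : s + n.+1%:R * h n <= 1 by rewrite hE.
pose Rn n w := wiener_sum L (fun t => bpath t w) s (h n) n.+1.
have mRn n : measurable_fun setT (Rn n).
  have [_] := wiener_sum_law s0 (h0 n) (t1' n); rewrite hE => H _ E mE.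
  rewrite setTI; apply: (full_history_sub t1); exact: g_sigma_measurable_fun.
apply: (@limit_joint_law _ _ _ Q _ _ (normal_prob 0 (Num.sqrt (var_between s t))) A mA Rn
  (fun w => wiener t w - wiener s w) (fun n => id) id) => //.
- by move=> w; apply: wiener_sum_cvg => //; exact: bpath_continuous.
- by move=> w; exact: cvg_cst.
- move=> n E mE; have [H _] := wiener_sum_law s0 (h0 n) (t1' n).
  rewrite hE in H; exact: H.
Qed.

End brownian.

(** * Filtering *)

Section filtering.
Context (R : realType) d (T : measurableType d) (Q : probability T R).
Variables (B : R -> T -> R) (V : T -> R).
Hypotheses (HB : is_brownian Q B) (mV : measurable_fun setT V).
Hypothesis VB : forall A, <<s history B 1>> A -> forall D, measurable D ->
  Q (A `&` V @^-1` D) = (Q A * Q (V @^-1` D))%E.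
Variables (L : R) (L0 : 0 < L) (L1 : L < 1).
Notation mu := (@lebesgue_measure R).
Notation a := (resid L).
Notation Hs s := (<<s full_history B V s>>).
Notation wien := (wiener B L).
Variables (m g : R).

Definition zscore (w : T) : R := (V w - m) / g.

(* The demand [Y / sigma] of the explicit solution, and the part of the
   standardised value that it does not reveal. *)
Definition signal t w := L * t * zscore w + a t * wien t w.
Definition innov t w := zscore w - L * signal t w.

Lemma innovE t w : innov t w = a t * (zscore w - L * wien t w).
Proof. by rewrite /innov /signal /resid; ring. Qed.

Lemma signal0 w : signal 0 w = 0.
Proof. by rewrite /signal wiener0 !mulr0 mul0r addr0. Qed.

Lemma wiener_continuous w : {within `[0, 1], continuous (fun t => wien t w)}.
Proof.
have cb := @bpath_continuous _ _ _ _ _ HB w.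
have cr := continuous_path_residV2 L0 L1 cb.
move=> x; apply: cvgB.
  apply: cvgM; first exact: cb.
  by apply: continuous_residV => // t /=; rewrite in_itv/= => /andP[].
apply: cvgM; first exact: cvg_cst.
exact: primitive_continuous (integrable_continuous01 cr) _.
Qed.

Lemma signal_continuous w : {within `[0, 1], continuous (fun t => signal t w)}.
Proof.
have H : continuous (fun t => L * t * zscore w).
  move=> y; apply: cvgM; last exact: cvg_cst.
  by apply: cvgM; [exact: cvg_cst|exact: cvg_id].
move=> x; apply: cvgD; first exact: (continuous_subspaceT H).
apply: cvgM; last exact: wiener_continuous.
exact: (continuous_subspaceT (@continuous_resid _ _)).
Qed.

Lemma innov_continuous w : {within `[0, 1], continuous (fun t => innov t w)}.
Proof.
move=> x; apply: cvgB; first exact: cvg_cst.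
by apply: cvgM; [exact: cvg_cst|exact: signal_continuous].
Qed.

Lemma zscore_history s : measurable_fun [set: g_sigma_algebraType (full_history B V s)]
  (zscore : g_sigma_algebraType _ -> R).
Proof.
apply: measurable_funM => //; apply: measurable_funB => //.
exact: full_history_V.
Qed.

Lemma signal_history u s : 0 <= u -> u <= s -> u <= 1 ->
  measurable_fun [set: g_sigma_algebraType (full_history B V s)]
  (signal u : g_sigma_algebraType _ -> R).
Proof.
move=> u0 us u1; apply: measurable_funD; apply: measurable_funM => //.
  exact: zscore_history.
exact: (wiener_history HB).
Qed.

Lemma innov_history u s : 0 <= u -> u <= s -> u <= 1 ->
  measurable_fun [set: g_sigma_algebraType (full_history B V s)]
  (innov u : g_sigma_algebraType _ -> R).
Proof.
move=> u0 us u1; apply: measurable_funB; first exact: zscore_history.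
by apply: measurable_funM => //; exact: signal_history.
Qed.

Lemma measurable_full_history (f : T -> R) s : s <= 1 ->
  measurable_fun [set: g_sigma_algebraType (full_history B V s)]
  (f : g_sigma_algebraType _ -> R) -> measurable_fun setT f.
Proof.
move=> s1 mf _ D mD; rewrite setTI; apply: (full_history_sub HB mV s1).
exact: g_sigma_measurable_fun.
Qed.

Lemma measurable_signal t : 0 <= t -> t <= 1 -> measurable_fun setT (signal t).
Proof. by move=> t0 t1; apply: (measurable_full_history t1); exact: signal_history. Qed.

Lemma measurable_innov t : 0 <= t -> t <= 1 -> measurable_fun setT (innov t).
Proof. by move=> t0 t1; apply: (measurable_full_history t1); exact: innov_history. Qed.

Hypothesis ZN : forall D, measurable D -> Q (zscore @^-1` D) = normal_prob 0 1 D.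

(* [G] carries the signal at finitely many times up to [t]; it is enlarged one
   time at a time. *)
Let separated (t : R) (G : set_system T) :=
  [/\ sigma_algebra setT G, G `<=` Hs t &
    indep_law Q G (innov t) (normal_prob 0 (Num.sqrt (a t)))].

Let sigmaE (G : set_system T) : sigma_algebra setT G -> <<s G>> = G.
Proof. exact: sigma_algebra_id. Qed.

Let separated0 : separated 0 <<s [set setT]>>.
Proof.
split; first exact: smallest_sigma_algebra.
  apply: g_sigma_sub; first exact: smallest_sigma_algebra.
  by move=> _ ->; exact: g_sigmaT.
rewrite resid0 sqrtr1.
apply: (indep_law_sigma (nu := normal_prob 0 1)) => //.
- by move=> _ ->.
- by move=> _ _ -> ->; rewrite setIT.
- exact: measurable_innov.
move=> _ -> D mD; rewrite setTI probability_setT mul1e.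
transitivity (Q (zscore @^-1` D)); last exact: ZN.
congr (Q _).
by apply/funext => w; rewrite /preimage/= /innov signal0 mulr0 subr0.
Qed.

(** Both signal t - signal s and innov t are linear in the independent Gaussian variables innov s
    and W_t - W_s. They are uncorrelated, with variances t - s and a(t); the first can thus be added
    to [G] without losing independence from the second. *)
Let separated_step s t G : 0 <= s -> s < t -> t <= 1 -> separated s G ->
  exists G', [/\ separated t G', G `<=` G' &
    forall D, measurable D -> G' ((fun w => signal t w - signal s w) @^-1` D)].
Proof.
move=> s0 st t1 [sG GH Gi].
have s1 : s <= 1 by exact: le_trans (ltW st) t1.
have t0 : 0 <= t by exact: le_trans (ltW st).
pose dW w := signal t w - signal s w.
pose eps w := wien t w - wien s w.
have meps : measurable_fun setT eps.
  apply: (measurable_full_history t1); apply: measurable_funB.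
    exact: (wiener_history HB).
  by apply: (wiener_history HB) => //; exact: ltW.
have hdW : measurable_fun [set: g_sigma_algebraType (full_history B V t)]
    (dW : g_sigma_algebraType _ -> R).
  by apply: measurable_funB; apply: signal_history => //; exact: ltW.
have mdW := measurable_full_history t1 hdW.
have as0 := resid_gt0 L0 L1 s1; have at0 := resid_gt0 L0 L1 t1.
have asn0 := lt0r_neq0 as0; have atn0 := lt0r_neq0 at0; have Ln0 := lt0r_neq0 L0.
have ast : a t < a s by exact: resid_lt.
have vE : var_between L s t = ((a t)^-1 - (a s)^-1) / L ^+ 2 by [].
have v0 : 0 < var_between L s t by exact: var_between_gt0.
have Gm : G `<=` measurable by move=> A /GH; exact: (full_history_sub HB mV s1).
have key A D E : G A -> measurable D -> measurable E ->
    Q (A `&` (dW @^-1` D `&` innov t @^-1` E)) =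
    (Q A * normal_prob 0 (Num.sqrt (t - s)) D * normal_prob 0 (Num.sqrt (a t)) E)%E.
  move=> GA mD mE.
  have := @normal_combination _ _ _ Q A (Gm _ GA) (innov s) eps (Num.sqrt (a s))
    (Num.sqrt (var_between L s t)) (measurable_innov s0 s1) meps.
  rewrite !sqrtr_gt0 => /(_ as0 v0)/(_ _)/wrap[].
    move=> D' E' mD' mE'; rewrite setIA (wiener_indep HB mV VB L0 L1 s0 st t1)//.
      by rewrite Gi.
    apply: g_sigmaI; first exact: GH.
    by apply: g_sigma_measurable_fun mD'; exact: innov_history.
  (* The coefficients come from innov s = a(s) (Z - L W_s), used to eliminate Z and W_s, together
     with a(s) - a(t) = L^2 (t - s). *)
  move=> /(_ ((1 - a t / a s) / L) (a t) (a t / a s) (- (a t * L))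
    (Num.sqrt (t - s)) (Num.sqrt (a t))).
  rewrite !sqrtr_gt0 subr_gt0 !sqr_sqrtr ?subr_ge0 ?(ltW st) ?(ltW as0) ?(ltW at0) ?(ltW v0)//.
  move=> /(_ st at0)/(_ _)/wrap[].
    have -> : t - s = (a s - a t) / L ^+ 2 by rewrite /resid; field.
    by rewrite vE; field; rewrite Ln0 asn0 atn0.
  move=> /(_ _)/wrap[]; first by rewrite vE; field; rewrite Ln0 asn0 atn0.
  move=> /(_ _)/wrap[]; first by rewrite vE; field; rewrite Ln0 asn0 atn0.
  move=> /(_ at0)/(_ _)/wrap[].
    have -> : a t * (a t / a s) - (1 - a t / a s) / L * - (a t * L) = a t.
      by field; rewrite Ln0 asn0.
    by [].
  move=> /(_ D E mD mE) <-; congr (Q (_ `&` (_ `&` _))).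
    apply/funext => w; rewrite /preimage/=; congr (D _).
    rewrite /dW /signal innovE /eps.
    have -> : 1 - a t / a s = L ^+ 2 * (t - s) / a s.
      by rewrite (_ : L ^+ 2 * (t - s) = a s - a t) ?/resid; [field|ring].
    have -> : a s * wien s w = (a t + L ^+ 2 * (t - s)) * wien s w.
      by rewrite /resid; ring.
    by field; rewrite Ln0 asn0.
  apply/funext => w; rewrite /preimage/=; congr (E _).
  by rewrite !innovE /eps; field; rewrite asn0.
  by rewrite -subr_ge0; exact: ltW.
  by rewrite -subr_ge0; exact: ltW.
have keyD C D : G C -> measurable D ->
    Q (C `&` dW @^-1` D) = (Q C * normal_prob 0 (Num.sqrt (t - s)) D)%E.
  move=> GC mD; have := key C D setT GC mD measurableT.
  by rewrite preimage_setT setIT probability_setT mule1.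
pose G1 := [set A | exists A1 D, [/\ G A1, measurable D & A = A1 `&` dW @^-1` D]].
have GT : G setT by rewrite -(sigmaE sG); exact: g_sigmaT.
have GI A C : G A -> G C -> G (A `&` C).
  by rewrite -(sigmaE sG); exact: g_sigmaI.
have G1H : G1 `<=` Hs t.
  move=> _ [A1 [D [GA mD ->]]]; apply: g_sigmaI.
    by apply: full_history_le (GH _ GA); exact: ltW.
  exact: g_sigma_measurable_fun hdW _ mD.
exists <<s G1>>; split.
- split; first exact: smallest_sigma_algebra.
    by apply: g_sigma_sub => //; exact: smallest_sigma_algebra.
  apply: (indep_law_sigma (nu := normal_prob 0 (Num.sqrt (a t)))).
  + by move=> A /G1H; exact: (full_history_sub HB mV t1).
  + move=> _ _ [A1 [D1 [GA1 mD1 ->]]] [A2 [D2 [GA2 mD2 ->]]].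
    exists (A1 `&` A2), (D1 `&` D2); split; [exact: GI|exact: measurableI|].
    by rewrite preimage_setI setIACA.
  + by exists setT, setT; split => //; rewrite preimage_setT setIT.
  + exact: measurable_innov.
  + by move=> _ [A1 [D [GA mD ->]]] E mE; rewrite -setIA key// keyD.
- move=> A GA; apply: sub_sigma_algebra; exists A, setT; split => //.
  by rewrite preimage_setT setIT.
- by move=> D mD; apply: sub_sigma_algebra; exists setT, D; split => //; rewrite setTI.
Qed.

Let separated_path s l G : 0 <= s -> path <%O s l -> all (fun u => u <= 1) l ->
  separated s G -> (forall D, measurable D -> G (signal s @^-1` D)) ->
  exists2 G', separated (last s l) G' & G `<=` G' /\
    forall u, u \in s :: l -> forall D, measurable D -> G' (signal u @^-1` D).
Proof.
elim: l s G => [|t l IH] s G s0 /=.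
  by move=> _ _ GG Gs; exists G => //; split => // u; rewrite inE => /eqP ->.
move=> /andP[st tl] /andP[t1 l1] GG Gs.
have [G1 [G1G GG1 G1d]] := separated_step s0 st t1 GG.
have t0 : 0 <= t by exact: le_trans (ltW st).
have [sG1 _ _] := G1G.
have G1t D : measurable D -> G1 (signal t @^-1` D).
  move=> mD; rewrite -(sigmaE sG1); apply: (g_sigma_measurable_fun _ mD).
  rewrite (_ : signal t = fun w => (signal t w - signal s w) + signal s w); last first.
    by apply/funext => w; rewrite subrK.
  apply: measurable_funD; apply: measurable_fun_g_sigma => E mE; rewrite (sigmaE sG1).
    exact: G1d.
  by apply: GG1; exact: Gs.
have [G' G'G [G1G' H]] := IH t G1 t0 tl l1 G1G G1t.
exists G' => //; split; first exact: subset_trans G1G'.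
move=> u; rewrite inE => /orP[/eqP -> D mD|]; last exact: H.
by apply: G1G'; apply: GG1; exact: Gs.
Qed.

Let finite_indep t (l : seq R) (D : R -> set R) : 0 <= t -> t <= 1 ->
  (forall u, u \in l -> 0 <= u <= t) -> (forall u, measurable (D u)) ->
  exists2 G, separated t G & G [set w | forall u, u \in l -> D u (signal u w)].
Proof.
move=> t0 t1 lt mD.
(* The given times strictly inside (0, t), sorted without repetition. The chain starts from time 0,
   where the signal is constant, and [t] is appended so that independence is obtained at [t]; for t
   = 0 the chain is empty. *)
pose l1 := sort <=%O (undup [seq u <- l | 0 < u < t]).
pose l2 := if 0 < t then rcons l1 t else [::].
have l1P u : u \in l1 = [&& 0 < u, u < t & u \in l].
  by rewrite mem_sort mem_undup mem_filter andbA.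
have last2 : last 0 l2 = t.
  rewrite /l2; case: ltP => [_|t0']; first by rewrite last_rcons.
  by apply/eqP; rewrite eq_le t0 t0'.
have path2 : path <%O 0 l2.
  rewrite /l2; case: ifPn => // t00; rewrite rcons_path; apply/andP; split.
    rewrite lt_path_sortedE sort_lt_sorted undup_uniq andbT.
    by apply/allP => u; rewrite l1P => /and3P[].
  have := mem_last 0 l1; rewrite inE => /orP[/eqP ->//|].
  by rewrite l1P => /and3P[].
have all2 : all (fun u => u <= 1) l2.
  rewrite /l2; case: ifPn => // _; rewrite all_rcons t1/=; apply/allP => u.
  by rewrite l1P => /and3P[_ ut _]; rewrite (le_trans (ltW ut)).
have mem2 u : u \in l -> u \in 0 :: l2.
  move=> ul; have /andP[] := lt u ul; rewrite le_eqVlt => /predU1P[<- _|u0 ut].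
    by rewrite inE eqxx.
  have t00 : 0 < t by exact: lt_le_trans ut.
  rewrite inE /l2 t00 mem_rcons inE l1P u0 ul andbT /=.
  by move: ut; rewrite le_eqVlt => /orP[->|->]; rewrite ?orbT.
have G00 D' : measurable D' -> <<s [set setT]>> (signal 0 @^-1` D').
  move=> mD'; rewrite (_ : signal 0 = cst 0); last by apply/funext => w; rewrite signal0.
  exact: g_sigma_measurable_fun (measurable_cst _) _ mD'.
have [G GG [_ H]] := separated_path (lexx 0) path2 all2 separated0 G00.
rewrite last2 in GG; exists G => //.
have [sG _ _] := GG; rewrite -(sigmaE sG).
have {}H u : u \in l -> forall D, measurable D -> G (signal u @^-1` D).
  by move=> ul; exact: (H u (mem2 u ul)).
elim: l {lt l1 l2 l1P last2 path2 all2 mem2} H => [|v l IH] H.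
  by rewrite (_ : [set w | _] = setT); [exact: g_sigmaT|apply/seteqP; split].
rewrite (_ : [set w | _] = signal v @^-1` (D v) `&`
    [set w | forall u, u \in l -> D u (signal u w)]); last first.
  apply/seteqP; split => w /=.
    by move=> h; split; [apply: h; rewrite inE eqxx|move=> u ul; apply: h; rewrite inE ul orbT].
  by move=> [h1 h2] u; rewrite inE => /orP[/eqP ->//|]; exact: h2.
apply: g_sigmaI.
  by rewrite (sigmaE sG); apply: H => //; rewrite inE eqxx.
by apply: IH => u ul; apply: H; rewrite inE ul orbT.
Qed.

(** Finite-dimensional cylinders form a pi-system generating the history of the signal, and each one
    lies in some separated sigma-algebra. *)
Lemma innov_indep_history t : 0 <= t -> t <= 1 ->
  indep_law Q <<s history signal t>> (innov t) (normal_prob 0 (Num.sqrt (a t))).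
Proof.
move=> t0 t1.
pose G := [set A | exists (l : seq R) (D : R -> set R),
  [/\ forall u, u \in l -> 0 <= u <= t, forall u, measurable (D u) &
     A = [set w | forall u, u \in l -> D u (signal u w)]]].
have : indep_law Q <<s G>> (innov t) (normal_prob 0 (Num.sqrt (a t))).
  apply: (indep_law_sigma (nu := normal_prob 0 (Num.sqrt (a t)))).
  - move=> _ [l [D [lt mD ->]]]; have [G' [_ G'H _] G'A] := finite_indep t0 t1 lt mD.
    exact: (full_history_sub HB mV t1) (G'H _ G'A).
  - move=> _ _ [l1 [D1 [lt1 mD1 ->]]] [l2 [D2 [lt2 mD2 ->]]].
    pose D u := (if u \in l1 then D1 u else setT) `&` (if u \in l2 then D2 u else setT).
    exists (l1 ++ l2), D; split.
    + by move=> u; rewrite mem_cat => /orP[/lt1|/lt2].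
    + by move=> u; apply: measurableI; case: ifPn.
    + apply/seteqP; split => w /=.
        move=> [h1 h2] u _; split; case: ifPn => // ul; [exact: h1|exact: h2].
      move=> h; split => u ul; have := h u; rewrite mem_cat ul ?orbT => /(_ isT)[];
        by rewrite ul.
  - by exists [::], (fun=> setT); split => //; apply/seteqP.
  - exact: measurable_innov.
  - move=> _ [l [D [lt mD ->]]] E mE.
    by have [G' [_ _ G'i] G'A] := finite_indep t0 t1 lt mD; exact: G'i.
apply: sub_indep_law; apply: sub_sigma => A [u /= ut [D mD <-]].
exists [:: u], (fun=> D); split => //.
  by move=> v; rewrite inE => /eqP ->; move: ut; rewrite in_itv.
rewrite setTI; apply/seteqP; split => w /=.
  by move=> h v; rewrite inE => /eqP ->.
by apply; rewrite inE.
Qed.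

Lemma innov_law t : 0 <= t -> t <= 1 -> forall D, measurable D ->
  Q (innov t @^-1` D) = normal_prob 0 (Num.sqrt (a t)) D.
Proof.
move=> t0 t1 D mD; have := innov_indep_history t0 t1 (@g_sigmaT _ _) mD.
by rewrite setTI probability_setT mul1e.
Qed.

Variables (sg : R) (Y : R -> T -> R).
Hypothesis mY : forall t, t \in `[0, 1] -> measurable_fun setT (Y t).
Hypothesis YE : forall t, t \in `[0, 1] -> {ae Q, forall w, Y t w = sg * signal t w}.

Let null := [set E | measurable E /\ Q E = 0%E].

(** The demand is a multiple of the signal only almost surely, at each time separately. Every
    generator of its augmented history is nevertheless equal, modulo a null set, to an event of the
    signal. *)
Lemma innov_indep_null t : 0 <= t -> t <= 1 ->
  indep_law Q <<s history Y t `|` null>> (innov t) (normal_prob 0 (Num.sqrt (a t))).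
Proof.
move=> t0 t1.
have hm : <<s history signal t>> `<=` measurable.
  apply: g_sigma_sub_measurable => A [u /= ut [D mD <-]].
  move: ut; rewrite in_itv/= => /andP[u0 ut].
  by apply: measurable_signal => //; exact: le_trans t1.
apply: (@indep_law_mod_null _ _ _ Q _ <<s history signal t>> _ _ (innov t)) => //.
- exact: measurable_innov.
- move=> A [[u /= ut [D mD <-]]|[mA A0]]; last first.
    split => //; exists set0; first exact: (@measurable0 _ (g_sigma_algebraType (history signal t))).
    by exists A; split => //; rewrite setDv set0D.
  have u01 : u \in `[0, 1].
    by move: ut; rewrite !in_itv/= => /andP[-> ut]; exact: le_trans t1.
  split; first exact: mY.
  have mD' : measurable ((fun x : R => sg * x) @^-1` D).
    by apply: measurable_preimage => //; exact: measurable_funM.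
  exists (signal u @^-1` ((fun x => sg * x) @^-1` D)).
    apply: sub_sigma_algebra; exists u => //.
    by exists ((fun x => sg * x) @^-1` D) => //; rewrite setTI.
  have [N [mN N0 NE]] := YE u01; exists N; split => //.
  rewrite setTI; apply/seteqP; split => w /= [Dw Nw]; split => //;
    by move: Dw; (have -> : Y u w = sg * signal u w by apply: contrapT => ?; apply/Nw/NE).
- exact: innov_indep_history.
Qed.

(** For t < 1 an event of the right limit belongs to the sigma-algebra of every later time, hence is
    independent of the innovation there; path continuity of the innovation brings this back to [t].
    At t = 1 only null sets have been added. *)
Lemma innov_indep_market t : 0 <= t -> t <= 1 ->
  indep_law Q (augmentation (history Y) null t) (innov t)
    (normal_prob 0 (Num.sqrt (a t))).
Proof.
move=> t0; rewrite le_eqVlt => /predU1P[->|t1] A FA.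
  by apply: innov_indep_null => //; apply: FA; right.
pose s n : R := t + (1 - t) / n.+1%:R.
have d0 n : 0 < (1 - t) / n.+1%:R by rewrite divr_gt0// subr_gt0.
have ts n : t < s n by rewrite /s ltrDl.
have s1 n : s n <= 1.
  have e0 : 0 <= 1 - t by rewrite subr_ge0 ltW.
  by rewrite /s -lerBrDl ler_pdivrMr// ler_peMr// ler1n.
have s0 n : 0 <= s n by rewrite (le_trans t0)// ltW.
have As n : <<s history Y (s n) `|` null>> A by apply: FA; left; rewrite ts s1.
have mA : measurable A.
  have hm : history Y 1 `|` null `<=` measurable.
    move=> C [[u /= u01 [D mD <-]]|[]//]; exact: mY.
  by apply: (g_sigma_sub_measurable hm); apply: FA; right.
move=> D mD; rewrite -innov_law// ?ltW//.
have scvg : s n @[n --> \oo] --> t.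
  rewrite -[X in _ --> X]addr0; apply: cvgD; first exact: cvg_cst.
  rewrite -(mulr0 (1 - t)); apply: cvgM; first exact: cvg_cst.
  exact: cvg_harmonic.
have icvg w : innov (s n) w @[n --> \oo] --> innov t w.
  apply: (within_continuous_cvg (@innov_continuous w)) => //=.
    by rewrite in_itv/= t0 ltW.
  by move=> n; rewrite in_itv/= s0 s1.
apply: (@limit_joint_law _ _ _ Q _ _ Q A mA (fun n => innov (s n)) (innov t)
  (fun n => innov (s n)) (innov t)) => //.
- by move=> n; exact: measurable_innov.
- by move=> n; exact: measurable_innov.
- by move=> n E mE; rewrite innov_law//; exact: innov_indep_null.
Qed.

End filtering.

(** * Integrals against future increments *)

Section square_integrable.
Local Open Scope ereal_scope.
Context d (T : measurableType d) (R : realType) (m : {measure set T -> \bar R}).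
Variables (D : set T) (mD : measurable D).
Implicit Types (f g : T -> R).

Lemma integrable_ge0 f : measurable_fun D f -> (forall x, 0 <= f x)%R ->
  \int[m]_(x in D) (f x)%:E < +oo -> m.-integrable D (EFin \o f).
Proof.
move=> mf f0 foo; apply/integrableP; split; first exact/measurable_EFinP.
by under eq_integral do rewrite /= ger0_norm ?f0//.
Qed.

Lemma integrable_mul f g : measurable_fun D f -> measurable_fun D g ->
  \int[m]_(x in D) (f x ^+ 2)%:E < +oo -> \int[m]_(x in D) (g x ^+ 2)%:E < +oo ->
  m.-integrable D (EFin \o (fun x => f x * g x)%R).
Proof.
move=> mf mg f2 g2.
have F2 : m.-integrable D (EFin \o (fun x => f x ^+ 2)%R).
  apply: integrable_ge0 => //; first exact: measurable_funX.
  by move=> x; exact: sqr_ge0.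
have G2 : m.-integrable D (EFin \o (fun x => g x ^+ 2)%R).
  apply: integrable_ge0 => //; first exact: measurable_funX.
  by move=> x; exact: sqr_ge0.
apply: le_integrable (integrable_EFinD mD F2 G2) => //.
  by apply/measurable_EFinP; exact: measurable_funM.
move=> x _ /=; rewrite lee_fin normrM.
rewrite [leRHS]ger0_norm ?addr_ge0 ?sqr_ge0//.
rewrite -(real_normK (num_real (f x))) -(real_normK (num_real (g x))).
have := sqr_ge0 (`|f x| - `|g x|)%R; have := normr_ge0 (f x); have := normr_ge0 (g x).
move: `|f x|%R `|g x|%R => u v u0 v0; nra.
Qed.

Lemma integrable_sqr f : m D < +oo -> measurable_fun D f ->
  \int[m]_(x in D) (f x ^+ 2)%:E < +oo -> m.-integrable D (EFin \o f).
Proof.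
move=> mDoo mf f2.
have -> : f = (fun x => f x * 1)%R by apply/funext => x; rewrite mulr1.
apply: (@integrable_mul f (cst 1%R)) => //.
by rewrite /= integral_cst// expr1n mul1e.
Qed.

Lemma sqr_integral_lty (f g : T -> R) : measurable_fun D f -> measurable_fun D g ->
  \int[m]_(x in D) (f x ^+ 2)%:E < +oo -> \int[m]_(x in D) (g x ^+ 2)%:E < +oo ->
  \int[m]_(x in D) ((f x + g x) ^+ 2)%:E < +oo.
Proof.
move=> mf mg f2 g2.
apply: (@le_lt_trans _ _ (\int[m]_(x in D) (2%:E * ((f x ^+ 2)%:E + (g x ^+ 2)%:E)))).
  apply: ge0_le_integral => //=.
  - by move=> x _; rewrite lee_fin sqr_ge0.
  - by apply/measurable_EFinP; apply: measurable_funX; exact: measurable_funD.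
  - apply/measurable_EFinP; apply: measurable_funM => //.
    by apply: measurable_funD; exact: measurable_funX.
  - move=> x _; rewrite -EFinD -EFinM lee_fin.
    have := sqr_ge0 (f x - g x)%R; nra.
rewrite ge0_integralZl//; last 2 first.
  - by apply/measurable_EFinP; apply: measurable_funD; exact: measurable_funX.
  - by move=> x _; rewrite -EFinD lee_fin addr_ge0 ?sqr_ge0.
rewrite ge0_integralD//; last 4 first.
  - by move=> x _; rewrite lee_fin sqr_ge0.
  - by apply/measurable_EFinP; exact: measurable_funX.
  - by move=> x _; rewrite lee_fin sqr_ge0.
  - by apply/measurable_EFinP; exact: measurable_funX.
by rewrite lte_mul_pinfty// lte_add_pinfty.
Qed.

End square_integrable.

(** By symmetry the positive and negative parts have equal integrals, and these are finite because
    the second moment is. *)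
Lemma normal_mean (R : realType) (s : R) : 0 < s ->
  (normal_prob 0 s).-integrable [set: R] (EFin \o id) /\
  (\int[normal_prob 0 s]_x x%:E = 0)%E.
Proof.
move=> s0.
have iid : (normal_prob 0 s).-integrable [set: R] (EFin \o id).
  apply: (integrable_sqr (m := normal_prob 0 s)) => //.
    by apply: (@le_lt_trans _ _ 1%E); [exact: (probability_le1 (normal_prob 0 s))|rewrite ltry].
  by rewrite normal_moment2// ltry.
split => //; rewrite integralE.
have -> : (\int[normal_prob 0 s]_x (EFin^\- x) = \int[normal_prob 0 s]_x (EFin^\+ x))%E.
  rewrite -(ge0_integral_normalN s0 (f := EFin^\-%E))//; last first.
    by apply/measurable_funeneg/measurable_EFinP.
  by apply: eq_integral => x _; rewrite funeposE funenegE /= opprK.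
rewrite subee//; apply: integrable_pos_fin_num => //.
Qed.

Section known.
Context (R : realType) d (T : measurableType d) (Q : probability T R).
Variables (B : R -> T -> R) (V : T -> R).
Hypotheses (HB : is_brownian Q B) (mV : measurable_fun setT V).
Hypothesis VB : forall A, <<s history B 1>> A -> forall D, measurable D ->
  Q (A `&` V @^-1` D) = (Q A * Q (V @^-1` D))%E.

Definition null_sets : set_system T := [set E | measurable E /\ Q E = 0%E].

(* The insider's filtration, augmented with the null sets of the single
   probability [Q]. *)
Definition known := augmentation (full_history B V) null_sets.

Lemma known_measurable t A : known t A -> measurable A.
Proof.
move=> /(_ 1)/(_ (or_intror erefl)); apply: g_sigma_sub_measurable => C [|[]//].
exact: (full_history_measurable HB mV (lexx 1)).
Qed.

Lemma known_sigma_algebra t : sigma_algebra setT (known t).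
Proof.
split=> [s _|A kA s hs|F kF s hs].
- exact: (@measurable0 _ (g_sigma_algebraType _)).
- by rewrite setTD; apply: (@measurableC _ (g_sigma_algebraType _)); exact: kA.
- apply: (@bigcup_measurable _ (g_sigma_algebraType _) F setT) => n _.
  exact: kF.
Qed.

Lemma known_null t A : null_sets A -> known t A.
Proof. by move=> nA s _; apply: sub_sigma_algebra; right. Qed.

(** Allows an adapted process to be modified on a null set. [A'] has to be measurable since only
    measurable null sets are adjoined. *)
Lemma known_eq_mod_null t A A' : known t A -> measurable A' -> eq_mod_null Q A A' ->
  known t A'.
Proof.
move=> kA mA' [N [mN N0 AA']].
have mA := known_measurable kA.
rewrite -(sigma_algebra_id (@known_sigma_algebra t)).
have nN C : measurable C -> <<s known t>> (C `&` N).
  move=> mC; apply: sub_sigma_algebra; apply: known_null; split; first exact: measurableI.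
  by apply/eqP; rewrite eq_le measure_ge0 -N0 andbT le_measure// ?inE//; exact: measurableI.
rewrite -(setUIDK A' N) -AA'.
apply: (@measurableU _ (g_sigma_algebraType _)); first exact: nN.
apply: (@measurableD _ (g_sigma_algebraType _)); first exact: sub_sigma_algebra.
by rewrite -(setTI N); exact: nN.
Qed.

(** The right limit is handled as for the market: the increment over [s, 1] is independent of what
    is known slightly before s, and s decreases to [t] along continuous paths. *)
Lemma known_indep t : 0 <= t -> t < 1 ->
  indep_law Q (known t) (increment B t 1) (normal_prob 0 (Num.sqrt (1 - t))).
Proof.
move=> t0 t1 A kA D mD.
(* The denominator starts at 2, so that every [s n] stays strictly below 1. *)
pose s n : R := t + (1 - t) / n.+2%:R.
have e0 : 0 < 1 - t by rewrite subr_gt0.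
have d0 n : 0 < (1 - t) / n.+2%:R by rewrite divr_gt0.
have ts n : t < s n by rewrite /s ltrDl.
have s1 n : s n < 1.
  rewrite /s -ltrBrDl ltr_pdivrMr// -[ltLHS]mulr1 ltr_pM2l//.
  by rewrite ltr1n.
have s0 n : 0 <= s n by rewrite (le_trans t0)// ltW.
have mA := known_measurable kA.
have t01 : t \in `[0, 1] by rewrite in_itv/= t0 ltW.
have minc u : 0 <= u -> u < 1 -> measurable_fun setT (increment B u 1).
  by move=> u0 u1; apply: (measurable_increment HB) => //; exact: ltW.
have incD n E : measurable E -> Q (increment B (s n) 1 @^-1` E) =
    normal_prob 0 (Num.sqrt (1 - s n)) E.
  move=> mE; have := increment_indep HB mV VB (s0 n) (s1 n) (lexx 1) (@g_sigmaT _ _) mE.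
  by rewrite setTI probability_setT mul1e.
have incDt E : measurable E -> Q (increment B t 1 @^-1` E) =
    normal_prob 0 (Num.sqrt (1 - t)) E.
  move=> mE; have := increment_indep HB mV VB t0 t1 (lexx 1) (@g_sigmaT _ _) mE.
  by rewrite setTI probability_setT mul1e.
have scvg : s n @[n --> \oo] --> t.
  rewrite -[X in _ --> X]addr0; apply: cvgD; first exact: cvg_cst.
  rewrite -(mulr0 (1 - t)); apply: cvgM; first exact: cvg_cst.
  by have := @cvg_harmonic R; rewrite -cvg_shiftS.
have icvg w : increment B (s n) 1 w @[n --> \oo] --> increment B t 1 w.
  apply: cvgB; first exact: cvg_cst.
  have [_ _ cB _ _] := HB.
  apply: (within_continuous_cvg (cB w)) => //.
  by move=> n; rewrite /= in_itv/= s0 ltW.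
rewrite -incDt//.
apply: (@limit_joint_law _ _ _ Q _ _ Q A mA (fun n => increment B (s n) 1) _
  (fun n => increment B (s n) 1) _) => //; try by move=> n; exact: minc.
move=> n E mE; rewrite incD//.
have : <<s full_history B V (s n) `|` null_sets>> A.
  by apply: kA; left; rewrite ts ltW.
move=> knA; apply: (@indep_law_mod_null _ _ _ Q (full_history B V (s n) `|` null_sets)
  <<s full_history B V (s n)>> _ _ (increment B (s n) 1)) => //.
- exact: (full_history_sub HB mV (ltW (s1 n))).
- exact: minc.
- move=> C [hC|[mC C0]].
    split; first exact: (full_history_measurable HB mV (ltW (s1 n))).
    by exists C; [exact: sub_sigma_algebra|exists set0; split].
  split => //; exists set0.
    exact: (@measurable0 _ (g_sigma_algebraType (full_history B V (s n)))).
  by exists C; split => //; rewrite setDv set0D.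
- exact: (increment_indep HB mV VB).
Qed.

Lemma known_measurable_fun t (X : T -> R) :
  (forall D, measurable D -> known t (X @^-1` D)) -> measurable_fun setT X.
Proof. by move=> kX _ D mD; rewrite setTI; apply: (@known_measurable t); exact: kX. Qed.

Lemma increment_law s t : 0 <= s -> s < t -> t <= 1 -> forall D, measurable D ->
  Q (increment B s t @^-1` D) = normal_prob 0 (Num.sqrt (t - s)) D.
Proof.
move=> s0 st t1 D mD; have := increment_indep HB mV VB s0 st t1 (@g_sigmaT _ _) mD.
by rewrite setTI probability_setT mul1e.
Qed.

Lemma ge0_integral_increment s t (f : R -> \bar R) : 0 <= s -> s < t -> t <= 1 ->
  measurable_fun setT f -> (forall x, 0 <= f x)%E ->
  (\int[Q]_w f (increment B s t w) = \int[normal_prob 0 (Num.sqrt (t - s))]_x f x)%E.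
Proof.
move=> s0 st t1 mf f0.
rewrite (ge0_integral_indep (P := Q) (nu := normal_prob 0 (Num.sqrt (t - s))) measurableT
  (measurable_increment HB s0 (ltW st) t1))//.
  by rewrite probability_setT mul1e.
by move=> D mD; rewrite setTI probability_setT mul1e increment_law.
Qed.

Lemma increment_moment2 s t : 0 <= s -> s <= t -> t <= 1 ->
  (\int[Q]_w (increment B s t w ^+ 2)%:E = (t - s)%:E)%E.
Proof.
move=> s0; rewrite le_eqVlt => /predU1P[->|st] t1.
  rewrite subrr -[RHS](integral0 Q setT); apply: eq_integral => w _.
  by rewrite /increment subrr expr0n.
rewrite (ge0_integral_increment (f := fun x => (x ^+ 2)%:E))//.
- by rewrite normal_moment2 ?sqrtr_gt0 ?subr_gt0// sqr_sqrtr// subr_ge0 ltW.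
- by apply/measurable_EFinP; exact: measurable_funX.
- by move=> x; rewrite lee_fin sqr_ge0.
Qed.

Lemma increment_moment4 s t : 0 <= s -> s <= t -> t <= 1 ->
  (\int[Q]_w (increment B s t w ^+ 4)%:E = (3 * (t - s) ^+ 2)%:E)%E.
Proof.
move=> s0; rewrite le_eqVlt => /predU1P[->|st] t1.
  rewrite subrr expr0n mulr0 -[RHS](integral0 Q setT); apply: eq_integral => w _.
  by rewrite /increment subrr expr0n.
rewrite (ge0_integral_increment (f := fun x => (x ^+ 4)%:E))//.
- rewrite normal_moment4 ?sqrtr_gt0 ?subr_gt0// (exprM _ 2 2) sqr_sqrtr//.
  by rewrite subr_ge0 ltW.
- by apply/measurable_EFinP; exact: measurable_funX.
- by move=> x; rewrite lee_fin (exprM _ 2 2) sqr_ge0.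
Qed.

(** The form in which the martingale property of the noise is used: increments are always taken up
    to the final time. At t = 1 the increment is 0. *)
Lemma integral_known_increment t (X : T -> R) : 0 <= t -> t <= 1 ->
  (forall D, measurable D -> known t (X @^-1` D)) ->
  Q.-integrable setT (EFin \o X) ->
  Q.-integrable setT (fun w => (X w * increment B t 1 w)%:E) /\
  (\int[Q]_w (X w * increment B t 1 w)%:E = 0)%E.
Proof.
move=> t0; rewrite le_eqVlt => /predU1P[->|t1] kX iX.
  have -> : (fun w => (X w * increment B 1 1 w)%:E) = cst 0%E.
    by apply/funext => w; rewrite /increment subrr mulr0.
  by split; [exact: integrable0|exact: integral0].
have v0 : 0 < Num.sqrt (1 - t) by rewrite sqrtr_gt0 subr_gt0.
have [iid E0] := normal_mean v0.
have mX := known_measurable_fun kX.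
have mI := measurable_increment HB t0 (ltW t1) (lexx 1).
have ind D E : measurable D -> measurable E ->
    (Q (X @^-1` D `&` increment B t 1 @^-1` E) =
     Q (X @^-1` D) * normal_prob 0 (Num.sqrt (1 - t)) E)%E.
  by move=> mD mE; apply: known_indep => //; exact: kX.
have H := integral_indep_mul (nu := normal_prob 0 (Num.sqrt (1 - t))) (X := X)
  (Y := increment B t 1) (g := id) mX mI (@measurable_id _ _ setT) ind iX.
exact: (H iid E0).
Qed.

End known.

(** * The insider's control problem *)

(* The value function of the insider's control problem is quadratic in the
   mispricing, with leading coefficient [(1 - t) / (2 * depth t)]. *)
Section control.
Context (R : realType).
Notation mu := (@lebesgue_measure R).
Variables (lam c : R) (lam0 : 0 < lam) (c0 : 0 < c).

Definition depth (t : R) : R := c + lam * (1 - t).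
Definition riccati (t : R) : R := (1 - t) / depth t.

Lemma depth_ge t : t <= 1 -> c <= depth t.
Proof. by move=> t1; rewrite lerDl mulr_ge0 ?subr_ge0// ltW. Qed.

Lemma depth_gt0 t : t <= 1 -> 0 < depth t.
Proof. by move=> t1; apply: lt_le_trans c0 _; exact: depth_ge. Qed.

Lemma is_derive_depth (t : R) : is_derive t (1 : R) depth (- lam).
Proof.
rewrite (_ : depth = cst c + (cst lam * (cst 1 - id))).
  have := @is_deriveD R R R (cst c) (cst lam * (cst 1 - id)) t 1 _ _ (is_derive_cst _ _ _)
    (@is_deriveM R R (cst lam) (cst 1 - id) t 1 _ _ (is_derive_cst _ _ _)
      (@is_deriveB R R R (cst 1) id t 1 _ _ (is_derive_cst _ _ _) (is_derive_id _ _))).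
  by move/is_derive_eq; apply; rewrite /GRing.scale/= sub0r mulrN1 mulr0 addr0 add0r.
by apply/funext.
Qed.

Lemma is_derive_depthV (t : R) : t <= 1 ->
  is_derive t (1 : R) (fun u => (depth u)^-1) (lam / depth t ^+ 2).
Proof.
move=> t1; have qn0 := lt0r_neq0 (depth_gt0 t1).
have := is_deriveV qn0 (is_derive_depth t).
by move/is_derive_eq; apply; rewrite /GRing.scale/= mulrNN mulrC.
Qed.

Lemma is_derive_riccati (t : R) : t <= 1 ->
  is_derive t (1 : R) riccati (- c / depth t ^+ 2).
Proof.
move=> t1; have qn0 := lt0r_neq0 (depth_gt0 t1).
have H1 : is_derive t (1 : R) (cst (1 : R) - id) (0 - 1).
  exact: (@is_deriveB R R R (cst 1) id t 1 _ _ (is_derive_cst _ _ _) (is_derive_id _ _)).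
have := is_deriveM H1 (is_derive_depthV t1).
move/is_derive_eq; apply; rewrite /GRing.scale/= (_ : (cst 1 - id) t = 1 - t)//.
by rewrite sub0r /depth; move: qn0; rewrite /depth => qn0; field.
Qed.

Lemma continuous_depthV2 : {within `[0, 1], continuous (fun t => (depth t ^+ 2)^-1)}.
Proof.
apply: continuous_in_subspaceT => t; rewrite inE/= in_itv/= => /andP[_ t1].
have [/derivable1_diffP/differentiable_continuous cq _] := is_derive_depth t.
apply: cvgV; first by rewrite expf_neq0// lt0r_neq0// depth_gt0.
by apply: cvgM.
Qed.

Lemma continuous_depthV : {within `[0, 1], continuous (fun t => (depth t)^-1)}.
Proof.
apply: continuous_in_subspaceT => t; rewrite inE/= in_itv/= => /andP[_ t1].
have [/derivable1_diffP/differentiable_continuous cq _] := is_derive_depth t.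
by apply: cvgV; first by rewrite lt0r_neq0// depth_gt0.
Qed.

Lemma continuous_drift_riccati :
  {within `[0, 1], continuous (fun t => - c / depth t ^+ 2)}.
Proof. by move=> x; apply: cvgM; [exact: cvg_cst|exact: continuous_depthV2]. Qed.

Lemma primitive_from_riccati :
  primitive_from (c + lam)^-1 (fun t => - c / depth t ^+ 2) riccati.
Proof.
have -> : (c + lam)^-1 = riccati 0 by rewrite /riccati /depth subr0 mulr1 mul1r.
apply: primitive_from_is_derive; last exact: continuous_drift_riccati.
by move=> t; rewrite in_itv/= => /andP[_ t1]; exact: is_derive_riccati.
Qed.

Lemma continuous_riccati : {within `[0, 1], continuous riccati}.
Proof. exact: primitive_from_continuous primitive_from_riccati. Qed.

Lemma riccati1 : riccati 1 = 0.
Proof. by rewrite /riccati subrr mul0r. Qed.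

Lemma integral_riccati : \int[mu]_(s in `[0, 1]) (- c / depth s ^+ 2 * s) =
  - (lam^-1 + c / lam ^+ 2 * ln (c / (c + lam))).
Proof.
have cl0 : 0 < c + lam by exact: addr_gt0.
(* Writing t = (c + lam - depth t) / lam splits t / depth^2 into multiples of 1 / depth^2 and 1 /
   depth, whose primitives are 1 / depth and the logarithm. *)
pose F (t : R) := - (c / lam ^+ 2) * ((c + lam) * (depth t)^-1 + ln (depth t)).
pose f (t : R) := - c / depth t ^+ 2 * t.
have dF : {in `[0, 1], forall x, is_derive x (1 : R) F (f x)}.
  move=> t; rewrite in_itv/= => /andP[_ t1].
  have q0 := depth_gt0 t1.
  have H1 : is_derive t (1 : R) ((@ln R) \o depth) ((depth t)^-1 * (- lam)).
    by apply: is_derive1_comp; [exact: is_derive1_ln|exact: is_derive_depth].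
  have H2 := @is_deriveM R R (cst (c + lam)) _ t 1 _ _ (is_derive_cst _ _ _) (is_derive_depthV t1).
  have := @is_deriveM R R (cst (- (c / lam ^+ 2))) _ t 1 _ _ (is_derive_cst _ _ _) (is_deriveD H2 H1).
  move/is_derive_eq; apply; rewrite /GRing.scale/= /f.
  rewrite !mulr0 !addr0; have := lt0r_neq0 q0; rewrite /depth => qn0.
  by field; rewrite qn0 lt0r_neq0.
have cf : {within `[0, 1], continuous f}.
  move=> x; apply: cvgM; first exact: continuous_drift_riccati.
  have cid : continuous (fun s : R => s) by move=> y; exact: cvg_id.
  exact: (continuous_subspaceT cid).
rewrite /Rintegral (integral_is_derive ltr01 dF cf)/=.
rewrite /F /depth subrr mulr0 addr0 subr0 mulr1.
rewrite lnM ?posrE ?invr_gt0// lnV ?posrE//.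
by field; rewrite !lt0r_neq0.
Qed.

Let m01 : measurable (`[0, 1]%classic : set (measurableTypeR R)).
Proof. exact: measurable_itv. Qed.

Let square01 (f : R -> R) := measurable_fun (`[0, 1]%classic : set R) f /\
  (\int[mu]_(x in `[0%R, 1%R]) (f x ^+ 2)%:E < +oo)%E.

Let square_continuous (f : R -> R) : {within `[0, 1], continuous f} -> square01 f.
Proof.
move=> cf; split; first by apply: subspace_continuous_measurable_fun.
have cf2 : {within `[0, 1], continuous (fun x => f x ^+ 2)}.
  by move=> x; apply: cvgM; exact: cf.
have fi := integrable_continuous01 cf2.
by rewrite EFin_Rintegral// ltry.
Qed.

Let square_mul f g : square01 f -> square01 g ->
  mu.-integrable `[0, 1] (EFin \o (fun x => f x * g x)).
Proof. by move=> [mf f2] [mg g2]; exact: integrable_mul. Qed.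

Let squareD f g : square01 f -> square01 g -> square01 (fun x => f x + g x).
Proof.
move=> [mf f2] [mg g2]; split; first exact: measurable_funD.
exact: sqr_integral_lty.
Qed.

Let squareM_continuous (f g : R -> R) : square01 f -> {within `[0, 1], continuous g} ->
  square01 (fun x => f x * g x).
Proof.
move=> [mf f2] cg; have [mg _] := square_continuous cg; split.
  exact: measurable_funM.
have cg2 : {within `[0, 1], continuous (fun x => g x ^+ 2)}.
  by move=> x; apply: cvgM; exact: cg.
have [K K0 gK] : exists2 K : R, 0 < K & forall x, x \in `[0, 1] -> `|g x ^+ 2| <= K.
  have /compact_bounded[M [_ Mg]] := continuous_compact cg2 (@segment_compact _ 0 1).
  exists (Num.max 1 (M + 1)); first by rewrite lt_max ltr01.
  move=> x x01; apply: (Mg (Num.max 1 (M + 1))).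
    by rewrite lt_max ltrDl ltr01 orbT.
  by exists x.
apply: (@le_lt_trans _ _ (\int[mu]_(x in `[0%R, 1%R]) (K%:E * (f x ^+ 2)%:E))%E).
  apply: ge0_le_integral => //=.
  - by move=> x _; rewrite lee_fin sqr_ge0.
  - by apply/measurable_EFinP; apply: measurable_funX; exact: measurable_funM.
  - by apply/measurable_EFinP; apply: measurable_funM => //; exact: measurable_funX.
  - move=> x x01; rewrite -EFinM lee_fin exprMn mulrC ler_wpM2r ?sqr_ge0//.
    by apply: le_trans (gK x x01); exact: ler_norm.
rewrite ge0_integralZl//=.
- by rewrite lte_mul_pinfty// lee_fin ltW.
- by apply/measurable_EFinP; exact: measurable_funX.
- by move=> x _; rewrite lee_fin sqr_ge0.
- by rewrite lee_fin ltW.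
Qed.

Variables (x0 : R) (al th b : R -> R).

Definition mispricing s := x0 - lam * th s - b s.

(* The density of [riccati s * (x0 - lam * th s)]. *)
Definition control_density s :=
  - c / depth s ^+ 2 * (x0 - lam * th s) - riccati s * (lam * al s).

(** Only the last term is quadratic in the deviation from the feedback mispricing / depth. The noise
    is written as its terminal value minus a future increment, so that the strategy-dependent cross
    term has mean zero once the scenario is random. *)
Lemma pathwise_wealth :
  (\int[mu]_(x in `[0%R, 1%R]) (al x ^+ 2)%:E < +oo)%E ->
  primitive_from 0 al th -> {within `[0, 1], continuous b} ->
  [/\ mu.-integrable `[0, 1] (EFin \o (fun s => mispricing s * al s)),
      mu.-integrable `[0, 1] (EFin \o (fun s => control_density s * (b 1 - b s))),
      mu.-integrable `[0, 1] (EFin \o (fun s => (al s - mispricing s / depth s) ^+ 2)) &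
  \int[mu]_(s in `[0, 1]) (mispricing s * al s) -
    c / 2 * \int[mu]_(s in `[0, 1]) (al s ^+ 2) =
  x0 ^+ 2 / (2 * (c + lam)) - b 1 * x0 / (c + lam)
  - \int[mu]_(s in `[0, 1]) (control_density s * (b 1 - b s))
  - 2^-1 * \int[mu]_(s in `[0, 1]) (- c / depth s ^+ 2 * b s ^+ 2)
  - c / 2 * \int[mu]_(s in `[0, 1]) ((al s - mispricing s / depth s) ^+ 2)].
Proof.
move=> al2 pth cb.
have mal : measurable_fun (`[0, 1]%classic : set R) al by have [/integrableP[/measurable_EFinP]] := pth.
have Sal : square01 al by [].
have cth := primitive_from_continuous pth.
have cXi : {within `[0, 1], continuous (fun s => x0 - lam * th s)}.
  move=> x; apply: cvgB; first exact: cvg_cst.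
  by apply: cvgM; [exact: cvg_cst|exact: cth].
have cx : {within `[0, 1], continuous mispricing}.
  by move=> x; apply: cvgB; [exact: cXi|exact: cb].
have Sx := square_continuous cx.
have pXi : primitive_from x0 (fun s => - lam * al s) (fun s => x0 - lam * th s).
  have := primitive_fromD (primitive_from_cst x0) (primitive_fromZ (- lam) pth).
  rewrite mulr0 addr0 => H; apply: (eq_primitive_from H) => s _ /=; first by rewrite add0r.
  by rewrite mulNr.
have pf := primitive_fromM primitive_from_riccati pXi.
have {}pf : primitive_from (x0 / (c + lam)) control_density
    (fun s => riccati s * (x0 - lam * th s)).
  by rewrite mulrC; apply: (eq_primitive_from pf) => s _ //; rewrite /control_density; ring.
have pk := primitive_fromM pf pXi.
(* With Xi = x0 - lam th, [control_density] and [k] are the densities of riccati Xi and riccati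
   Xi^2. As riccati vanishes at 1, their integrals are minus the initial values, whatever the
   strategy. *)
pose k s := control_density s * (x0 - lam * th s) +
  riccati s * (x0 - lam * th s) * (- lam * al s).
have t11 : (1 : R) \in `[0, 1] by rewrite in_itv/= ler01 lexx.
have fE : \int[mu]_(s in `[0, 1]) control_density s = - (x0 / (c + lam)).
  have [_ /(_ 1 t11)] := pf; rewrite riccati1 mul0r => /eqP.
  by rewrite eq_sym addrC addr_eq0 => /eqP.
have kE : \int[mu]_(s in `[0, 1]) k s = - (x0 / (c + lam) * x0).
  have [_ /(_ 1 t11)] := pk; rewrite riccati1 !mul0r => /eqP.
  by rewrite eq_sym addrC addr_eq0 => /eqP.
have iF : mu.-integrable `[0, 1] (EFin \o control_density) by have [] := pf.
have iK : mu.-integrable `[0, 1] (EFin \o k) by have [] := pk.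
have Sf : square01 control_density.
  apply: squareD.
    apply: square_continuous => x; apply: cvgM; last exact: cXi.
    exact: continuous_drift_riccati.
  have -> : (fun s => - (riccati s * (lam * al s))) = (fun s => al s * (- lam * riccati s)).
    by apply/funext => s; ring.
  apply: squareM_continuous => // x; apply: cvgM; first exact: cvg_cst.
  exact: continuous_riccati.
have cdb : {within `[0, 1], continuous (fun s => b 1 - b s)}.
  by move=> x; apply: cvgB; [exact: cvg_cst|exact: cb].
have iFb := square_mul Sf (square_continuous cdb).
have iA : mu.-integrable `[0, 1] (EFin \o (fun s => - c / depth s ^+ 2 * b s ^+ 2)).
  apply: integrable_continuous01 => x.
  by apply: cvgM; [exact: continuous_drift_riccati|apply: cvgM; exact: cb].
have ixa := square_mul Sx Sal.
have ia2 : mu.-integrable `[0, 1] (EFin \o (fun s => al s ^+ 2)) := square_mul Sal Sal.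
have Sd : square01 (fun s => al s - mispricing s / depth s).
  apply: squareD => //; apply: square_continuous => x; apply: cvgN.
  by apply: cvgM; [exact: cx|exact: continuous_depthV].
have id2 : mu.-integrable `[0, 1] (EFin \o (fun s => (al s - mispricing s / depth s) ^+ 2))
  := square_mul Sd Sd.
split => //.
rewrite -[X in _ - X]RintegralZl// -RintegralB//; last exact: integrable_EFinZ.
have ib1f := integrable_EFinZ m01 (b 1) iF.
have ik2 := integrable_EFinZ m01 2^-1 iK.
have iA2 := integrable_EFinZ m01 2^-1 iA.
have id3 := integrable_EFinZ m01 (c / 2) id2.
have I1 := integrable_EFinB m01 ib1f ik2.
have I2 := integrable_EFinB m01 I1 iFb.
have I3 := integrable_EFinB m01 I2 iA2.
transitivity (\int[mu]_(s in `[0, 1]) (b 1 * control_density s - 2^-1 * k s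
   - control_density s * (b 1 - b s) - 2^-1 * (- c / depth s ^+ 2 * b s ^+ 2)
   - c / 2 * (al s - mispricing s / depth s) ^+ 2)).
  apply: eq_Rintegral => s; rewrite inE/= in_itv/= => /andP[_ s1].
  have := lt0r_neq0 (depth_gt0 s1).
  rewrite /k /control_density /mispricing /riccati /depth => qn0.
  by field.
rewrite RintegralB// RintegralB// RintegralB// RintegralB//.
rewrite (RintegralZl _ m01 iF) (RintegralZl _ m01 iK) (RintegralZl _ m01 iA) (RintegralZl _ m01 id2).
rewrite fE kE; have cl0 : c + lam != 0 by rewrite lt0r_neq0// addr_gt0.
by congr (_ - _ - _ - _); field.
Qed.

End control.

Section integral_EFin.
Local Open Scope ereal_scope.
Context d (T : measurableType d) (R : realType) (m : {measure set T -> \bar R}).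
Variables (D : set T) (mD : measurable D).
Implicit Types (f g : T -> R).

Lemma integral_EFinD f g : m.-integrable D (EFin \o f) ->
  m.-integrable D (EFin \o g) ->
  \int[m]_(x in D) (f x + g x)%R%:E = \int[m]_(x in D) (f x)%:E + \int[m]_(x in D) (g x)%:E.
Proof. by move=> fi gi; rewrite -integralD//; apply: eq_integral => x _. Qed.

Lemma integral_EFinB f g : m.-integrable D (EFin \o f) ->
  m.-integrable D (EFin \o g) ->
  \int[m]_(x in D) (f x - g x)%R%:E = \int[m]_(x in D) (f x)%:E - \int[m]_(x in D) (g x)%:E.
Proof. by move=> fi gi; rewrite -integralB//; apply: eq_integral => x _. Qed.

Lemma integral_EFinZ k f : m.-integrable D (EFin \o f) ->
  \int[m]_(x in D) (k * f x)%R%:E = k%:E * \int[m]_(x in D) (f x)%:E.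
Proof. by move=> fi; rewrite -integralZl//; apply: eq_integral => x _. Qed.

End integral_EFin.

(** * Nonnegative integrals over time and scenarios *)

Section double_integrals.
Local Open Scope ereal_scope.
Context (R : realType) d (T : measurableType d) (Q : probability T R).
Notation mu := (@lebesgue_measure R).
Notation unit_box := (`[(0 : R)%R, 1%R]%classic `*` [set: T]).
Notation dint F := (\int[Q]_w \int[mu]_(s in `[0%R, 1%R]) F s w).
Implicit Types (f g : R -> T -> R).

Let m01 : measurable (`[0%R, 1%R]%classic : set R).
Proof. exact: measurable_itv. Qed.

Lemma measurable_section f w : measurable_fun unit_box (fun p => f p.1 p.2) ->
  measurable_fun (`[0%R, 1%R]%classic : set R) (f^~ w).
Proof.
move=> mf; apply: (@measurable_comp _ _ _ _ _ _ unit_box (fun p => f p.1 p.2) _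
  (fun s => (s, w))) => //.
- exact: measurableX.
- by move=> _ [s s01 <-].
- exact: measurable_funTS.
Qed.

Let measurable_inner f : measurable_fun unit_box (fun p => f p.1 p.2) ->
  measurable_fun setT (fun w => \int[mu]_(s in `[0%R, 1%R]) (f s w)%:E).
Proof.
move=> mf; apply: (measurable_integral_process (f := fun s w => (f s w)%:E)).
exact/measurable_EFinP.
Qed.

Lemma double_integral_le f g : measurable_fun unit_box (fun p => f p.1 p.2) ->
  measurable_fun unit_box (fun p => g p.1 p.2) ->
  (forall s w, s \in `[0, 1]%R -> 0 <= f s w <= g s w)%R ->
  dint (fun s w => (f s w)%:E) <= dint (fun s w => (g s w)%:E).
Proof.
move=> mf mg fg; apply: ge0_le_integral => //.
- move=> w _; apply: integral_ge0 => s s01; rewrite lee_fin.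
  by have /andP[] := fg s w s01.
- exact: measurable_inner.
- exact: measurable_inner.
- move=> w _; apply: ge0_le_integral => //.
  + by move=> s s01; rewrite lee_fin; have /andP[] := fg s w s01.
  + by apply/measurable_EFinP; exact: measurable_section.
  + by apply/measurable_EFinP; exact: measurable_section.
  + by move=> s s01; rewrite lee_fin; have /andP[] := fg s w s01.
Qed.

Lemma double_integralD f g : measurable_fun unit_box (fun p => f p.1 p.2) ->
  measurable_fun unit_box (fun p => g p.1 p.2) ->
  (forall s w, 0 <= f s w)%R -> (forall s w, 0 <= g s w)%R ->
  dint (fun s w => (f s w + g s w)%:E) =
  dint (fun s w => (f s w)%:E) + dint (fun s w => (g s w)%:E).
Proof.
move=> mf mg f0 g0; rewrite -ge0_integralD//; first last.
- exact: measurable_inner.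
- by move=> w _; apply: integral_ge0 => s _; rewrite lee_fin.
- exact: measurable_inner.
- by move=> w _; apply: integral_ge0 => s _; rewrite lee_fin.
apply: eq_integral => w _; rewrite -ge0_integralD//.
- by move=> s _; rewrite lee_fin.
- by apply/measurable_EFinP; exact: measurable_section.
- by move=> s _; rewrite lee_fin.
- by apply/measurable_EFinP; exact: measurable_section.
Qed.

Lemma double_integralZ f (k : R) : measurable_fun unit_box (fun p => f p.1 p.2) ->
  (forall s w, 0 <= f s w)%R -> (0 <= k)%R ->
  dint (fun s w => (k * f s w)%:E) = k%:E * dint (fun s w => (f s w)%:E).
Proof.
move=> mf f0 k0; rewrite -ge0_integralZl//; first last.
- by move=> w _; apply: integral_ge0 => s _; rewrite lee_fin.
- exact: measurable_inner.
apply: eq_integral => w _; rewrite -ge0_integralZl//.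
- by apply/measurable_EFinP; exact: measurable_section.
- by move=> s _; rewrite lee_fin.
Qed.

Lemma double_integral_cst (k : R) : dint (fun _ _ => k%:E) = k%:E.
Proof.
rewrite (eq_integral (cst k%:E)); last first.
  by move=> w _; rewrite integral_cst//= lebesgue_measure_itv/= lte_fin ltr01 -EFinB subr0 mule1.
rewrite integral_cst//; transitivity (k%:E * 1); last exact: mule1.
by congr (_ * _); exact: probability_setT.
Qed.

Lemma double_integral_mul_lty f g :
  measurable_fun unit_box (fun p => f p.1 p.2) ->
  measurable_fun unit_box (fun p => g p.1 p.2) ->
  dint (fun s w => (f s w ^+ 2)%:E) < +oo -> dint (fun s w => (g s w ^+ 2)%:E) < +oo ->
  \int[mu]_(s in `[0%R, 1%R]) \int[Q]_w `|(f s w * g s w)%:E| < +oo.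
Proof.
move=> mf mg f2 g2.
have mf2 : measurable_fun unit_box (fun p => (f p.1 p.2 ^+ 2)%R) by exact: measurable_funX.
have mg2 : measurable_fun unit_box (fun p => (g p.1 p.2 ^+ 2)%R) by exact: measurable_funX.
have mfg : measurable_fun unit_box (fun p => (f p.1 p.2 * g p.1 p.2)%R).
  exact: measurable_funM.
have mabs : measurable_fun unit_box (fun p => `|(f p.1 p.2 * g p.1 p.2)%:E|).
  by apply: measurableT_comp => //; exact/measurable_EFinP.
rewrite -(tonelli_process Q (f := fun s w => `|(f s w * g s w)%:E|) mabs (fun _ _ => abse_ge0 _)).
apply: (@le_lt_trans _ _ (dint (fun s w => (f s w ^+ 2 + g s w ^+ 2)%:E))).
  apply: (double_integral_le (f := fun s w => `|f s w * g s w|%R)).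
  - exact: measurableT_comp.
  - exact: measurable_funD.
  - move=> s w _; rewrite normr_ge0 normrM -(real_normK (num_real (f s w))).
    rewrite -(real_normK (num_real (g s w))) /=.
    have := normr_ge0 (f s w); have := normr_ge0 (g s w).
    move: `|f s w|%R `|g s w|%R => u v u0 v0; nra.
rewrite (double_integralD (f := fun s w => (f s w ^+ 2)%R) (g := fun s w => (g s w ^+ 2)%R)
  mf2 mg2 (fun _ _ => sqr_ge0 _) (fun _ _ => sqr_ge0 _)).
exact: lte_add_pinfty.
Qed.

Lemma integrable_double_integral f : measurable_fun unit_box (fun p => f p.1 p.2) ->
  (forall s w, s \in `[0, 1]%R -> 0 <= f s w)%R ->
  (forall w, mu.-integrable `[0%R, 1%R] (EFin \o f^~ w)) ->
  dint (fun s w => (f s w)%:E) < +oo ->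
  Q.-integrable setT (fun w => (\int[mu]_(s in `[0%R, 1%R]) f s w)%R%:E) /\
  \int[Q]_w (\int[mu]_(s in `[0%R, 1%R]) f s w)%R%:E = dint (fun s w => (f s w)%:E).
Proof.
move=> mf f0 fi foo.
have E : \int[Q]_w (\int[mu]_(s in `[0%R, 1%R]) f s w)%R%:E = dint (fun s w => (f s w)%:E).
  by apply: eq_integral => w _; rewrite EFin_Rintegral//; exact: fi.
split => //; apply: (integrable_ge0 (f := fun w => (\int[mu]_(s in `[0%R, 1%R]) f s w)%R)) => //.
- exact: measurable_Rintegral_process.
- by move=> w; apply: Rintegral_ge0 => // s; exact: f0.
- by rewrite E.
Qed.

End double_integrals.

Section anticipating.
Context (R : realType) d (T : measurableType d) (Q : probability T R).
Variables (B : R -> T -> R) (V : T -> R).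
Hypotheses (HB : is_brownian Q B) (mV : measurable_fun setT V).
Hypothesis VB : forall A, <<s history B 1>> A -> forall D, measurable D ->
  Q (A `&` V @^-1` D) = (Q A * Q (V @^-1` D))%E.
Notation mu := (@lebesgue_measure R).
Notation unit_box := (`[(0 : R), 1]%classic `*` [set: T]).
Notation dint F := (\int[Q]_w \int[mu]_(s in `[0%R, 1%R]) F s w)%E.

Lemma measurable_process_increment :
  measurable_fun unit_box (fun p => increment B p.1 1 p.2).
Proof.
apply: (measurable_process (X := fun s => increment B s 1)).
  by move=> s; rewrite in_itv/= => /andP[s0 s1]; exact: (measurable_increment HB).
have [_ _ cB _ _] := HB.
by move=> w x; apply: cvgB; [exact: cvg_cst|exact: cB].
Qed.

Lemma measurable_bpath t : t \in `[0, 1] -> measurable_fun setT (bpath B t).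
Proof.
rewrite in_itv/= => /andP[t0 t1]; exact: (measurable_increment HB (lexx 0) t0 t1).
Qed.

Lemma measurable_process_bpath : measurable_fun unit_box (fun p => bpath B p.1 p.2).
Proof.
apply: measurable_process; first exact: measurable_bpath.
exact: (bpath_continuous HB).
Qed.

Lemma measurable_process_cst (g : R -> R) : {within `[0, 1], continuous g} ->
  measurable_fun unit_box (fun p => g p.1).
Proof. by move=> cg; apply: (measurable_process (X := fun s _ => g s)). Qed.

(** The integrand looks into the future through B_1 - B_s, but after Fubini each time is treated
    alone: for almost every s the factor f_s is integrable and known at s, while the increment is
    independent and centred. *)
Lemma integral_anticipating (f : R -> T -> R) :
  measurable_fun unit_box (fun p => f p.1 p.2) ->
  (forall t, t \in `[0, 1] -> forall D, measurable D -> known Q B V t (f t @^-1` D)) ->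
  (dint (fun s w => (f s w ^+ 2)%:E) < +oo)%E ->
  Q.-integrable setT
    (fun w => (\int[mu]_(s in `[0, 1]) (f s w * increment B s 1 w))%:E) /\
  (\int[Q]_w (\int[mu]_(s in `[0, 1]) (f s w * increment B s 1 w))%:E = 0)%E.
Proof.
move=> mf kf f2.
have minc := measurable_process_increment.
have mfi : measurable_fun unit_box (fun p => f p.1 p.2 * increment B p.1 1 p.2).
  exact: measurable_funM.
have i2 : (dint (fun s w => (increment B s 1 w ^+ 2)%:E) < +oo)%E.
  have msq : measurable_fun unit_box (fun p => (increment B p.1 1 p.2 ^+ 2)%:E).
    by apply/measurable_EFinP; exact: measurable_funX.
  have sq0 s w : (0 <= (increment B s 1 w ^+ 2)%:E)%E by rewrite lee_fin sqr_ge0.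
  rewrite (tonelli_process Q (f := fun s w => (increment B s 1 w ^+ 2)%:E) msq sq0).
  have -> : (\int[mu]_(s in `[0%R, 1%R]) \int[Q]_w (increment B s 1 w ^+ 2)%:E =
      \int[mu]_(s in `[0%R, 1%R]) (1 - s)%:E)%E.
    apply: eq_integral => s; rewrite inE/= in_itv/= => /andP[s0 s1].
    exact: (increment_moment2 HB mV VB).
  apply: (@le_lt_trans _ _ (\int[mu]_(s in `[0%R, 1%R]) 1)%E).
    apply: ge0_le_integral => //=.
    - by move=> s; rewrite in_itv/= => /andP[_ s1]; rewrite lee_fin subr_ge0.
    - by apply/measurable_EFinP; exact: measurable_funB.
    - by move=> s; rewrite in_itv/= => /andP[s0 _]; rewrite lee_fin gerBl.
  by rewrite integral_cst//= lebesgue_measure_itv/= lte_fin ltr01 -EFinB subr0 mule1 ltry.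
have Foo := double_integral_mul_lty mf minc f2 i2.
have [_ aei intb ->] := fubini_process (P := Q) (f := fun s w => f s w * increment B s 1 w) mfi Foo.
split => //.
rewrite -[RHS](integral0 mu `[0%R, 1%R]).
rewrite [LHS]integral_mkcond [RHS]integral_mkcond.
have mf2 : measurable_fun unit_box (fun p => f p.1 p.2 ^+ 2) by exact: measurable_funX.
have f2' : (\int[mu]_(s in `[0%R, 1%R]) \int[Q]_w `|(f s w ^+ 2)%:E| < +oo)%E.
  have mabs : measurable_fun unit_box (fun p => `|(f p.1 p.2 ^+ 2)%:E|%E).
    by apply: measurableT_comp => //; exact/measurable_EFinP.
  rewrite -(tonelli_process Q (f := fun s w => `|(f s w ^+ 2)%:E|%E) mabs (fun _ _ => abse_ge0 _)).
  apply: le_lt_trans f2.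
  apply: (double_integral_le Q (f := fun s w => `|f s w ^+ 2|)) => //.
    exact: measurableT_comp.
  by move=> s w _; rewrite normr_ge0 /= ger0_norm ?lexx ?sqr_ge0.
have [_ aef _ _] := fubini_process (P := Q) (f := fun s w => f s w ^+ 2) mf2 f2'.
have [N [mN N0 NP]] := aef; apply: ae_integral_eq; exists N; split => //.
apply: subset_trans NP => s /= sF H; apply: sF.
rewrite !patchE; case: ifPn => //; rewrite inE/= => s01.
have := s01; rewrite in_itv/= => /andP[s0 s1].
have fs : measurable_fun setT (f s).
  by apply: (known_measurable_fun HB mV (t := s)); exact: kf.
have fsi : Q.-integrable setT (EFin \o f s).
  apply: integrable_sqr => //; first exact: fin_num_fun_lty.
  have /integrableP[_] := H s01; apply: le_lt_trans.
  by rewrite (eq_integral (fun x => `|(f s x ^+ 2)%:E|%E))// => w _; rewrite /= ger0_norm ?sqr_ge0.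
by have [_ ->] := integral_known_increment HB mV VB s0 s1 (kf s s01) fsi.
Qed.

End anticipating.

(** * Expected wealth of strategies that are regular in every scenario *)

Section expected_wealth.
Context (R : realType) d (T : measurableType d) (Q : probability T R).
Variables (B : R -> T -> R) (V : T -> R).
Hypotheses (HB : is_brownian Q B) (mV : measurable_fun setT V).
Hypothesis VB : forall A, <<s history B 1>> A -> forall D, measurable D ->
  Q (A `&` V @^-1` D) = (Q A * Q (V @^-1` D))%E.
Notation mu := (@lebesgue_measure R).
Notation unit_box := (`[(0 : R), 1]%classic `*` [set: T]).
Notation dint F := (\int[Q]_w \int[mu]_(s in `[0%R, 1%R]) F s w)%E.
Variables (lam c sg x0 : R) (lam0 : 0 < lam) (c0 : 0 < c) (sg0 : 0 < sg).
Notation known := (known Q B V).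
Notation q := (depth lam c).

Let m01 : measurable (`[0%R, 1%R]%classic : set (measurableTypeR R)).
Proof. exact: measurable_itv. Qed.

(** The value of the control problem for an initial mispricing [x0]; by [regular_expected_wealth]
    any strategy falls short of it by the expected squared gap. *)
Definition control_value := c * sg ^+ 2 / 2 * ln (c / (c + lam)) +
  x0 ^+ 2 / (2 * (c + lam)) + lam * sg ^+ 2 / 2.

Section regular.
Variables (al th : R -> T -> R).
Hypothesis mal : measurable_fun unit_box (fun p => al p.1 p.2).
Hypothesis kal : forall t, t \in `[0, 1] -> forall D, measurable D -> known t (al t @^-1` D).
Hypothesis kth : forall t, t \in `[0, 1] -> forall D, measurable D -> known t (th t @^-1` D).
Hypothesis pth : forall w, primitive_from 0 (al^~ w) (th^~ w).
Hypothesis al2w : forall w, (\int[mu]_(s in `[0%R, 1%R]) (al s w ^+ 2)%:E < +oo)%E.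
Hypothesis al2 : (dint (fun s w => (al s w ^+ 2)%:E) < +oo)%E.

Let b s w := lam * sg * bpath B s w.
Let xi s w := mispricing lam x0 (th^~ w) (b^~ w) s.
Let gap s w := al s w - xi s w / q s.
Let f s w := control_density lam c x0 (al^~ w) (th^~ w) s.

Let cb w : {within `[0, 1], continuous (b^~ w)}.
Proof. by move=> x; apply: cvgM; [exact: cvg_cst|exact: (bpath_continuous HB)]. Qed.

Let mth : measurable_fun unit_box (fun p => th p.1 p.2).
Proof.
apply: measurable_process => [s s01|w]; last exact: primitive_from_continuous (pth w).
exact: (known_measurable_fun HB mV (kth s01)).
Qed.

Let mb : measurable_fun unit_box (fun p => b p.1 p.2).
Proof. by apply: measurable_funM => //; exact: (measurable_process_bpath HB). Qed.

Let mA : measurable_fun unit_box (fun p : R * T => riccati lam c p.1).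
Proof. exact: (measurable_process_cst (continuous_riccati lam0 c0)). Qed.

Let mA' : measurable_fun unit_box (fun p : R * T => - c / q p.1 ^+ 2).
Proof.
exact: (measurable_process_cst (g := fun t => - c / q t ^+ 2) (continuous_drift_riccati lam0 c0)).
Qed.

Let mqV : measurable_fun unit_box (fun p : R * T => (q p.1)^-1).
Proof.
exact: (measurable_process_cst (g := fun t => (q t)^-1) (continuous_depthV lam0 c0)).
Qed.

Let mxi : measurable_fun unit_box (fun p => xi p.1 p.2).
Proof.
by apply: measurable_funB => //; apply: measurable_funB => //; exact: measurable_funM.
Qed.

Let mgap : measurable_fun unit_box (fun p => gap p.1 p.2).
Proof. by apply: measurable_funB => //; exact: measurable_funM. Qed.

Let mf : measurable_fun unit_box (fun p => f p.1 p.2).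
Proof.
apply: measurable_funB; apply: measurable_funM => //.
  by apply: measurable_funB => //; exact: measurable_funM.
exact: measurable_funM.
Qed.

(** Cauchy-Schwarz, from the nonnegative integral over [0, s] of (al - k)^2 with k = th s: it gives
    (2 - s) k^2 as a lower bound, and 2 - s >= 1. *)
Let th2 s w : s \in `[0, 1] -> th s w ^+ 2 <= \int[mu]_(s in `[0, 1]) (al s w ^+ 2).
Proof.
move=> s01; have [ai H] := pth w; rewrite (H s s01) add0r.
have ma : measurable_fun (`[0, 1]%classic : set R) (al^~ w).
  by have /integrableP[/measurable_EFinP] := ai.
have ai2 : mu.-integrable `[0, 1] (EFin \o (fun s => al s w ^+ 2)).
  apply: integrable_ge0 => //; first exact: measurable_funX.
  by move=> x; exact: sqr_ge0.
have sub f0 := @integrable_sub01 R f0 s s01.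
pose k := \int[mu]_(x in `[0, s]) al x w.
have ms : measurable (`[0, s]%classic : set (measurableTypeR R)) by exact: measurable_itv.
have ci (r : R) : mu.-integrable `[0, s] (EFin \o (fun=> r)).
  apply: sub; apply: integrable_continuous01 => x; exact: cvg_cst.
have : 0 <= \int[mu]_(x in `[0, s]) (al x w ^+ 2 - (2 * k * al x w - k ^+ 2)).
  apply: Rintegral_ge0 => // x _.
  have -> : al x w ^+ 2 - (2 * k * al x w - k ^+ 2) = (al x w - k) ^+ 2 by ring.
  exact: sqr_ge0.
have i1 := sub _ ai2; have i2 := integrable_EFinZ ms (2 * k) (sub _ ai).
rewrite (RintegralB ms i1 (integrable_EFinB ms i2 (ci _))) (RintegralB ms i2 (ci _)).
rewrite (RintegralZl _ ms (sub _ ai)) -/k.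
have -> : \int[mu]_(x in `[0, s]) (k ^+ 2) = k ^+ 2 * s.
  move: s01; rewrite in_itv/= => /andP[s0 s1].
  rewrite /Rintegral integral_cst//= lebesgue_measure_itv/= lte_fin.
  case: ltrP => [_|s0']; first by rewrite -EFinB subr0.
  by rewrite mule0/= (_ : s = 0) ?mulr0//; lra.
move=> H0.
have : \int[mu]_(x in `[0, s]) (al x w ^+ 2) <= \int[mu]_(x in `[0, 1]) (al x w ^+ 2).
  rewrite -lee_fin -!EFin_Rintegral//.
  apply: ge0_subset_integral => //.
  - by apply/measurable_EFinP; exact: measurable_funX.
  - by move=> x _; rewrite lee_fin sqr_ge0.
  - by move: s01; rewrite in_itv/= => /andP[_ s1]; apply: subset_itvl; rewrite bnd_simp.
move: s01; rewrite in_itv/= => /andP[s0 s1].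
have := sqr_ge0 k; nra.
Qed.

Let th2_lty : (dint (fun s w => (th s w ^+ 2)%:E) < +oo)%E.
Proof.
apply: le_lt_trans al2; apply: ge0_le_integral => //.
- by move=> w _; apply: integral_ge0 => s _; rewrite lee_fin sqr_ge0.
- apply: (measurable_integral_process (f := fun s w => (th s w ^+ 2)%:E)).
  by apply/measurable_EFinP; exact: measurable_funX.
- apply: (measurable_integral_process (f := fun s w => (al s w ^+ 2)%:E)).
  by apply/measurable_EFinP; exact: measurable_funX.
- move=> w _.
  have ai2 : mu.-integrable `[0, 1] (EFin \o (fun s => al s w ^+ 2)).
    apply: integrable_ge0 => //; last by move=> x; exact: sqr_ge0.
    by apply: measurable_funX; have [/integrableP[/measurable_EFinP]] := pth w.
  rewrite [leRHS]EFin_Rintegral//.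
  apply: (@le_trans _ _ (\int[mu]_(s in `[0%R, 1%R])
    (\int[mu]_(s in `[0, 1]) (al s w ^+ 2))%:E)%E).
    apply: ge0_le_integral => //.
    + by move=> s _; rewrite lee_fin sqr_ge0.
    + by apply/measurable_EFinP; apply: measurable_funX; exact: measurable_section mth.
    + by move=> s s01; rewrite lee_fin th2.
  by rewrite integral_cst//= lebesgue_measure_itv/= lte_fin ltr01 -EFinB subr0 mule1.
Qed.

Let bpath2 : dint (fun s w => (bpath B s w ^+ 2)%:E) =
  (\int[mu]_(s in `[0%R, 1%R]) s%:E)%E.
Proof.
have msq : measurable_fun unit_box (fun p => (bpath B p.1 p.2 ^+ 2)%:E).
  by apply/measurable_EFinP; apply: measurable_funX; exact: (measurable_process_bpath HB).
have sq0 s w : (0 <= (bpath B s w ^+ 2)%:E)%E by rewrite lee_fin sqr_ge0.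
rewrite (tonelli_process Q (f := fun s w => (bpath B s w ^+ 2)%:E) msq sq0).
apply: eq_integral => s; rewrite inE/= in_itv/= => /andP[s0 s1].
have := increment_moment2 HB mV VB (lexx 0) s0 s1.
by rewrite subr0.
Qed.

Let bpath2_lty : (dint (fun s w => (bpath B s w ^+ 2)%:E) < +oo)%E.
Proof.
rewrite bpath2.
have cid : continuous (fun s : R => s) by move=> y; exact: cvg_id.
have : mu.-integrable `[0, 1] (EFin \o (fun s => s)).
  by apply: integrable_continuous01; exact: (continuous_subspaceT cid).
by move=> H; rewrite EFin_Rintegral// ltry.
Qed.

(** A common majorant through which the square-integrability of both the gap and the control density
    is checked. *)
Let dominated (g : R -> T -> R) (K : R) : 0 <= K ->
  measurable_fun unit_box (fun p => g p.1 p.2) ->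
  (forall s w, s \in `[0, 1] ->
     0 <= g s w <= K * (1 + (th s w ^+ 2 + (al s w ^+ 2 + bpath B s w ^+ 2)))) ->
  (dint (fun s w => (g s w)%:E) < +oo)%E.
Proof.
move=> K0 mg gK.
have mb0 := measurable_process_bpath HB.
have m1 : measurable_fun unit_box (fun p => al p.1 p.2 ^+ 2 + bpath B p.1 p.2 ^+ 2).
  by apply: measurable_funD; exact: measurable_funX.
have m2 : measurable_fun unit_box (fun p => th p.1 p.2 ^+ 2 + (al p.1 p.2 ^+ 2 + bpath B p.1 p.2 ^+ 2)).
  by apply: measurable_funD => //; exact: measurable_funX.
have m3 : measurable_fun unit_box (fun p => 1 + (th p.1 p.2 ^+ 2 + (al p.1 p.2 ^+ 2 + bpath B p.1 p.2 ^+ 2))).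
  by apply: measurable_funD.
have p1 s w : 0 <= al s w ^+ 2 + bpath B s w ^+ 2 by rewrite addr_ge0 ?sqr_ge0.
have p2 s w : 0 <= th s w ^+ 2 + (al s w ^+ 2 + bpath B s w ^+ 2) by rewrite addr_ge0 ?sqr_ge0.
have p3 s w : 0 <= 1 + (th s w ^+ 2 + (al s w ^+ 2 + bpath B s w ^+ 2)) by rewrite addr_ge0.
apply: (@le_lt_trans _ _ (dint (fun s w =>
    (K * (1 + (th s w ^+ 2 + (al s w ^+ 2 + bpath B s w ^+ 2))))%:E))).
  by apply: double_integral_le => //; exact: measurable_funM.
rewrite (double_integralZ Q m3 p3 K0).
apply: lte_mul_pinfty; [by rewrite lee_fin|exact: fin_numE|].
have e1 := double_integralD Q (f := fun _ _ => 1) (measurable_cst _) m2 (fun _ _ => ler01) p2.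
have e2 := double_integralD Q (f := fun s w => th s w ^+ 2) (measurable_funX 2 mth) m1 (fun _ _ => sqr_ge0 _) p1.
have e3 := double_integralD Q (f := fun s w => al s w ^+ 2) (g := fun s w => bpath B s w ^+ 2)
  (measurable_funX 2 mal) (measurable_funX 2 mb0) (fun _ _ => sqr_ge0 _) (fun _ _ => sqr_ge0 _).
rewrite e1 e2 e3 double_integral_cst.
apply: lte_add_pinfty; first exact: ltry.
apply: lte_add_pinfty; first exact: th2_lty.
exact: lte_add_pinfty al2 bpath2_lty.
Qed.

Let q_inv s : s \in `[0, 1] -> 0 <= (q s)^-1 <= c^-1.
Proof.
rewrite in_itv/= => /andP[s0 s1].
have q0 := depth_gt0 lam0 c0 s1.
by rewrite invr_ge0 ltW//= lef_pV2 ?posrE// (depth_ge _ lam0).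
Qed.

Let A_bound s : s \in `[0, 1] -> 0 <= riccati lam c s <= c^-1.
Proof.
move=> s01; have /andP[q0 qc] := q_inv s01; move: s01; rewrite in_itv/= => /andP[s0 s1].
rewrite /riccati mulr_ge0 ?subr_ge0//=.
by apply: le_trans qc; rewrite ler_piMl// gerBl.
Qed.

Let A'_bound s : s \in `[0, 1] -> `|- c / q s ^+ 2| <= c^-1.
Proof.
move=> s01; have /andP[q0 qc] := q_inv s01.
rewrite mulNr normrN ger0_norm ?mulr_ge0 ?invr_ge0 ?sqr_ge0 ?(ltW c0)//.
have -> : c^-1 = c * (c^-1 * c^-1) by field; rewrite lt0r_neq0.
by rewrite ler_pM2l// expr2 invfM ler_pM.
Qed.

Let gap_lty : (dint (fun s w => (gap s w ^+ 2)%:E) < +oo)%E.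
Proof.
(* From (a - x / q)^2 <= 2 a^2 + 2 (x / q)^2, the bound 1 / q <= 1 / c, and a factor 3 for the
   square of the three summands of x. *)
pose K := 2 + 6 * c^-1 ^+ 2 * (x0 ^+ 2 + lam ^+ 2 + (lam * sg) ^+ 2).
apply: (dominated (K := K)).
- by rewrite /K; do ?[exact: sqr_ge0|exact: ler0n|apply: addr_ge0|apply: mulr_ge0].
- exact: measurable_funX.
- move=> s w s01; rewrite sqr_ge0/=.
  have /andP[q0 qc] := q_inv s01.
  rewrite /gap /xi /mispricing /b.
  move: (th s w) (al s w) (bpath B s w) => t a be.
  have h1 : (a - (x0 - lam * t - lam * sg * be) / q s) ^+ 2 <=
      2 * a ^+ 2 + 2 * ((x0 - lam * t - lam * sg * be) / q s) ^+ 2.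
    have := sqr_ge0 (a + (x0 - lam * t - lam * sg * be) / q s); nra.
  apply: le_trans h1 _; rewrite exprMn.
  have h2 : (q s)^-1 ^+ 2 <= c^-1 ^+ 2 by rewrite ler_sqr ?nnegrE// ?invr_ge0 ?ltW.
  have h3 : (x0 - lam * t - lam * sg * be) ^+ 2 <=
      3 * (x0 ^+ 2 + lam ^+ 2 * t ^+ 2 + (lam * sg) ^+ 2 * be ^+ 2).
    rewrite -!exprMn; move: (lam * t) (lam * sg * be) => u v.
    have := sqr_ge0 (x0 + u); have := sqr_ge0 (x0 + v); have := sqr_ge0 (u - v); nra.
  have h4 : (x0 - lam * t - lam * sg * be) ^+ 2 * (q s)^-1 ^+ 2 <=
      3 * (x0 ^+ 2 + lam ^+ 2 * t ^+ 2 + (lam * sg) ^+ 2 * be ^+ 2) * c^-1 ^+ 2.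
    by apply: ler_pM => //; rewrite sqr_ge0.
  apply: (@le_trans _ _ (2 * a ^+ 2 + 2 * (3 * (x0 ^+ 2 + lam ^+ 2 * t ^+ 2 + (lam * sg) ^+ 2 * be ^+ 2) * c^-1 ^+ 2))).
    by rewrite lerD2l ler_pM2l.
  rewrite /K; have := sqr_ge0 c^-1; have := sqr_ge0 x0; have := sqr_ge0 lam.
  have := sqr_ge0 (lam * sg); have := sqr_ge0 a; have := sqr_ge0 t; have := sqr_ge0 be.
  move: (c^-1 ^+ 2) (x0 ^+ 2) (lam ^+ 2) ((lam * sg) ^+ 2) (a ^+ 2) (t ^+ 2) (be ^+ 2).
  move=> k X l p a2 t2 b2 b0 t0 a0 p0 l0 X0 k0.
  rewrite -subr_ge0.
  have -> : (2 + 6 * k * (X + l + p)) * (1 + (t2 + (a2 + b2))) -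
     (2 * a2 + 2 * (3 * (X + l * t2 + p * b2) * k)) =
     2 + 2 * t2 + 2 * b2 + 6 * k * (l + p + X * t2 + X * a2 + X * b2 + l * a2 + l * b2
       + p * t2 + p * a2) by ring.
  by do ?[assumption|exact: ler0n|apply: addr_ge0|apply: mulr_ge0].
Qed.

Let f_lty : (dint (fun s w => (f s w ^+ 2)%:E) < +oo)%E.
Proof.
(* Both [riccati] and the modulus of its derivative are at most 1 / c on [0, 1]. *)
pose K := 4 * c^-1 ^+ 2 * (x0 ^+ 2 + lam ^+ 2).
apply: (dominated (K := K)).
- by rewrite /K; do ?[exact: sqr_ge0|exact: ler0n|apply: addr_ge0|apply: mulr_ge0].
- exact: measurable_funX.
- move=> s w s01; rewrite sqr_ge0/=.
  have /andP[A0 Ac] := A_bound s01; have A'c := A'_bound s01.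
  rewrite /f /control_density.
  move: (- c / q s ^+ 2) (riccati lam c s) (th s w) (al s w) (bpath B s w) A0 Ac A'c => u r t a be r0 rc uc.
  have h1 : (u * (x0 - lam * t) - r * (lam * a)) ^+ 2 <=
      4 * u ^+ 2 * (x0 ^+ 2 + (lam * t) ^+ 2) + 2 * r ^+ 2 * (lam * a) ^+ 2.
    rewrite -subr_ge0; move: (lam * t) (lam * a) => y z.
    have -> : 4 * u ^+ 2 * (x0 ^+ 2 + y ^+ 2) + 2 * r ^+ 2 * z ^+ 2 - (u * (x0 - y) - r * z) ^+ 2 =
       2 * (u * (x0 + y)) ^+ 2 + (u * (x0 - y) + r * z) ^+ 2 by ring.
    by do ?[exact: sqr_ge0|exact: ler0n|apply: addr_ge0|apply: mulr_ge0].
  have h2 : u ^+ 2 <= c^-1 ^+ 2.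
    by rewrite -(real_normK (num_real u)) ler_sqr ?nnegrE// invr_ge0 ltW.
  have h3 : r ^+ 2 <= c^-1 ^+ 2 by rewrite ler_sqr ?nnegrE// invr_ge0 ltW.
  apply: le_trans h1 _; rewrite /K !exprMn.
  have := sqr_ge0 x0; have := sqr_ge0 lam; have := sqr_ge0 u; have := sqr_ge0 r.
  have := sqr_ge0 a; have := sqr_ge0 t; have := sqr_ge0 be.
  move: (c^-1 ^+ 2) (x0 ^+ 2) (lam ^+ 2) (a ^+ 2) (t ^+ 2) (be ^+ 2) (u ^+ 2) (r ^+ 2) h2 h3.
  move=> k X l a2 t2 b2 u2 r2 h2 h3 b0 t0 a0 r20 u20 l0 X0.
  have k0 : 0 <= k by exact: le_trans h2.
  have g1 : u2 * (X + l * t2) <= k * (X + l * t2).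
    by rewrite ler_wpM2r// addr_ge0// mulr_ge0.
  have g2 : r2 * (l * a2) <= k * (l * a2) by rewrite ler_wpM2r// mulr_ge0.
  apply: (@le_trans _ _ (4 * (k * (X + l * t2)) + 2 * (k * (l * a2)))).
    by rewrite -!mulrA lerD// ler_pM2l.
  rewrite -subr_ge0.
  have -> : 4 * k * (X + l) * (1 + (t2 + (a2 + b2))) - (4 * (k * (X + l * t2)) + 2 * (k * (l * a2)))
    = 4 * (k * (l + X * t2 + X * a2 + X * b2 + l * b2)) + 2 * (k * (l * a2)) by ring.
  by do ?[assumption|exact: ler0n|apply: addr_ge0|apply: mulr_ge0].
Qed.

Let kf t : t \in `[0, 1] -> forall D, measurable D -> known t (f t @^-1` D).
Proof.
move=> t01 D mD; rewrite -(sigma_algebra_id (@known_sigma_algebra _ _ _ Q B V t)).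
apply: (g_sigma_measurable_fun _ mD).
have kk g : (forall D, measurable D -> known t (g @^-1` D)) ->
    measurable_fun [set: g_sigma_algebraType (known t)] (g : g_sigma_algebraType (known t) -> R).
  move=> kg; apply: measurable_fun_g_sigma => E mE.
  by rewrite (sigma_algebra_id (@known_sigma_algebra _ _ _ Q B V t)); exact: kg.
apply: measurable_funB; apply: measurable_funM => //.
  by apply: measurable_funB => //; apply: measurable_funM => //; exact: kk (kth t01).
by apply: measurable_funM => //; exact: kk (kal t01).
Qed.

(** Expectation of [pathwise_wealth]. The term in B_1 and the anticipating term have mean zero, the
    term in B^2 becomes [integral_riccati] through E B_s^2 = s, and only the gap still depends on
    the strategy. *)
Lemma regular_expected_wealth :
  (\int[Q]_w (\int[mu]_(s in `[0, 1]) (xi s w * al s w)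
    - c / 2 * \int[mu]_(s in `[0, 1]) (al s w ^+ 2))%:E =
  control_value%:E - (c / 2)%:E * dint (fun s w => (gap s w ^+ 2)%:E))%E.
Proof.
have PW w := pathwise_wealth lam0 c0 x0 (al2w w) (pth w) (cb (w := w)).
pose W0 := x0 ^+ 2 / (2 * (c + lam)).
pose G w := \int[mu]_(s in `[0, 1]) (gap s w ^+ 2).
pose N w := \int[mu]_(s in `[0, 1]) (f s w * increment B s 1 w).
pose S w := \int[mu]_(s in `[0, 1]) (c / q s ^+ 2 * bpath B s w ^+ 2).
have cS w : {within `[0, 1], continuous (fun s => c / q s ^+ 2 * bpath B s w ^+ 2)}.
  move=> x; apply: cvgM; last by apply: cvgM; exact: (bpath_continuous HB).
  by apply: cvgM; [exact: cvg_cst|exact: continuous_depthV2].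
have iSw w := integrable_continuous01 (cS w).
have WE w : \int[mu]_(s in `[0, 1]) (xi s w * al s w) - c / 2 * \int[mu]_(s in `[0, 1]) (al s w ^+ 2) =
   W0 + - (lam * sg * x0 / (c + lam)) * increment B 0 1 w + - (lam * sg) * N w
   + (lam * sg) ^+ 2 / 2 * S w - c / 2 * G w.
  have [_ ifb _ ->] := PW w; have ls0 : lam * sg != 0 by rewrite lt0r_neq0// mulr_gt0.
  have -> : \int[mu]_(s in `[0, 1]) (control_density lam c x0 (al^~ w) (th^~ w) s * (b 1 w - b s w)) =
      lam * sg * N w.
    rewrite /N -RintegralZl//.
      by apply: eq_Rintegral => s _; rewrite /f /b -bpathB; ring.
    have := integrable_EFinZ m01 (lam * sg)^-1 ifb; apply: eq_integrable => // s _ /=.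
    by rewrite /f /b -bpathB; congr (_%:E); field; rewrite !lt0r_neq0.
  have -> : \int[mu]_(s in `[0, 1]) (- c / q s ^+ 2 * b s w ^+ 2) = - (lam * sg) ^+ 2 * S w.
    rewrite /S -RintegralZl//.
    by apply: eq_Rintegral => s _; rewrite /b; ring.
  rewrite /W0 -(bpathB B 0 1) bpath0 subr0 {1}/b.
  move: (N w) (S w) (bpath B 1 w) => n s be; rewrite -[X in _ - c / 2 * X]/(G w); move: (G w) => g.
  by rewrite invfM; move: (c + lam)^-1 => k; field.
under eq_integral do rewrite WE.
have igap w : mu.-integrable `[0, 1] (EFin \o (fun s => gap s w ^+ 2)) by have [_ _] := PW w.
have [iG EG] := integrable_double_integral (Q := Q) (f := fun s w => gap s w ^+ 2)
  (measurable_funX 2 mgap) (fun _ _ _ => sqr_ge0 _) igap gap_lty.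
have [iN EN] := integral_anticipating HB mV VB mf kf f_lty.
have mSp : measurable_fun unit_box (fun p => c / q p.1 ^+ 2 * bpath B p.1 p.2 ^+ 2).
  apply: measurable_funM; last by apply: measurable_funX; exact: (measurable_process_bpath HB).
  have cg : {within `[0, 1], continuous (fun s => c / q s ^+ 2)}.
    by move=> x; apply: cvgM; [exact: cvg_cst|exact: continuous_depthV2].
  exact: (measurable_process_cst (g := fun t => c / q t ^+ 2) cg).
have Sp0 s w : s \in `[0, 1] -> 0 <= c / q s ^+ 2 * bpath B s w ^+ 2.
  by move=> _; rewrite mulr_ge0 ?sqr_ge0// divr_ge0 ?sqr_ge0// ltW.
have ES : (dint (fun s w => (c / q s ^+ 2 * bpath B s w ^+ 2)%:E) =
    (lam^-1 + c / lam ^+ 2 * ln (c / (c + lam)))%:E)%E.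
  have m2 : measurable_fun unit_box (fun p => (c / q p.1 ^+ 2 * bpath B p.1 p.2 ^+ 2)%:E).
    exact/measurable_EFinP.
  have p2 s w : (0 <= (c / q s ^+ 2 * bpath B s w ^+ 2)%:E)%E.
    by rewrite lee_fin mulr_ge0 ?sqr_ge0// divr_ge0 ?sqr_ge0// ltW.
  rewrite (tonelli_process Q (f := fun s w => (c / q s ^+ 2 * bpath B s w ^+ 2)%:E) m2 p2).
  transitivity (\int[mu]_(s in `[0%R, 1%R]) (c / q s ^+ 2 * s)%:E)%E.
    apply: eq_integral => s; rewrite inE/= in_itv/= => /andP[s0 s1].
    under eq_integral do rewrite EFinM.
    have := increment_moment2 HB mV VB (lexx 0) s0 s1; rewrite subr0 => E2.
    rewrite ge0_integralZl//; last 3 first.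
    - apply/measurable_EFinP; apply: measurable_funX; apply: measurable_bpath HB _ _.
      by rewrite in_itv/= s0.
    - by move=> w _; rewrite lee_fin sqr_ge0.
    - by rewrite lee_fin divr_ge0 ?sqr_ge0// ltW.
    by rewrite [X in (_ * X)%E]E2.
  have icont : mu.-integrable `[0, 1] (EFin \o (fun s => c / q s ^+ 2 * s)).
    apply: integrable_continuous01 => x; apply: cvgM; last first.
      have cid : continuous (fun s : R => s) by move=> y; exact: cvg_id.
      exact: (continuous_subspaceT cid).
    by apply: cvgM; [exact: cvg_cst|exact: continuous_depthV2].
  rewrite EFin_Rintegral//; congr (_%:E).
  rewrite -[RHS]opprK -integral_riccati// -[RHS]mulN1r -RintegralZl//.
    by apply: eq_Rintegral => s _; rewrite mulN1r !mulNr opprK.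
  have := integrable_EFinZ m01 (-1) icont; apply: eq_integrable => // s _ /=.
  by rewrite mulN1r !mulNr.
have Slty : (dint (fun s w => (c / q s ^+ 2 * bpath B s w ^+ 2)%:E) < +oo)%E.
  by rewrite ES ltry.
have [iS EiS] := integrable_double_integral (Q := Q) mSp Sp0 iSw Slty.
(* The increment over [0, 1] is centred: the case of the constant factor 1, known at time 0. *)
have kT : forall D, measurable D -> known 0 (cst (1 : R) @^-1` D).
  move=> D mD; rewrite -(sigma_algebra_id (@known_sigma_algebra _ _ _ Q B V 0)).
  exact: (g_sigma_measurable_fun (measurable_cst _) mD).
have ic1 : Q.-integrable setT (EFin \o cst (1 : R)).
  by apply: finite_measure_integrable_cst.
have [iI EI] := integral_known_increment HB mV VB (lexx 0) ler01 kT ic1.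
have {}iI : Q.-integrable setT (EFin \o increment B 0 1).
  by apply: eq_integrable iI => // w _; rewrite /= mul1r.
have {}EI : (\int[Q]_w (increment B 0 1 w)%:E = 0)%E.
  by rewrite -[RHS]EI; apply: eq_integral => w _; rewrite /= mul1r.
have i0 : Q.-integrable setT (EFin \o cst W0) by apply: finite_measure_integrable_cst.
have j1 := integrable_EFinZ measurableT (- (lam * sg * x0 / (c + lam))) iI.
have j2 := integrable_EFinZ measurableT (- (lam * sg)) iN.
have j3 := integrable_EFinZ measurableT ((lam * sg) ^+ 2 / 2) iS.
have j4 := integrable_EFinZ measurableT (c / 2) iG.
have k1 := integrable_EFinD measurableT i0 j1.
have k2 := integrable_EFinD measurableT k1 j2.
have k3 := integrable_EFinD measurableT k2 j3.
rewrite (integral_EFinB measurableT k3 j4) (integral_EFinD measurableT k2 j3).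
rewrite (integral_EFinD measurableT k1 j2) (integral_EFinD measurableT i0 j1).
rewrite (integral_EFinZ measurableT _ iI) (integral_EFinZ measurableT _ iN).
rewrite (integral_EFinZ measurableT _ iS) (integral_EFinZ measurableT _ iG).
rewrite EI EN EiS ES EG !mule0 !adde0; congr (_ - _)%E.
have -> : (\int[Q]_w (cst W0 w)%:E = W0%:E)%E.
  transitivity (W0%:E * 1)%E; last exact: mule1.
  by rewrite -(probability_setT Q); exact: (integral_cst Q measurableT W0%:E).
rewrite -EFinM -EFinD; congr (_%:E); rewrite /W0 /control_value.
by field; rewrite !lt0r_neq0// addr_gt0.
Qed.

End regular.

End expected_wealth.

Section almost_everywhere.
Context d (T : measurableType d) (R : realType) (m : {measure set T -> \bar R}).

Lemma ae_imp (P1 P2 : T -> Prop) : {ae m, forall x, P1 x} ->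
  (forall x, P1 x -> P2 x) -> {ae m, forall x, P2 x}.
Proof. by move=> h P12; apply: filterS h. Qed.

Lemma ae_imp2 (P1 P2 P3 : T -> Prop) : {ae m, forall x, P1 x} ->
  {ae m, forall x, P2 x} -> (forall x, P1 x -> P2 x -> P3 x) ->
  {ae m, forall x, P3 x}.
Proof. by move=> h1 h2 P123; apply: filterS2 h1 h2. Qed.

End almost_everywhere.

(** * Reduction of almost sure hypotheses to the regular case *)

Section expected_wealth_ae.
Context (R : realType) d (T : measurableType d) (Q : probability T R).
Variables (B : R -> T -> R) (V : T -> R).
Hypotheses (HB : is_brownian Q B) (mV : measurable_fun setT V).
Hypothesis VB : forall A, <<s history B 1>> A -> forall D, measurable D ->
  Q (A `&` V @^-1` D) = (Q A * Q (V @^-1` D))%E.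
Notation mu := (@lebesgue_measure R).
Notation unit_box := (`[(0 : R), 1]%classic `*` [set: T]).
Notation dint F := (\int[Q]_w \int[mu]_(s in `[0%R, 1%R]) F s w)%E.
Variables (lam c sg x0 : R) (lam0 : 0 < lam) (c0 : 0 < c) (sg0 : 0 < sg).
Notation known := (known Q B V).
Notation q := (depth lam c).
Variables (al th : R -> T -> R).
Hypothesis mal : measurable_fun unit_box (fun p => al p.1 p.2).
Hypothesis kal : forall t, t \in `[0, 1] -> forall D, measurable D -> known t (al t @^-1` D).
Hypothesis kth : forall t, t \in `[0, 1] -> forall D, measurable D -> known t (th t @^-1` D).
Hypothesis pth : {ae Q, forall w, path_primitive (al^~ w) (th^~ w)}.
Hypothesis al2 : (dint (fun s w => (al s w ^+ 2)%:E) < +oo)%E.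

Let xi s w := mispricing lam x0 (th^~ w) (fun s => lam * sg * bpath B s w) s.

Let m01 : measurable (`[0%R, 1%R]%classic : set (measurableTypeR R)).
Proof. exact: measurable_itv. Qed.

Let I2 w := (\int[mu]_(s in `[0%R, 1%R]) (al s w ^+ 2)%:E)%E.

Let mI2 : measurable_fun setT I2.
Proof.
apply: (measurable_integral_process (f := fun s w => (al s w ^+ 2)%:E)).
by apply/measurable_EFinP; exact: measurable_funX.
Qed.

Let I2_ge0 w : (0 <= I2 w)%E.
Proof. by apply: integral_ge0 => s _; rewrite lee_fin sqr_ge0. Qed.

Let G := [set w | (I2 w < +oo)%E].

Let mG : measurable G.
Proof. by rewrite -[G]setTI; exact: emeasurable_fun_infty_o. Qed.

Let QG : Q (~` G) = 0%E.
Proof.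
have iI2 : Q.-integrable setT I2.
  apply/integrableP; split => //.
  by rewrite (eq_integral I2)// => w _; rewrite gee0_abs.
have [N [mN N0 NP]] := integrable_ae measurableT iI2.
apply/eqP; rewrite eq_le measure_ge0 andbT -N0 le_measure ?inE//; first exact: measurableC.
apply: subset_trans NP => w /= Gw H; apply: Gw; have := H I.
by rewrite ge0_fin_numE.
Qed.

(** The rate is switched off where its square is not integrable, and the position is recomputed from
    it, so that the regular case applies in every scenario. The event [G] depends on the whole path
    up to time 1, but its complement is null, so the modified rate remains known at each time. *)
Let al' s w := al s w * \1_G w.
Let th' s w := \int[mu]_(x in `[0, s]) al' x w.

Let al'G s w : G w -> al' s w = al s w.
Proof. by move=> Gw; rewrite /al' indicE mem_set// mulr1. Qed.

Let al'NG s w : ~ G w -> al' s w = 0.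
Proof. by move=> Gw; rewrite /al' indicE memNset// mulr0. Qed.

Let mal' : measurable_fun unit_box (fun p => al' p.1 p.2).
Proof.
apply: measurable_funM => //; apply: measurable_funTS.
apply: (measurableT_comp (f := (\1_G : T -> R))) => //.
Qed.

Let al2w w : (\int[mu]_(s in `[0%R, 1%R]) (al' s w ^+ 2)%:E < +oo)%E.
Proof.
have [Gw|Gw] := pselect (G w).
  by under eq_integral do rewrite al'G//; exact: Gw.
under eq_integral do rewrite al'NG// expr0n/=.
by rewrite integral0 ltry.
Qed.

Let pth' w : primitive_from 0 (al'^~ w) (th'^~ w).
Proof.
split; last by move=> t _; rewrite add0r.
apply: integrable_sqr => //.
- by rewrite /= lebesgue_measure_itv/= lte_fin ltr01 -EFinB ltry.
- exact: measurable_section mal'.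
Qed.

Let ae_G : {ae Q, forall w, G w}.
Proof. by exists (~` G); split => //; exact: measurableC. Qed.

Let ae_th : {ae Q, forall w, G w /\ (forall s, s \in `[0, 1] -> th s w = th' s w)}.
Proof.
apply: (ae_imp2 ae_G pth) => w Gw [_ H]; split => // s s01; rewrite (H s s01).
by apply: eq_Rintegral => x _; rewrite al'G.
Qed.

Let known_ae t (X X' : T -> R) : measurable_fun setT X' ->
  {ae Q, forall w, X w = X' w} ->
  (forall D, measurable D -> known t (X @^-1` D)) ->
  forall D, measurable D -> known t (X' @^-1` D).
Proof.
move=> mX' [N [mN N0 NP]] kX D mD.
apply: (known_eq_mod_null HB mV (kX D mD)); first exact: measurable_preimage.
exists N; split => //; apply/seteqP; split => w /= [Dw Nw]; split => //;
  by move: Dw; (have -> : X w = X' w by apply: contrapT => ?; apply/Nw/NP).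
Qed.

Let kal' t : t \in `[0, 1] -> forall D, measurable D -> known t (al' t @^-1` D).
Proof.
move=> t01; apply: (known_ae (X := al t)); last exact: kal.
  by apply: measurable_funM => //; exact: (known_measurable_fun HB mV (kal t01)).
by apply: (ae_imp ae_G) => w Gw; rewrite al'G.
Qed.

Let kth' t : t \in `[0, 1] -> forall D, measurable D -> known t (th' t @^-1` D).
Proof.
move=> t01; apply: (known_ae (X := th t)); last exact: kth.
  apply: measurable_Rintegral_process; apply: measurable_funS mal'.
    by apply: measurableX => //; exact: measurable_itv.
  move=> [s w] [/= + _]; move: t01; rewrite !in_itv/= => /andP[_ t1] /andP[-> st].
  by split => //; exact: le_trans t1.
by apply: (ae_imp ae_th) => w [_]; exact.
Qed.

Lemma expected_wealth_ae (W : T -> R) :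
  {ae Q, forall w, W w = \int[mu]_(s in `[0, 1]) (xi s w * al s w)
    - c / 2 * \int[mu]_(s in `[0, 1]) (al s w ^+ 2)} ->
  (\int[Q]_w (W w)%:E = (control_value lam c sg x0)%:E -
     (c / 2)%:E * dint (fun s w => ((al s w - xi s w / q s) ^+ 2)%:E))%E.
Proof.
move=> HW.
have al2' : (dint (fun s w => (al' s w ^+ 2)%:E) < +oo)%E.
  rewrite (ae_integral_eq (g := I2))//.
  by apply: (ae_imp ae_G) => w Gw; apply: eq_integral => s _; rewrite al'G.
have key := regular_expected_wealth HB mV VB x0 lam0 c0 sg0 mal' kal' kth' pth' al2w al2'.
have xiE w : (forall s, s \in `[0, 1] -> th s w = th' s w) -> forall s, s \in `[0, 1] ->
    mispricing lam x0 (th'^~ w) (fun s => lam * sg * bpath B s w) s = xi s w.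
  by move=> thw s s01; rewrite /xi /mispricing thw.
rewrite (ae_integral_eq (g := fun w => (\int[mu]_(s in `[0, 1])
   (mispricing lam x0 (th'^~ w) (fun s => lam * sg * bpath B s w) s * al' s w)
    - c / 2 * \int[mu]_(s in `[0, 1]) (al' s w ^+ 2))%:E)); last first.
  apply: (ae_imp2 ae_th HW) => w [Gw thw] ->; congr (_%:E); congr (_ - _ * _).
    by apply: eq_Rintegral => s; rewrite inE => s01; rewrite xiE// al'G.
  by apply: eq_Rintegral => s _; rewrite al'G.
rewrite key; congr (_ - _ * _)%E; apply: ae_integral_eq.
apply: (ae_imp ae_th) => w [Gw thw]; apply: eq_integral => s; rewrite inE => s01.
by rewrite xiE// al'G.
Qed.

End expected_wealth_ae.

(** * The explicit solution *)

Section parameters.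
Context (R : realType).
Implicit Types (kappa gamma sigma : R).

Lemma Lambda_eq kappa : Lambda kappa ^+ 2 + kappa * Lambda kappa = 1.
Proof.
rewrite /Lambda; have h : 0 <= kappa ^+ 2 + 4 by rewrite addr_ge0 ?sqr_ge0.
have := sqr_sqrtr h; move: (Num.sqrt _) => r rE.
have -> : ((r - kappa) / 2) ^+ 2 + kappa * ((r - kappa) / 2) = (r ^+ 2 - kappa ^+ 2) / 4 by field.
by rewrite rE; field.
Qed.

Lemma Lambda_gt0 kappa : 0 < Lambda kappa.
Proof.
rewrite /Lambda divr_gt0// subr_gt0.
have [k0|k0] := ltP kappa 0; first by rewrite (lt_le_trans k0)// sqrtr_ge0.
rewrite -[ltLHS]ger0_norm// -sqrtr_sqr ltr_sqrt; first by rewrite ltrDl.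
by rewrite ltr_wpDl// sqr_ge0.
Qed.

Lemma Lambda_lt1 kappa : 0 < kappa -> Lambda kappa < 1.
Proof.
move=> k0; have := Lambda_eq kappa; have := Lambda_gt0 kappa.
move: (Lambda kappa) => L L0 LE; rewrite ltNge; apply/negP => L1; nra.
Qed.

Lemma lambda_starE kappa gamma sigma : 0 < gamma -> 0 < sigma ->
  lambda_star (kappa * (gamma / sigma)) gamma sigma = Lambda kappa * (gamma / sigma).
Proof.
move=> g0 s0; rewrite /lambda_star /Lambda.
have -> : (kappa * (gamma / sigma)) ^+ 2 + 4 * gamma ^+ 2 / sigma ^+ 2 =
    (gamma / sigma) ^+ 2 * (kappa ^+ 2 + 4) by field; rewrite lt0r_neq0.
rewrite sqrtrM ?sqr_ge0// sqrtr_sqr ger0_norm ?divr_ge0 ?ltW//.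
by field; rewrite lt0r_neq0.
Qed.

(** The meeting point of control and filtering: kappa = (1 - L^2) / L turns the affine function c +
    lambda (1 - t) into a multiple of the conditional variance. *)
Lemma depth_resid kappa gamma sigma t : 0 < sigma ->
  depth (Lambda kappa * (gamma / sigma)) (kappa * (gamma / sigma)) t =
  gamma / (sigma * Lambda kappa) * resid (Lambda kappa) t.
Proof.
move=> s0; rewrite /depth /resid; have := Lambda_eq kappa; have := Lambda_gt0 kappa.
move: (Lambda kappa) => L L0 LE.
have -> : kappa = (1 - L ^+ 2) / L.
  by rewrite -LE addrAC subrr add0r mulfK// lt0r_neq0.
by field; rewrite !lt0r_neq0.
Qed.

(** In this form the equilibrium drift is mispricing divided by [depth], the feedback for which the
    gap in the insider's problem vanishes. *)
Lemma drift_starE kappa gamma sigma (mu t v y : R) : 0 < gamma -> 0 < sigma -> t <= 1 ->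
  0 < kappa ->
  drift_star kappa gamma sigma mu t v y =
  (v - mu - Lambda kappa * (gamma / sigma) * y) /
  depth (Lambda kappa * (gamma / sigma)) (kappa * (gamma / sigma)) t.
Proof.
move=> g0 s0 t1 k0; rewrite depth_resid// /drift_star -/(resid _ t).
have := resid_neq0 (Lambda_gt0 kappa) (Lambda_lt1 k0) t1.
have := Lambda_gt0 kappa; move: (Lambda kappa) => L L0 a0.
by field; rewrite a0 !lt0r_neq0.
Qed.

End parameters.

Section model.
Context (R : realType) (d : measure_display) (Omega : measurableType d).
Variables (M : kyle_model R Omega) (sigma mu gamma kappa : R).
Hypotheses (sigma_gt0 : 0 < sigma) (gamma_gt0 : 0 < gamma) (kappa_gt0 : 0 < kappa).
Notation leb := (@lebesgue_measure R).
Notation B := (noise M).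
Notation V := (value M).
Notation L := (Lambda kappa).
Notation a := (resid L).

Let L0 : 0 < L := Lambda_gt0 kappa.
Let L1 : L < 1 := Lambda_lt1 kappa_gt0.

Lemma measurable_value : measurable_fun setT V.
Proof.
move=> _ D mD; rewrite setTI (kyle_sigma_algebra M); apply: sub_sigma_algebra; right.
by exists D => //; rewrite setTI.
Qed.

(** The value is almost surely [v], so any event it determines is, modulo a null set, everything or
    empty. *)
Lemma kyle_cond_independence v A : <<s history B 1>> A -> forall D, measurable D ->
  cond_law M v (A `&` V @^-1` D) = (cond_law M v A * cond_law M v (V @^-1` D))%E.
Proof.
move=> hA D mD.
have mA : measurable A.
  by apply: g_sigma_sub_measurable hA; exact: (history_measurable (kyle_cond_brownian M v)).
have mVD : measurable (V @^-1` D) by apply: measurable_preimage => //; exact: measurable_value.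
have [N [mN N0 NP]] := kyle_cond_value M v.
have [Dv|Dv] := pselect (D v).
  have e : eq_mod_null (cond_law M v) (V @^-1` D) setT.
    exists N; split => //; apply/seteqP; split => w /= [// _ Nw]; split => //.
    by have -> : V w = v by apply: contrapT => ?; apply/Nw/NP.
  have eA := eq_mod_null_measure mVD measurableT mA e.
  have e1 := eq_mod_null_measure mVD measurableT measurableT e.
  by rewrite setIC eA setTI -[X in (_ * _ X)%E]setIT e1 setIT probability_setT mule1.
have e : eq_mod_null (cond_law M v) (V @^-1` D) set0.
  exists N; split => //; apply/seteqP; split => w /= [] // Dw Nw; exfalso; apply: Dv.
  by have <- : V w = v by apply: contrapT => ?; apply/Nw/NP.
have eA := eq_mod_null_measure mVD measurable0 mA e.
have e1 := eq_mod_null_measure mVD measurable0 measurableT e.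
by rewrite setIC eA set0I -[X in (_ * _ X)%E]setIT e1 set0I measure0 mule0.
Qed.

Lemma insider_known_cond v t : insider_filtration M t `<=` known (cond_law M v) B V t.
Proof.
move=> A iA s hs; apply: sub_sigma (iA s hs) => C [hC|[mC C0]]; first by left.
by right.
Qed.

Lemma joint_law0 E : measurable E -> (forall v, cond_law M v E = 0%E) ->
  joint_law M E = 0%E.
Proof.
move=> mE E0; rewrite kyle_disintegration//.
by under eq_integral do rewrite E0; rewrite integral0.
Qed.

Lemma insider_known_joint t : insider_filtration M t `<=` known (joint_law M) B V t.
Proof.
move=> A iA s hs; apply: sub_sigma (iA s hs) => C [hC|[mC C0]]; first by left.
by right; split => //; exact: joint_law0.
Qed.

Lemma insider_measurable t A : insider_filtration M t A -> measurable A.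
Proof.
move=> iA; apply: (known_measurable (kyle_brownian M) measurable_value (t := t)).
exact: insider_known_joint.
Qed.

Lemma full_history_insider t : t <= 1 ->
  <<s full_history B V t>> `<=` insider_filtration M t.
Proof.
move=> t1 A hA s hs; apply: (@sub_sigma _ (full_history B V s)); first by move=> C; left.
have ts : t <= s by case: hs => [/andP[/ltW]|->].
exact: full_history_le hA.
Qed.

Notation Z := (zscore V mu gamma).
Notation sig := (signal B V L mu gamma).
Notation inn := (innov B V L mu gamma).

Definition explicit_rate (t : R) w := L * sigma * (inn t w / a t).
(** Subtracting [bpath] rather than the noise makes the position start at 0 in every scenario, as
    [explicit_primitive] requires. *)
Definition explicit_position (t : R) w := sigma * sig t w - sigma * bpath B t w.

(** In sigma a W - sigma B the Brownian path cancels and leaves - L^2 sigma a J, a product of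
    absolutely continuous paths; the remaining part of the position is linear in time. *)
Lemma explicit_primitive w :
  primitive_from 0 (explicit_rate^~ w) (explicit_position^~ w).
Proof.
have cb := @bpath_continuous _ _ _ _ _ (kyle_brownian M) w.
have cr := continuous_path_residV2 L0 L1 cb.
pose J t := \int[leb]_(s in `[0, t]) (bpath B s w / a s ^+ 2).
have pJ : primitive_from 0 (fun s => bpath B s w / a s ^+ 2) J.
  by split; [exact: integrable_continuous01|move=> t _; rewrite add0r].
have pa : primitive_from 1 (fun _ => - L ^+ 2) a.
  rewrite -(resid0 L); apply: primitive_from_is_derive; last by move=> x; exact: cvg_cst.
  by move=> t _; exact: is_derive_resid.
have pt : primitive_from 0 (fun _ => 1) (fun t : R => t).
  apply: (primitive_from_is_derive (F := fun t : R => t)); last by move=> x; exact: cvg_cst.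
  by move=> t _; exact: is_derive_id.
have := primitive_fromD (primitive_fromZ (L * sigma * Z w) pt)
  (primitive_fromZ (- (L ^+ 2 * sigma)) (primitive_fromM pa pJ)).
rewrite !mulr0 addr0 => H; apply: (eq_primitive_from H) => t; rewrite in_itv/= => /andP[t0 t1].
  have an0 := resid_neq0 L0 L1 t1.
  rewrite /explicit_rate innovE /wiener /wiener_path -/(J t) /=.
  by field.
have an0 := resid_neq0 L0 L1 t1.
rewrite /explicit_position /signal /wiener /wiener_path -/(J t) /=.
by field.
Qed.

Lemma explicit_drift s w y : s \in `[0, 1] -> y = sigma * sig s w ->
  drift_star kappa gamma sigma mu s (V w) y = explicit_rate s w.
Proof.
rewrite in_itv/= => /andP[_ s1] ->; rewrite /drift_star -/(resid _ s) /explicit_rate.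
rewrite /innov /zscore; congr (_ * (_ / _)); congr (_ - _).
by field; rewrite lt0r_neq0.
Qed.

Lemma demand_explicit w t : B 0 w = 0 ->
  demand M sigma explicit_position t w = sigma * sig t w.
Proof. by move=> B0; rewrite /demand /explicit_position /bpath B0 subr0 subrK. Qed.

Lemma measurable_fun_insider t (X : Omega -> R) : t <= 1 ->
  measurable_fun [set: g_sigma_algebraType (full_history B V t)]
    (X : g_sigma_algebraType (full_history B V t) -> R) ->
  forall D, measurable D -> insider_filtration M t (X @^-1` D).
Proof.
by move=> t1 mX D mD; apply: full_history_insider => //; exact: g_sigma_measurable_fun.
Qed.

Lemma explicit_position_adapted : adapted (insider_filtration M) explicit_position.
Proof.
move=> t; rewrite in_itv/= => /andP[t0 t1]; apply: measurable_fun_insider => //.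
apply: measurable_funB; apply: measurable_funM => //.
  exact: (signal_history (kyle_brownian M)).
exact: bpath_history.
Qed.

Lemma explicit_rate_adapted : adapted (insider_filtration M) explicit_rate.
Proof.
move=> t; rewrite in_itv/= => /andP[t0 t1]; apply: measurable_fun_insider => //.
apply: measurable_funM => //; apply: measurable_funM => //.
exact: (innov_history (kyle_brownian M)).
Qed.

Lemma explicit_solves : solves_theta_star M kappa gamma sigma mu explicit_position.
Proof.
split; first exact: explicit_position_adapted.
move=> v; have [_ B0 _ _ _] := kyle_cond_brownian M v.
apply: (ae_imp B0) => w B0w; apply/path_primitiveE.
apply: (eq_primitive_from (explicit_primitive w)) => // s s01.
by rewrite (explicit_drift (s := s))// demand_explicit.
Qed.

Section solution.
Variable theta : R -> Omega -> R.
Hypothesis theta_solves : solves_theta_star M kappa gamma sigma mu theta.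
Notation Y := (demand M sigma theta).

(** The difference D of two solutions satisfies D' = - L^2 D / a, and 1 / a is an integrating
    factor: the product rule gives D / a zero density and initial value 0. *)
Lemma solution_unique v : {ae cond_law M v, forall w,
  [/\ V w = v, B 0 w = 0 & forall t, t \in `[0, 1] -> theta t w = explicit_position t w]}.
Proof.
have [_ B0 _ _ _] := kyle_cond_brownian M v.
apply: (ae_imp2 (ae_imp2 (kyle_cond_value M v) B0 (fun w h1 h2 => conj h1 h2))
  (theta_solves.2 v)) => w [Vw B0w] /path_primitiveE pth.
split => // t t01.
have := primitive_fromD pth (primitive_fromZ (-1) (explicit_primitive w)).
rewrite mulr0 addr0 => pD.
have pa : primitive_from (a 0)^-1 (fun t => L ^+ 2 / a t ^+ 2) (fun t => (a t)^-1).
  apply: (primitive_from_is_derive (F := fun t => (a t)^-1)).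
    by move=> u; rewrite in_itv/= => /andP[_ u1]; exact: is_derive_residV.
  move=> x; apply: cvgM; first exact: cvg_cst.
  by apply: continuous_residV2 => // u /=; rewrite in_itv/= => /andP[].
have := primitive_fromM pD pa; rewrite mul0r => -[_ /(_ t t01)].
have int0 (f : R -> R) : (forall s, s \in `[0, t] -> f s = 0) -> \int[leb]_(s in `[0, t]) f s = 0.
  move=> f0; rewrite /Rintegral (eq_integral (cst 0%E)) ?integral0// => s.
  by rewrite inE => st; rewrite f0.
rewrite int0; last first.
  move=> s; rewrite in_itv/= => /andP[s0 st].
  have s1 : s <= 1 by move: t01; rewrite in_itv/= => /andP[_]; exact: le_trans.
  have an0 := resid_neq0 L0 L1 s1.
  rewrite /= /explicit_rate /drift_star -/(resid _ s) /innov /demand /explicit_position /zscore.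
  rewrite /bpath B0w subr0.
  by field; rewrite an0 !lt0r_neq0.
rewrite addr0 => /eqP.
have an0 : a t != 0 by move: t01; rewrite in_itv/= => /andP[_ t1]; exact: resid_neq0.
by rewrite mulf_eq0 invr_eq0 (negPf an0) orbF /= mulN1r subr_eq0 => /eqP.
Qed.

Lemma measurable_solution t : t \in `[0, 1] -> measurable_fun setT (theta t).
Proof.
move=> t01 _ D mD; rewrite setTI; apply: (insider_measurable (t := t)).
exact: theta_solves.1.
Qed.

Lemma measurable_demand t : t \in `[0, 1] -> measurable_fun setT (Y t).
Proof.
move=> t01; apply: measurable_funD; first exact: measurable_solution.
by apply: measurable_funM => //; exact: (measurable_B (kyle_brownian M)).
Qed.

(** [solution_unique] has an exceptional set depending on v. At a fixed time the set where the two
    demands differ is measurable and null under every conditional law, hence null under the joint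
    one. *)
Lemma joint_demand t : t \in `[0, 1] -> {ae joint_law M, forall w, Y t w = sigma * sig t w}.
Proof.
move=> t01; have := t01; rewrite in_itv/= => /andP[t0 t1].
have msig : measurable_fun setT (fun w => sigma * sig t w).
  apply: measurable_funM => //.
  exact: (measurable_signal (kyle_brownian M) measurable_value L0 L1 mu gamma t0 t1).
have mE : measurable [set w | Y t w != sigma * sig t w].
  have -> : [set w | Y t w != sigma * sig t w] =
     (fun w => Y t w - sigma * sig t w) @^-1` (~` [set 0]).
    apply/seteqP; split => w /=; first by move=> /negP h /eqP; rewrite subr_eq0.
    by move=> h; apply/negP; rewrite -subr_eq0 => /eqP.
  apply: measurable_preimage; last exact: measurableC.
  by apply: measurable_funB => //; exact: measurable_demand.
exists [set w | Y t w != sigma * sig t w]; split => //; last by move=> w /= /eqP.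
apply: joint_law0 => // v; apply/eqP; rewrite eq_le measure_ge0 andbT.
have [N [mN N0 NP]] := solution_unique v.
rewrite -N0 le_measure ?inE//; apply: subset_trans NP => w /= /eqP h [_ B0w H]; apply: h.
by rewrite -(demand_explicit t B0w) /demand H.
Qed.

Lemma demand_equation v : {ae cond_law M v, forall w,
  let b := fun s => drift_star kappa gamma sigma mu s (V w) (Y s w) in
  [/\ Y 0 w = 0, leb.-integrable `[0, 1] (EFin \o b) &
    forall t, t \in `[0, 1] ->
      Y t w = sigma * B t w + \int[leb]_(s in `[0, t]) b s]}.
Proof.
have [_ B0 _ _ _] := kyle_cond_brownian M v.
apply: (ae_imp2 B0 (theta_solves.2 v)) => w B0w [ib H]; split => //.
  rewrite /demand B0w mulr0 addr0 H ?in_itv/= ?lexx ?ler01//.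
  by rewrite set_itv1 /Rintegral integral_set1.
by move=> t t01; rewrite {1}/demand H// addrC.
Qed.

End solution.
End model.

(** * Square-integrability of the explicit solution *)

Section square_processes.
Context (R : realType) d (T : measurableType d) (Q : probability T R).
Notation mu := (@lebesgue_measure R).
Notation unit_box := (`[(0 : R), 1]%classic `*` [set: T]).
Notation dint F := (\int[Q]_w \int[mu]_(s in `[0%R, 1%R]) F s w)%E.
Implicit Types f g : R -> T -> R.

Definition square_process f :=
  measurable_fun unit_box (fun p => f p.1 p.2) /\
  (dint (fun s w => (f s w ^+ 2)%:E) < +oo)%E.

Lemma square_process_dom f g (K : R) : 0 <= K -> square_process f ->
  measurable_fun unit_box (fun p => g p.1 p.2) ->
  (forall s w, s \in `[0, 1] -> g s w ^+ 2 <= K * f s w ^+ 2) -> square_process g.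
Proof.
move=> K0 [mf f2] mg gf; split => //.
have mf2 : measurable_fun unit_box (fun p => f p.1 p.2 ^+ 2) by exact: measurable_funX.
apply: (@le_lt_trans _ _ (dint (fun s w => (K * f s w ^+ 2)%:E))).
  apply: (double_integral_le Q (f := fun s w => g s w ^+ 2)).
  - exact: measurable_funX.
  - exact: measurable_funM.
  - by move=> s w s01; rewrite sqr_ge0 gf.
rewrite (double_integralZ Q mf2 (fun _ _ => sqr_ge0 _) K0).
by apply: lte_mul_pinfty; [rewrite lee_fin|exact: fin_numE|].
Qed.

Lemma square_processD f g : square_process f -> square_process g ->
  square_process (fun s w => f s w + g s w).
Proof.
move=> [mf f2] [mg g2]; split; first exact: measurable_funD.
have mf2 : measurable_fun unit_box (fun p => f p.1 p.2 ^+ 2) by exact: measurable_funX.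
have mg2 : measurable_fun unit_box (fun p => g p.1 p.2 ^+ 2) by exact: measurable_funX.
have ms : measurable_fun unit_box (fun p => f p.1 p.2 ^+ 2 + g p.1 p.2 ^+ 2).
  exact: measurable_funD.
apply: (@le_lt_trans _ _ (dint (fun s w => (2 * (f s w ^+ 2 + g s w ^+ 2))%:E))).
  apply: (double_integral_le Q (f := fun s w => (f s w + g s w) ^+ 2)).
  - by apply: measurable_funX; exact: measurable_funD.
  - exact: measurable_funM.
  - by move=> s w _; rewrite sqr_ge0/=; have := sqr_ge0 (f s w - g s w); nra.
have p2 s w : 0 <= f s w ^+ 2 + g s w ^+ 2 by rewrite addr_ge0 ?sqr_ge0.
rewrite (double_integralZ Q ms p2 (ler0n R 2)).
apply: lte_mul_pinfty; [by rewrite lee_fin|exact: fin_numE|].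
rewrite (double_integralD Q mf2 mg2 (fun _ _ => sqr_ge0 _) (fun _ _ => sqr_ge0 _)).
exact: lte_add_pinfty.
Qed.

Lemma square_processZ f (k : R) : square_process f ->
  square_process (fun s w => k * f s w).
Proof.
move=> Sf; have [mf _] := Sf; apply: (square_process_dom (sqr_ge0 k) Sf).
  exact: measurable_funM.
by move=> s w _; rewrite exprMn.
Qed.

Lemma square_process_rv (X : T -> R) : measurable_fun setT X ->
  (\int[Q]_w (X w ^+ 2)%:E < +oo)%E -> square_process (fun _ => X).
Proof.
move=> mX X2; split.
  by apply: measurable_funTS; exact: (measurableT_comp mX).
apply: le_lt_trans X2; rewrite le_eqVlt; apply/orP; left; apply/eqP.
apply: eq_integral => w _.
by rewrite integral_cst//= lebesgue_measure_itv/= lte_fin ltr01 -EFinB subr0 mule1.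
Qed.

Lemma square_process_cst (k : R) : square_process (fun _ _ => k).
Proof.
split; first exact: measurable_cst.
by rewrite (double_integral_cst Q) ltry.
Qed.

End square_processes.

Section square_signal.
Context (R : realType) d (T : measurableType d) (Q : probability T R).
Variables (B : R -> T -> R) (V : T -> R).
Hypotheses (HB : is_brownian Q B) (mV : measurable_fun setT V).
Hypothesis VB : forall A, <<s history B 1>> A -> forall D, measurable D ->
  Q (A `&` V @^-1` D) = (Q A * Q (V @^-1` D))%E.
Variables (L : R) (L0 : 0 < L) (L1 : L < 1) (m g : R).
Hypothesis Z2 : (\int[Q]_w (zscore V m g w ^+ 2)%:E < +oo)%E.
Notation mu := (@lebesgue_measure R).
Notation a := (resid L).
Notation unit_box := (`[(0 : R), 1]%classic `*` [set: T]).

Lemma measurable_wiener t : t \in `[0, 1] -> measurable_fun setT (wiener B L t).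
Proof.
rewrite in_itv/= => /andP[t0 t1]; apply: (measurable_full_history HB mV t1).
exact: (wiener_history HB).
Qed.

Lemma measurable_process_wiener : measurable_fun unit_box (fun p => wiener B L p.1 p.2).
Proof.
apply: measurable_process; first exact: measurable_wiener.
by move=> w; exact: (wiener_continuous HB L0 L1).
Qed.

(** The variance is t / a(t), and a is bounded below by 1 - L^2 on [0, 1]. *)
Lemma wiener_moment2 t : t \in `[0, 1] ->
  (\int[Q]_w (wiener B L t w ^+ 2)%:E <= (1 - L ^+ 2)^-1%:E)%E.
Proof.
move=> t01; have := t01; rewrite in_itv/= => /andP[t0 t1].
have L21 : 0 < 1 - L ^+ 2 by rewrite subr_gt0 expr_lt1// ltW.
move: t0; rewrite le_eqVlt => /predU1P[<-|t0].
  under eq_integral do rewrite wiener0 expr0n/=.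
  by rewrite integral0 lee_fin invr_ge0 ltW.
have v0 := var_between_gt0 L0 L1 t0 t1.
have mt := measurable_wiener t01.
have -> : (\int[Q]_w (wiener B L t w ^+ 2)%:E =
    \int[Q]_w ((wiener B L t w - wiener B L 0 w) ^+ 2)%:E)%E.
  by apply: eq_integral => w _; rewrite wiener0 subr0.
rewrite (ge0_integral_indep (P := Q) (nu := normal_prob 0 (Num.sqrt (var_between L 0 t)))
  (f := fun x : R => (x ^+ 2)%:E) (Y := fun w => wiener B L t w - wiener B L 0 w) measurableT)//.
- have sv0 : 0 < Num.sqrt (var_between L 0 t) by rewrite sqrtr_gt0.
  rewrite probability_setT mul1e (normal_moment2 sv0) lee_fin sqr_sqrtr ?(ltW v0)//.
  rewrite /var_between resid0 invr1.
  have an0 := resid_neq0 L0 L1 t1.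
  have -> : ((a t)^-1 - 1) / L ^+ 2 = t / a t.
    by move: an0; rewrite /resid => an0; field; rewrite an0 lt0r_neq0.
  apply: (@le_trans _ _ (a t)^-1).
    by rewrite ler_piMl// invr_ge0 ltW// resid_gt0.
  by rewrite lef_pV2 ?posrE ?resid_gt0//; exact: resid_min.
- apply: measurable_funB => //; apply: measurable_wiener.
  by rewrite in_itv/= lexx ler01.
- move=> D mD; have := wiener_indep HB mV VB L0 L1 (lexx 0) t0 t1 (@g_sigmaT _ _) mD.
  by [].
- by apply/measurable_EFinP; exact: measurable_funX.
- by move=> x; rewrite lee_fin sqr_ge0.
Qed.

Lemma square_wiener : square_process Q (wiener B L).
Proof.
split; first exact: measurable_process_wiener.
have m2 : measurable_fun unit_box (fun p => (wiener B L p.1 p.2 ^+ 2)%:E).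
  by apply/measurable_EFinP; apply: measurable_funX; exact: measurable_process_wiener.
have p2 s w : (0 <= (wiener B L s w ^+ 2)%:E)%E by rewrite lee_fin sqr_ge0.
rewrite (tonelli_process Q (f := fun s w => (wiener B L s w ^+ 2)%:E) m2 p2).
apply: (@le_lt_trans _ _ (\int[mu]_(s in `[0%R, 1%R]) (1 - L ^+ 2)^-1%:E)%E).
  rewrite integral_mkcond [leRHS]integral_mkcond.
  have h0 : 0 <= (1 - L ^+ 2)^-1 by rewrite invr_ge0 subr_ge0 expr_le1// ltW.
  apply: ge0_ae_le_integral.
  - by move=> s; rewrite patchE; case: ifPn => // _; exact: integral_ge0.
  - by move=> s; rewrite patchE; case: ifPn.
  - apply: aeW => s; rewrite !patchE; case: ifPn => //.
    by rewrite inE => s01; exact: wiener_moment2.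
by rewrite integral_cst//= lebesgue_measure_itv/= lte_fin ltr01 -EFinB subr0 mule1 ltry.
Qed.

Let resid01 s : s \in `[0, 1] -> 0 <= a s <= 1.
Proof.
rewrite in_itv/= => /andP[s0 s1]; rewrite ltW ?resid_gt0//= /resid gerBl.
by rewrite mulr_ge0// sqr_ge0.
Qed.

Let measurable_zscore : measurable_fun setT (zscore V m g).
Proof. by apply: measurable_funM => //; exact: measurable_funB. Qed.

Lemma square_signal : square_process Q (signal B V L m g).
Proof.
have Sz := square_process_rv measurable_zscore Z2.
apply: square_processD.
  apply: (square_process_dom (sqr_ge0 L) Sz).
    apply: measurable_funM; last by have [] := Sz.
    have cL : {within `[0, 1], continuous (fun t : R => L * t)}.
      move=> x; apply: cvgM; first exact: cvg_cst.
      have cid : continuous (fun s : R => s) by move=> y; exact: cvg_id.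
      exact: (continuous_subspaceT cid).
    exact: (measurable_process_cst cL).
  move=> s w; rewrite in_itv/= => /andP[s0 s1]; rewrite exprMn.
  apply: ler_wpM2r; first exact: sqr_ge0.
  by rewrite exprMn ler_piMr ?sqr_ge0// expr_le1.
apply: (square_process_dom ler01 square_wiener).
  apply: measurable_funM; last exact: measurable_process_wiener.
  exact: (measurable_process_cst (continuous_subspaceT (@continuous_resid _ L))).
move=> s w s01; have /andP[h0 h1] := resid01 s01.
rewrite exprMn; apply: ler_wpM2r; first exact: sqr_ge0.
by rewrite expr_le1.
Qed.

Lemma square_feedback : square_process Q (fun s w => zscore V m g w - L * wiener B L s w).
Proof.
have Sz := square_process_rv measurable_zscore Z2.
have := square_processD Sz (square_processZ (- L) square_wiener).
by congr square_process; apply/funext => s; apply/funext => w; rewrite mulNr.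
Qed.

End square_signal.

(** * Admissibility and optimality of the explicit strategy *)

Section optimality.
Context (R : realType) (d : measure_display) (Omega : measurableType d).
Variables (M : kyle_model R Omega) (sigma mu gamma kappa : R).
Hypotheses (sigma_gt0 : 0 < sigma) (gamma_gt0 : 0 < gamma) (kappa_gt0 : 0 < kappa).
Notation leb := (@lebesgue_measure R).
Notation B := (noise M).
Notation V := (value M).
Notation L := (Lambda kappa).
Notation lam := (L * (gamma / sigma)).
Notation c := (kappa * (gamma / sigma)).
Notation H := (price_star lam mu).
Notation P v := (cond_law M v).
Notation unit_box := (`[(0 : R), 1]%classic `*` [set: Omega]).
Notation dint v F := (\int[cond_law M v]_w \int[leb]_(s in `[0%R, 1%R]) F s w)%E.
Notation sig := (signal B V L mu gamma).
Notation rate0 := (explicit_rate M sigma mu gamma kappa).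
Notation position0 := (explicit_position M sigma mu gamma kappa).

Let L0 : 0 < L := Lambda_gt0 kappa.
Let L1 : L < 1 := Lambda_lt1 kappa_gt0.
Let mV : measurable_fun setT V := measurable_value M.

Let lam0 : 0 < lam.
Proof. by rewrite mulr_gt0// divr_gt0. Qed.

Let c0 : 0 < c.
Proof. by rewrite mulr_gt0// divr_gt0. Qed.

(** Up to time 1 the division by a cancels the factor of the innovation, so the rate is L sigma (Z -
    L W). *)
Lemma square_explicit_rate (Q : probability Omega R) : is_brownian Q B ->
  (forall A, <<s history B 1>> A -> forall D, measurable D ->
    Q (A `&` V @^-1` D) = (Q A * Q (V @^-1` D))%E) ->
  (\int[Q]_w (zscore V mu gamma w ^+ 2)%:E < +oo)%E -> square_process Q rate0.
Proof.
move=> HB VB Z2.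
have Sf := square_processZ (L * sigma) (square_feedback HB mV VB L0 L1 Z2).
have E s w : s \in `[0, 1] ->
    L * sigma * (zscore V mu gamma w - L * wiener B L s w) = rate0 s w.
  rewrite in_itv/= => /andP[_ s1]; rewrite /explicit_rate innovE.
  by rewrite [_ / resid L s]mulrC mulKf ?resid_neq0.
apply: (square_process_dom ler01 Sf); last by move=> s w s01; rewrite mul1r E.
apply: eq_measurable_fun (proj1 Sf) => -[s w]; rewrite inE/= => -[s01 _].
exact: E.
Qed.

Lemma cond_zscore2 v : (\int[P v]_w (zscore V mu gamma w ^+ 2)%:E < +oo)%E.
Proof.
rewrite (ae_integral_eq (g := fun=> (((v - mu) / gamma) ^+ 2)%:E)); last first.
  by apply: (ae_imp (kyle_cond_value M v)) => w Vw; rewrite /zscore Vw.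
have := finite_measure_integrable_cst (P v) (((v - mu) / gamma) ^+ 2).
move=> /(_ setT measurableT) /integrableP[_]; apply: le_lt_trans.
apply: ge0_ae_le_integral => [w|w|]; [by rewrite lee_fin sqr_ge0| by [] |].
by apply: aeW => w /=; rewrite lee_fin ler_norm.
Qed.

Let square_rate v : square_process (P v) rate0.
Proof.
apply: square_explicit_rate; [exact: kyle_cond_brownian|exact: kyle_cond_independence|].
exact: cond_zscore2.
Qed.

(** Under the conditional law the mispricing starts at v - mu, and the price term splits into lambda
    theta and lambda sigma B; this matches the abstract control problem almost surely. *)
Lemma expected_wealthE theta alpha v : adapted (insider_filtration M) theta ->
  trading_rate M theta alpha ->
  (dint v (fun s w => (alpha s w ^+ 2)%:E) < +oo)%E ->
  expected_wealth M sigma c H theta alpha v = ((control_value lam c sigma (v - mu))%:E -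
    (c / 2)%:E * dint v (fun s w => ((alpha s w -
       mispricing lam (v - mu) (theta^~ w) (fun s => lam * sigma * bpath B s w) s /
       depth lam c s) ^+ 2)%:E))%E.
Proof.
move=> kth [kal mal pal] al2; rewrite /expected_wealth expectation.unlock.
apply: (expected_wealth_ae (kyle_cond_brownian M v) mV (@kyle_cond_independence _ _ _ M v)) => //.
- by move=> t t01 D mD; apply: insider_known_cond; exact: kal.
- by move=> t t01 D mD; apply: insider_known_cond; exact: kth.
have [_ B0 _ _ _] := kyle_cond_brownian M v.
apply: (ae_imp2 B0 (kyle_cond_value M v)) => w B0w Vw; rewrite /insider_wealth.
congr (_ - _); apply: eq_Rintegral => s _.
rewrite /mispricing /price_star /demand /bpath B0w Vw subr0; congr (_ * _).
by ring.
Qed.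

Section solution.
Variable theta : R -> Omega -> R.
Hypothesis theta_solves : solves_theta_star M kappa gamma sigma mu theta.

Let theta_unique v := solution_unique sigma_gt0 gamma_gt0 kappa_gt0 theta_solves v.

Let primitive0 w : primitive_from 0 (rate0^~ w) (position0^~ w) :=
  explicit_primitive M sigma mu gamma kappa_gt0 w.

Lemma solution_trading_rate : trading_rate M theta rate0.
Proof.
split.
- exact: explicit_rate_adapted.
- by have [] := square_rate 0.
- move=> v; apply: (ae_imp (theta_unique v)) => w [_ _ thE].
  apply/path_primitiveE; apply: (eq_primitive_from (primitive0 w)) => // t t01.
  by rewrite thE.
Qed.

Lemma solution_admissible : admissible_with_rate M sigma H theta rate0.
Proof.
split; [exact: theta_solves.1|exact: solution_trading_rate|move=> v].
have Sr := square_rate v.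
have Ss := square_signal (kyle_cond_brownian M v) mV (@kyle_cond_independence _ _ _ M v)
  L0 L1 (cond_zscore2 v).
have [mh h2] := square_processD (square_processZ (lam * sigma) Ss) (square_process_cst (P v) mu).
have [mr r2] := Sr.
rewrite (ae_integral_eq (g := fun w => \int[leb]_(s in `[0%R, 1%R])
   ((lam * sigma * sig s w + mu) ^+ 2 + rate0 s w ^+ 2)%:E)%E); last first.
  apply: (ae_imp (theta_unique v)) => w [_ B0w thE].
  apply: eq_integral => s; rewrite inE => s01.
  by rewrite /price_star /demand thE// -/(demand M sigma position0 s w) demand_explicit// mulrA.
rewrite (double_integralD (P v) (f := fun s w => (lam * sigma * sig s w + mu) ^+ 2)
  (g := fun s w => rate0 s w ^+ 2) (measurable_funX 2 mh) (measurable_funX 2 mr)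
  (fun _ _ => sqr_ge0 _) (fun _ _ => sqr_ge0 _)).
exact: lte_add_pinfty.
Qed.

(** Any trading rate of the solution equals the explicit one at almost every time, and the explicit
    one is the optimal feedback by [drift_starE]; the gap is therefore zero. *)
Lemma solution_wealth alpha v : trading_rate M theta alpha ->
  expected_wealth M sigma c H theta alpha v = (control_value lam c sigma (v - mu))%:E.
Proof.
move=> al; have [_ _ pal] := al.
have ae_rate : {ae P v, forall w, [/\ V w = v, B 0 w = 0,
    forall t, t \in `[0, 1] -> theta t w = position0 t w &
    {ae leb, forall s, s \in `[0, 1] -> alpha s w = rate0 s w}]}.
  apply: (ae_imp2 (theta_unique v) (pal v)) => w [Vw B0w thE] /path_primitiveE pw.
  split => //; apply: (primitive_from_uniq pw).
  by apply: (eq_primitive_from (primitive0 w)) => // t t01; rewrite thE.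
have ae01 (f g : R -> R) : {ae leb, forall s, s \in `[0, 1] -> f s = g s} ->
    (\int[leb]_(s in `[0%R, 1%R]) (f s)%:E = \int[leb]_(s in `[0%R, 1%R]) (g s)%:E)%E.
  move=> fg; rewrite integral_mkcond [RHS]integral_mkcond; apply: ae_integral_eq.
  apply: (ae_imp fg) => s fgs; rewrite !patchE; case: ifPn => //.
  by rewrite inE => s01; rewrite fgs.
have [_ r2] := square_rate v.
have al2 : (dint v (fun s w => (alpha s w ^+ 2)%:E) < +oo)%E.
  rewrite (ae_integral_eq (g := fun w => \int[leb]_(s in `[0%R, 1%R]) (rate0 s w ^+ 2)%:E)%E)//.
  apply: (ae_imp ae_rate) => w [_ _ _ alE]; apply: ae01.
  by apply: (ae_imp alE) => s alEs s01; rewrite alEs.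
rewrite (expected_wealthE theta_solves.1 al al2).
rewrite (ae_integral_eq (g := cst 0%E)).
  by rewrite integral0 mule0 sube0.
apply: (ae_imp ae_rate) => w [Vw B0w thE alE].
transitivity (\int[leb]_(s in `[0%R, 1%R]) (cst (0 : R) s)%:E)%E; last exact: integral0.
apply: ae01; apply: (ae_imp alE) => s alEs s01; rewrite alEs//=.
rewrite -(explicit_drift (y := demand M sigma theta s w) sigma_gt0 s01).
  move: (s01); rewrite in_itv/= => /andP[_ s1].
  rewrite drift_starE// /mispricing /demand Vw /bpath B0w subr0.
  by rewrite (_ : v - mu - _ - _ = v - mu - lam * (theta s w + sigma * B s w)) ?subrr ?expr0n//; ring.
by rewrite /demand thE// -/(demand M sigma position0 s w) demand_explicit.
Qed.

(** The upper bound holds because the gap term enters with a negative sign; square-integrability of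
    a competitor's rate comes from its admissibility. *)
Lemma solution_optimal alpha v : trading_rate M theta alpha ->
  expected_wealth M sigma c H theta alpha v =
    ereal_sup [set e | exists theta' alpha',
      admissible_with_rate M sigma H theta' alpha' /\
      e = expected_wealth M sigma c H theta' alpha' v].
Proof.
move=> al; apply/eqP; rewrite eq_le; apply/andP; split.
  apply: ereal_sup_ubound; exists theta, rate0; split; first exact: solution_admissible.
  by rewrite !solution_wealth//; exact: solution_trading_rate.
apply: ge_ereal_sup => _ [th' [al' [[kth' al't adm] ->]]].
rewrite solution_wealth//.
have al2 : (dint v (fun s w => (al' s w ^+ 2)%:E) < +oo)%E.
  apply: le_lt_trans (adm v); apply: ge0_ae_le_integral.
  - by move=> w; apply: integral_ge0 => s _; rewrite lee_fin sqr_ge0.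
  - by move=> w; apply: integral_ge0 => s _; rewrite lee_fin addr_ge0 ?sqr_ge0.
  - apply: aeW => w; rewrite integral_mkcond [leRHS]integral_mkcond.
    apply: ge0_ae_le_integral.
    + by move=> s; rewrite patchE; case: ifPn => // _; rewrite lee_fin sqr_ge0.
    + by move=> s; rewrite patchE; case: ifPn => // _; rewrite lee_fin addr_ge0 ?sqr_ge0.
    + apply: aeW => s; rewrite !patchE; case: ifPn => // _.
      by rewrite lee_fin lerDr sqr_ge0.
rewrite (expected_wealthE kth' al't al2) lee_subel_addl//.
rewrite leeDr// mule_ge0//; first by rewrite lee_fin divr_ge0// ltW.
by apply: integral_ge0 => w _; apply: integral_ge0 => s _; rewrite lee_fin sqr_ge0.
Qed.

End solution.
End optimality.

(** * Conditional laws of the value *)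

Section conditional_uniqueness.
Local Open Scope ereal_scope.
Context d (T : measurableType d) (R : realType) (P : probability T R).

(** The sets where the difference of the versions is nonnegative or negative both belong to [G], so
    its absolute value integrates to 0. *)
Lemma cond_exp_unique (G : set_system T) (X Z Z' : T -> R) : sigma_algebra setT G ->
  is_cond_exp P G X Z -> is_cond_exp P G X Z' -> {ae P, forall w, Z w = Z' w}.
Proof.
move=> sG [Gm _ iZ GZ ZE] [_ _ iZ' GZ' Z'E].
have sGE : <<s G>> = G by exact: sigma_algebra_id.
pose h w := (Z w - Z' w)%R.
have Gh D : measurable D -> G (h @^-1` D).
  move=> mD; rewrite -sGE; apply: (g_sigma_measurable_fun _ mD).
  by apply: measurable_funB; apply: measurable_fun_g_sigma => E mE; rewrite sGE;
    [exact: GZ|exact: GZ'].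
have ih : P.-integrable setT (EFin \o h) by exact: integrable_EFinB.
have h0 A : G A -> \int[P]_(w in A) (h w)%:E = 0.
  move=> GA; have mA := Gm _ GA.
  have iZA : P.-integrable A (EFin \o Z) by apply: integrableS iZ.
  have iZA' : P.-integrable A (EFin \o Z') by apply: integrableS iZ'.
  rewrite (integral_EFinB mA iZA iZA') -ZE// -Z'E// subee//.
  by rewrite ZE//; exact: integrable_fin_num.
have mh : measurable_fun setT (EFin \o h) by have /integrableP[] := ih.
have mpos : measurable [set w | (0 <= h w)%R].
  rewrite (_ : [set w | _] = h @^-1` `[0%R, +oo[%classic).
    by apply: Gm; exact: Gh.
  by apply/seteqP; split => w /=; rewrite in_itv/= andbT.
have Gpos : G [set w | (0 <= h w)%R].
  rewrite (_ : [set w | _] = h @^-1` `[0%R, +oo[%classic); first exact: Gh.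
  by apply/seteqP; split => w /=; rewrite in_itv/= andbT.
have Gneg : G (~` [set w | (0 <= h w)%R]).
  rewrite (_ : ~` _ = h @^-1` `]-oo, 0%R[%classic); first exact: Gh.
  by apply/seteqP; split => w /=; rewrite in_itv/= ltNge => /negP.
have : \int[P]_w `|(h w)%:E| = 0.
  rewrite -(setvU [set w | (0 <= h w)%R]) ge0_integral_setU//=; last 3 first.
  - exact: measurableC.
  - by rewrite setvU; apply/measurable_EFinP; apply: measurableT_comp => //; exact/measurable_EFinP.
  - by apply/disj_setPS => w [].
  have -> : \int[P]_(x in [set w | (0 <= h w)%R]) `|h x|%:E = 0.
    rewrite -(h0 _ Gpos); apply: eq_integral => w; rewrite inE/= => hw.
    by rewrite ger0_norm.
  have ihN : P.-integrable (~` [set w | (0 <= h w)%R]) (EFin \o h).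
    by apply: integrableS ih => //; exact: measurableC.
  rewrite adde0 -[RHS](mule0 (-1)%:E) -(h0 _ Gneg) -(integral_EFinZ _ (-1) ihN); last exact: measurableC.
  apply: eq_integral => w; rewrite inE/= => /negP; rewrite -ltNge => hw.
  by rewrite ltr0_norm// mulN1r.
move=> /(ae_eq_integral_abs P measurableT mh) H.
by apply: (ae_imp H) => w /(_ I) /= [/eqP]; rewrite subr_eq0 => /eqP.
Qed.

End conditional_uniqueness.

Section filtering_consequences.
Context (R : realType) (d : measure_display) (Omega : measurableType d).
Variables (M : kyle_model R Omega) (sigma mu gamma kappa : R).
Hypotheses (sigma_gt0 : 0 < sigma) (gamma_gt0 : 0 < gamma) (kappa_gt0 : 0 < kappa).
Hypothesis value_normal : forall D : set R, measurable D ->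
  prior M D = normal_prob mu gamma D.
Variable theta : R -> Omega -> R.
Hypothesis theta_solves : solves_theta_star M kappa gamma sigma mu theta.
Notation leb := (@lebesgue_measure R).
Notation B := (noise M).
Notation V := (value M).
Notation L := (Lambda kappa).
Notation lam := (L * (gamma / sigma)).
Notation a := (resid L).
Notation Q := (joint_law M).
Notation Y := (demand M sigma theta).
Notation F := (market_filtration M sigma theta).
Notation sig := (signal B V L mu gamma).
Notation inn := (innov B V L mu gamma).

Let L0 : 0 < L := Lambda_gt0 kappa.
Let L1 : L < 1 := Lambda_lt1 kappa_gt0.
Let mV : measurable_fun setT V := measurable_value M.

Let mY t : t \in `[0, 1] -> measurable_fun setT (Y t).
Proof. exact: (measurable_demand theta_solves). Qed.

Lemma zscore_law D : measurable D -> Q (zscore V mu gamma @^-1` D) = normal_prob 0 1 D.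
Proof.
move=> mD.
have mlin : measurable_fun [set: R] (fun v : R => (v - mu) / gamma).
  by apply: measurable_funM => //; exact: measurable_funB.
have -> : zscore V mu gamma @^-1` D = V @^-1` ((fun v => (v - mu) / gamma) @^-1` D) by [].
rewrite kyle_value_law; last exact: measurable_preimage.
rewrite value_normal; last exact: measurable_preimage.
rewrite -[gamma in normal_prob _ gamma _]mulr1.
rewrite -(normal_prob_affine mu gamma_gt0 ltr01); last exact: measurable_preimage.
congr (normal_prob 0 1); apply/seteqP; split => x /=;
  by rewrite addrK mulrC mulKf// lt0r_neq0.
Qed.

Lemma innov_market t : t \in `[0, 1] ->
  indep_law Q (F t) (inn t) (normal_prob 0 (Num.sqrt (a t))).
Proof.
move=> t01; have := t01; rewrite in_itv/= => /andP[t0 t1].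
exact: (innov_indep_market (kyle_brownian M) mV (kyle_independence (k := M)) L0 L1
  zscore_law mY (joint_demand sigma_gt0 gamma_gt0 kappa_gt0 theta_solves) t0 t1).
Qed.

Lemma market_sigma_algebra t : sigma_algebra setT (F t).
Proof.
split=> [s _|A FA s hs|G FG s hs].
- exact: (@measurable0 _ (g_sigma_algebraType _)).
- by rewrite setTD; apply: (@measurableC _ (g_sigma_algebraType _)); exact: FA.
- apply: (@bigcup_measurable _ (g_sigma_algebraType _) G setT) => n _.
  exact: FG.
Qed.

Lemma market_measurable t : F t `<=` measurable.
Proof.
move=> A FA; have := FA 1 (or_intror erefl).
apply: g_sigma_sub_measurable => C [[u /= u01 [D mD <-]]|[]//]; exact: mY.
Qed.

Lemma market_demand t : t \in `[0, 1] -> forall D, measurable D -> F t (Y t @^-1` D).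
Proof.
move=> t01 D mD s hs; apply: sub_sigma_algebra; left; exists t => /=; last first.
  by exists D => //; rewrite setTI.
move: t01; rewrite !in_itv/= => /andP[-> t1] /=.
by case: hs => [/andP[/ltW]|->].
Qed.

(** The value is a part observed by the market plus [gamma] times an innovation independent of the
    market's information; all conditional laws, means and variances are read off from this. *)
Lemma value_decomposition t : t \in `[0, 1] ->
  {ae Q, forall w, V w = lam * Y t w + mu + gamma * inn t w}.
Proof.
move=> t01.
apply: (ae_imp (joint_demand sigma_gt0 gamma_gt0 kappa_gt0 theta_solves t01)) => w ->.
by rewrite /innov /zscore; field; rewrite !lt0r_neq0.
Qed.

Lemma market_minn t : t \in `[0, 1] -> measurable_fun setT (inn t).
Proof.
rewrite in_itv/= => /andP[t0 t1].
exact: (measurable_innov (kyle_brownian M) mV L0 L1 mu gamma t0 t1).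
Qed.

Let sqrt_resid t : t \in `[0, 1] -> 0 < Num.sqrt (a t).
Proof. by rewrite in_itv/= => /andP[_ t1]; rewrite sqrtr_gt0; exact: resid_gt0. Qed.

Let sqrt_var t : t \in `[0, 1] ->
  gamma * Num.sqrt (a t) = Num.sqrt (gamma ^+ 2 * (1 - t * L ^+ 2)).
Proof. by move=> _; rewrite sqrtrM ?sqr_ge0// sqrtr_sqr ger0_norm// ltW. Qed.

Lemma innov_moment2 t A : t \in `[0, 1] -> F t A ->
  (\int[Q]_(w in A) (inn t w ^+ 2)%:E = Q A * (a t)%:E)%E.
Proof.
move=> t01 FA.
rewrite (ge0_integral_indep (nu := normal_prob 0 (Num.sqrt (a t)))
  (f := fun x : R => (x ^+ 2)%:E) (market_measurable FA) (market_minn t01))//.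
- rewrite (normal_moment2 (sqrt_resid t01)) sqr_sqrtr//.
  by move: t01; rewrite in_itv/= => /andP[_ t1]; rewrite ltW// resid_gt0.
- by move=> D mD; exact: innov_market.
- by apply/measurable_EFinP; exact: measurable_funX.
- by move=> x; rewrite lee_fin sqr_ge0.
Qed.

Lemma innov_mean t A : t \in `[0, 1] -> F t A ->
  Q.-integrable setT (EFin \o inn t) /\ (\int[Q]_(w in A) (inn t w)%:E = 0)%E.
Proof.
move=> t01 FA; have mA := market_measurable FA; have mi := market_minn t01.
have ii : Q.-integrable setT (EFin \o inn t).
  apply: (integrable_sqr (m := Q)) => //; first exact: fin_num_fun_lty.
  rewrite innov_moment2//; first by rewrite probability_setT mul1e ltry.
  by rewrite -(sigma_algebra_id (market_sigma_algebra t)); exact: g_sigmaT.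
split => //.
have ind D E : measurable D -> measurable E ->
    (Q ((\1_A : _ -> R) @^-1` D `&` inn t @^-1` E) =
     Q ((\1_A : _ -> R) @^-1` D) * normal_prob 0 (Num.sqrt (a t)) E)%E.
  move=> mD mE; apply: innov_market => //.
  rewrite -(sigma_algebra_id (market_sigma_algebra t)).
  rewrite preimage_indic; case: ifPn => _; case: ifPn => _ /=.
  - exact: g_sigmaT.
  - exact: sub_sigma_algebra.
  - by apply: (@measurableC _ (g_sigma_algebraType _)); exact: sub_sigma_algebra.
  - exact: (@measurable0 _ (g_sigma_algebraType _)).
have i1 : Q.-integrable setT (EFin \o (\1_A : _ -> R)) by exact: integrable_indic.
have [iid E0] := normal_mean (sqrt_resid t01).
have [_] := integral_indep_mul (nu := normal_prob 0 (Num.sqrt (a t))) (X := \1_A)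
  (Y := inn t) (g := id) (measurable_indic mA) mi (@measurable_id _ _ setT) ind i1 iid E0.
move=> <-; rewrite integral_mkcond; apply: eq_integral => w _.
by rewrite patchE indicE; case: ifPn => _ /=; rewrite ?mul1r ?mul0r.
Qed.

Let FT t : F t setT.
Proof. by rewrite -(sigma_algebra_id (market_sigma_algebra t)); exact: g_sigmaT. Qed.

Let value_integrable : Q.-integrable setT (EFin \o V).
Proof.
have t00 : (0 : R) \in `[0, 1] by rewrite in_itv/= lexx ler01.
have [ii _] := innov_mean t00 (@FT 0).
have ic : Q.-integrable setT (EFin \o cst mu) by exact: finite_measure_integrable_cst.
have := integrable_EFinD measurableT ic (integrable_EFinZ measurableT gamma ii).
apply: eq_integrable => // w _ /=; congr (_%:E).
by rewrite /innov signal0 mulr0 subr0 /zscore; field; rewrite lt0r_neq0.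
Qed.

(** Obtained from the integrability of the value and of the innovation, of which the price is almost
    surely a combination. *)
Let price_integrable t : t \in `[0, 1] ->
  Q.-integrable setT (EFin \o (fun w => lam * Y t w + mu)).
Proof.
move=> t01; have [ii _] := innov_mean t01 (@FT t).
have i := integrable_EFinB measurableT value_integrable (integrable_EFinZ measurableT gamma ii).
apply/integrableP; split.
  by apply/measurable_EFinP; apply: measurable_funD => //; apply: measurable_funM => //; exact: mY.
have /integrableP[_] := i; apply: le_lt_trans; rewrite le_eqVlt; apply/orP; left; apply/eqP.
apply: ae_integral_eq; apply: (ae_imp (value_decomposition t01)) => w /= ->.
by congr (`|_%:E|%E); ring.
Qed.

Let residual_integral t (f : R -> \bar R) A : t \in `[0, 1] ->
  (\int[Q]_(w in A) f (V w - (lam * Y t w + mu))%R =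
   \int[Q]_(w in A) f (gamma * inn t w)%R)%E.
Proof.
move=> t01; rewrite integral_mkcond [RHS]integral_mkcond; apply: ae_integral_eq.
apply: (ae_imp (value_decomposition t01)) => w h.
by rewrite !patchE; case: ifPn => // _; rewrite {1}h addrAC subrr add0r.
Qed.

Lemma market_cond_exp t : t \in `[0, 1] ->
  is_cond_exp Q (F t) V (fun w => price_star lam mu t (Y t w)).
Proof.
move=> t01; split => //.
- exact: market_measurable.
- exact: price_integrable.
- move=> D mD; rewrite -(sigma_algebra_id (market_sigma_algebra t)).
  apply: (g_sigma_measurable_fun _ mD); apply: measurable_funD => //.
  apply: measurable_funM => //; apply: measurable_fun_g_sigma => E mE.
  by apply: sub_sigma_algebra; exact: market_demand.
- move=> A FA; have mA := market_measurable FA.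
  have [ii i0] := innov_mean t01 FA.
  have iV : Q.-integrable A (EFin \o V) by apply: integrableS value_integrable.
  have iP : Q.-integrable A (EFin \o (fun w => lam * Y t w + mu)).
    by apply: integrableS (price_integrable t01).
  have iI : Q.-integrable A (EFin \o inn t) by apply: integrableS ii.
  have := residual_integral (fun x => x%:E) A t01.
  rewrite (integral_EFinB mA iV iP) (integral_EFinZ mA gamma iI) i0 mule0.
  have fP := integrable_fin_num mA iP.
  have fV := integrable_fin_num mA iV.
  by move=> /eqP; rewrite sube_eq ?fin_num_adde_defl// add0e => /eqP.
Qed.

Lemma market_cond_var t : t \in `[0, 1] ->
  is_cond_var Q (F t) V (cst (gamma ^+ 2 * a t)).
Proof.
move=> t01; exists (fun w => price_star lam mu t (Y t w)); first exact: market_cond_exp.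
have res2 A : F t A -> (\int[Q]_(w in A) ((V w - price_star lam mu t (Y t w)) ^+ 2)%:E =
    (gamma ^+ 2)%:E * (Q A * (a t)%:E))%E.
  move=> FA; rewrite (residual_integral (fun x => (x ^+ 2)%:E) A t01).
  rewrite -innov_moment2// -ge0_integralZl//.
  - by apply: eq_integral => w _; rewrite exprMn EFinM.
  - exact: market_measurable FA.
  - apply/measurable_EFinP; apply: measurable_funTS; apply: measurable_funX.
    exact: market_minn.
  - by move=> w _; rewrite lee_fin sqr_ge0.
  - by rewrite lee_fin sqr_ge0.
split => //.
- exact: market_measurable.
- apply: integrable_ge0 => //.
  + apply: measurable_funX; apply: measurable_funB => //; apply: measurable_funD => //.
    by apply: measurable_funM => //; exact: mY.
  + by move=> w; exact: sqr_ge0.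
  + by rewrite res2//; rewrite probability_setT mul1e -EFinM ltry.
- exact: finite_measure_integrable_cst.
- move=> D mD; rewrite -(sigma_algebra_id (market_sigma_algebra t)).
  exact: (g_sigma_measurable_fun (measurable_cst _) mD).
- move=> A FA; rewrite res2//; have mA := market_measurable FA.
  transitivity ((gamma ^+ 2 * a t)%:E * Q A)%E; first by rewrite muleCA muleC EFinM.
  by symmetry; exact: (integral_cst Q mA (gamma ^+ 2 * a t)%:E).
Qed.

(** A version of the conditional variance may be centred at any version [m] of the conditional mean;
    uniqueness identifies [m] with the price almost surely. *)
Lemma expected_cond_var t Z : t \in `[0, 1] -> is_cond_var Q (F t) V Z ->
  (\int[Q]_w (Z w)%:E = (gamma ^+ 2 * a t)%:E)%E.
Proof.
move=> t01 [m Vm [_ _ _ _ /(_ setT (@FT t)) <-]].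
have [m' Vm' [_ _ _ _ /(_ setT (@FT t)) H]] := market_cond_var t01.
transitivity (\int[Q]_w (cst (gamma ^+ 2 * a t) w)%:E)%E; last first.
  transitivity ((gamma ^+ 2 * a t)%:E * 1)%E; last exact: mule1.
  by rewrite -(probability_setT Q); exact: (integral_cst Q measurableT (gamma ^+ 2 * a t)%:E).
rewrite -H; apply: ae_integral_eq.
by apply: (ae_imp (cond_exp_unique (market_sigma_algebra t) Vm Vm')) => w ->.
Qed.

(** The demand is frozen at y and the innovation integrated out, which gives [k y]; independence of
    the innovation from F t intersected with events of the demand justifies this on each event of
    the market. *)
Lemma market_cond_law t : t \in `[0, 1] ->
  is_cond_law Q (F t) V (fun w => normal_prob (lam * Y t w + mu)
    (Num.sqrt (gamma ^+ 2 * (1 - t * L ^+ 2)))).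
Proof.
move=> t01 D mD.
pose nu : probability _ R := normal_prob 0 (Num.sqrt (a t)).
pose f (z : R * R) : \bar R := (\1_D (gamma * z.2 + (lam * z.1 + mu)))%:E.
pose k (y : R) : \bar R := (\int[nu]_x f (y, x))%E.
have mf : measurable_fun setT f.
  apply/measurable_EFinP; apply: (measurableT_comp (f := (\1_D : R -> R))) => //.
  apply: measurable_funD; first exact: measurable_funM.
  by apply: measurable_funD => //; exact: measurable_funM.
have f0 z : (0 <= f z)%E by rewrite lee_fin indicE.
have kE y : k y = normal_prob (lam * y + mu) (Num.sqrt (gamma ^+ 2 * (1 - t * L ^+ 2))) D.
  rewrite -(sqrt_var t01) -(normal_prob_affine _ gamma_gt0 (sqrt_resid t01) mD).
  have mpre : measurable ((fun x : R => gamma * x + (lam * y + mu)) @^-1` D).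
    apply: measurable_preimage => //.
    by apply: measurable_funD => //; exact: measurable_funM.
  have := integral_indic nu measurableT mpre; rewrite setIT => <-.
  by apply: eq_integral => x _.
have mk : measurable_fun setT k by exact: measurable_fun_fubini_tonelli_F.
have k0 y : (0 <= k y)%E by exact: integral_ge0.
have k1 y : (k y <= 1)%E.
  by rewrite kE; exact: (probability_le1 (normal_prob _ _)).
have kfin y : k y \is a fin_num.
  by rewrite ge0_fin_numE//; apply: le_lt_trans (k1 y) _; rewrite ltry.
rewrite (_ : (fun w => fine _) = fun w => fine (k (Y t w))); last first.
  by apply/funext => w; rewrite kE.
have mfk : measurable_fun setT (fun y => fine (k y)).
  exact: (measurableT_comp (@fine_measurable R setT measurableT) mk).
have FK E : measurable E -> F t ((fun w => fine (k (Y t w))) @^-1` E).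
  by move=> mE; exact: (market_demand t01 (measurable_preimage mfk mE)).
split => //.
- exact: market_measurable.
- by apply: integrable_indic => //; exact: measurable_preimage.
- apply: (integrable_ge0 (f := fun w => fine (k (Y t w)))) => //.
  + by apply: (measurableT_comp mfk); exact: mY.
  + by move=> w; rewrite fine_ge0.
  + apply: (@le_lt_trans _ _ (\int[Q]_w (cst 1 w))%E).
      apply: ge0_ae_le_integral => [w|w|].
      * by rewrite lee_fin fine_ge0.
      * by [].
      * by apply: aeW => w; rewrite fineK.
    by rewrite integral_cst// mul1e; exact: fin_num_fun_lty.
- move=> A FA; have mA := market_measurable FA.
  transitivity (\int[Q]_(w in A) f (Y t w, inn t w))%E.
    rewrite integral_mkcond [RHS]integral_mkcond; apply: ae_integral_eq.
    apply: (ae_imp (value_decomposition t01)) => w h.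
    rewrite !patchE; case: ifPn => // _; rewrite /f indicE.
    rewrite (_ : gamma * inn t w + _ = V w); last by rewrite h addrC.
    by rewrite [in RHS]indicE.
  rewrite (ge0_integral_joint (nu := nu) mA (mY t01) (market_minn t01) _ mf f0).
    by apply: eq_integral => w _; rewrite fineK.
  move=> D' E mD' mE; rewrite setIA; apply: innov_market => //.
  rewrite -(sigma_algebra_id (market_sigma_algebra t)); apply: g_sigmaI.
    exact: sub_sigma_algebra.
  by apply: sub_sigma_algebra; exact: market_demand.
Qed.

Lemma market_density t y (D : set R) : t \in `[0, 1] -> measurable D ->
  (normal_prob (lam * y + mu) (Num.sqrt (gamma ^+ 2 * (1 - t * L ^+ 2))) D =
   \int[prior M]_(v in D) (rho_star kappa gamma lam mu t y v)%:E)%E.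
Proof.
move=> t01 mD.
have mrho : measurable_fun [set: R] (rho_star kappa gamma lam mu t y).
  apply: measurable_funM => //; apply: measurableT_comp => //.
  apply: measurable_funM => //; apply: measurable_funB.
    by apply: measurable_funM => //; apply: measurable_funX; apply: measurable_funB => //; exact: measurable_funB.
  by apply: measurable_funX; exact: measurable_funB.
pose f (v : R) : \bar R := (\1_D v * rho_star kappa gamma lam mu t y v)%:E.
have mf : measurable_fun setT f.
  by apply/measurable_EFinP; apply: measurable_funM => //; exact: measurable_indic.
have f0 v : (0 <= f v)%E.
  by rewrite lee_fin indicE !mulr_ge0 ?invr_ge0 ?sqrtr_ge0 ?expR_ge0.
(* The identity transports the prior to the copy [measurableTypeR R], where it can be compared with
   [normal_prob]. *)
have mid : measurable_fun [set: R] (fun v : R => v : measurableTypeR R).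
  by move=> _ A mA; rewrite setTI.
have -> : (\int[prior M]_(v in D) (rho_star kappa gamma lam mu t y v)%:E =
    \int[normal_prob mu gamma]_v f v)%E.
  rewrite integral_mkcond; transitivity (\int[prior M]_v f v)%E.
    apply: eq_integral => v _; rewrite patchE /f indicE.
    by case: ifPn => _; rewrite ?mul1r ?mul0r.
  transitivity (\int[law (prior M) mid]_v f v)%E.
    by rewrite ge0_integral_pushforward.
  by apply: eq_measure_integral => A mA _; exact: value_normal.
rewrite (integral_normal_prob mu gamma mf f0).
rewrite /normal_prob integral_mkcond; apply: eq_integral => v _.
rewrite patchE /f indicE -EFinM; case: ifPn => _; rewrite ?mul1r ?mul0r//.
have st := sqrt_resid t01; have stn0 := lt0r_neq0 st.
have an0 : a t != 0 by move: t01; rewrite in_itv/= => /andP[_ t1]; exact: resid_neq0.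
rewrite -(sqrt_var t01) (normal_pdf_shift (lam * y + mu)) ?mulr_gt0//.
rewrite (normal_pdf_shift mu)// !normal_pdf0E// ?mulr_gt0//.
have pn0 : Num.sqrt (pi *+ 2) != 0 :> R.
  by rewrite lt0r_neq0// sqrtr_gt0 mulrn_wgt0// pi_gt0.
have gn0 := lt0r_neq0 gamma_gt0.
rewrite exprMn sqr_sqrtr; last first.
  by move: t01; rewrite in_itv/= => /andP[_ t1]; rewrite ltW// resid_gt0.
rewrite /rho_star -/(resid L t).
rewrite [X in _ = X%:E](_ : _ = (gamma * Num.sqrt (a t) * Num.sqrt (pi *+ 2))^-1 *
  (expR (- (1 / (2 * gamma ^+ 2)) * ((v - lam * y - mu) ^+ 2 / a t - (v - mu) ^+ 2)) *
   expR (- ((v - mu) ^+ 2 / (gamma ^+ 2 * 2))))); last first.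
  by field; rewrite pn0 stn0 gn0.
by rewrite -expRD; congr (_ * expR _)%:E; field; rewrite an0 gn0 lt0r_neq0.
Qed.

End filtering_consequences.

(** * The integral of the noise against the price *)

Section ito_uniqueness.
Context (R : realType) d (T : measurableType d) (P : probability T R).
Variables (X S : R -> T -> R).
Hypotheses (mX : forall t, t \in `[0, 1] -> measurable_fun setT (X t))
  (mS : forall t, t \in `[0, 1] -> measurable_fun setT (S t)).

Definition ito_sum (n : nat) (t : nat -> R) w :=
  \sum_(0 <= i < n) X (t i) w * (S (t i.+1) w - S (t i) w).

Lemma measurable_ito_sum n t : (forall i, (i <= n)%N -> t i \in `[0, 1]) ->
  measurable_fun setT (ito_sum n t).
Proof.
rewrite /ito_sum; elim: n => [_|n IH tn].
  rewrite (_ : (fun w => _) = cst 0); first exact: measurable_cst.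
  by apply/funext => w; rewrite big_geq.
rewrite (_ : (fun w => _) = fun w => \sum_(0 <= i < n) X (t i) w * (S (t i.+1) w - S (t i) w)
    + X (t n) w * (S (t n.+1) w - S (t n) w)); last first.
  by apply/funext => w; rewrite big_nat_recr.
apply: measurable_funD; first by apply: IH => i ni; apply: tn; exact: leqW.
have tnn : t n \in `[0, 1] by exact: tn.
have tn1 : t n.+1 \in `[0, 1] by exact: tn.
by apply: measurable_funM; [exact: mX|apply: measurable_funB; exact: mS].
Qed.

Lemma measurable_deviation (f g : T -> R) e : measurable_fun setT f -> measurable_fun setT g ->
  measurable [set w | e <= `|f w - g w|].
Proof.
move=> mf mg; have mn : measurable_fun setT (fun w => `|f w - g w|).
  by apply: measurableT_comp => //; exact: measurable_funB.
rewrite (_ : [set w | _] = (fun w => `|f w - g w|) @^-1` `[e, +oo[%classic).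
  exact: measurable_preimage.
by apply/seteqP; split => w /=; rewrite in_itv/= andbT.
Qed.

(** Limits in probability are unique: a uniform partition fine enough for both integrals puts both
    within 1 / (k + 1) of one sum, outside an event of small probability. *)
Lemma ito_unique I I' : is_ito_integral P X S I -> is_ito_integral P X S I' ->
  {ae P, forall w, I w = I' w}.
Proof.
move=> [mI HI] [mI' HI'].
have null k : P.-negligible [set w | 2 * k.+1%:R^-1 <= `|I w - I' w|].
  have k0 : 0 < k.+1%:R^-1 :> R by rewrite invr_gt0.
  exists [set w | 2 * k.+1%:R^-1 <= `|I w - I' w|]; split => //.
    exact: measurable_deviation.
  apply/eqP; rewrite eq_le measure_ge0 andbT; apply/lee_addgt0Pr => eta eta0.
  rewrite add0e; have e20 : 0 < eta / 2 by rewrite divr_gt0.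
  have [d1 d10 H1] := HI _ _ k0 e20; have [d2 d20 H2] := HI' _ _ k0 e20.
  have d0 : 0 < Num.min d1 d2 by rewrite lt_min d10.
  have [n] := ltr_add_invr d0; rewrite add0r lt_min => /andP[nd1 nd2].
  pose t i : R := i%:R / n.+1%:R.
  have t0 : t 0%N = 0 by rewrite /t mul0r.
  have t1 : t n.+1 = 1 by rewrite /t divff.
  have tS i : t i.+1 = t i + n.+1%:R^-1 by rewrite /t -addn1 natrD mulrDl mul1r.
  have n0 : 0 < n.+1%:R^-1 :> R by rewrite invr_gt0.
  have part dl : n.+1%:R^-1 < dl -> forall i, (i < n.+1)%N -> t i <= t i.+1 < t i + dl.
    by move=> ndl i _; rewrite tS lerDl ltW//= ltrD2l.
  have {H1} H1 := H1 n.+1 t t0 t1 (part _ nd1).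
  have {H2} H2 := H2 n.+1 t t0 t1 (part _ nd2).
  have ms : measurable_fun setT (ito_sum n.+1 t).
    apply: measurable_ito_sum => i ni; rewrite in_itv/= /t divr_ge0//=.
    by rewrite ler_pdivrMr// mul1r ler_nat.
  have mU := measurable_deviation k.+1%:R^-1 ms mI.
  have mU' := measurable_deviation k.+1%:R^-1 ms mI'.
  apply: (@le_trans _ _ (P ([set w | k.+1%:R^-1 <= `|ito_sum n.+1 t w - I w|] `|`
     [set w | k.+1%:R^-1 <= `|ito_sum n.+1 t w - I' w|]))).
    rewrite le_measure ?inE//; [exact: measurable_deviation|exact: measurableU|].
    move=> w /=; case: (leP _ `|ito_sum n.+1 t w - I w|) => h1; first by left.
    case: (leP _ `|ito_sum n.+1 t w - I' w|) => h2; first by right.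
    move: h1 h2; move: (ito_sum n.+1 t w) k.+1%:R^-1 => s e h1 h2 h.
    have : `|I w - I' w| <= `|s - I w| + `|s - I' w|.
      rewrite (_ : I w - I' w = - (s - I w) + (s - I' w)); last by ring.
      by rewrite (le_trans (ler_normD _ _))// normrN.
    by move: h1 h2 h; lra.
  apply: le_trans (measureU2 _ mU mU') _.
  by rewrite (_ : eta = eta / 2 + eta / 2); [rewrite EFinD; exact: leeD|field].
apply: negligibleS (negligible_bigcup null) => w /= Iw.
have : 0 < `|I w - I' w| / 2 by rewrite divr_gt0// normr_gt0 subr_eq0; apply/eqP.
move=> /ltr_add_invr[k]; rewrite add0r => hk; exists k => //=.
by rewrite mulrC -ler_pdivlMr// ltW.
Qed.

End ito_uniqueness.

(** * Riemann sums along a partition *)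

Section partitions.
Context (R : realType).
Notation mu := (@lebesgue_measure R).
Variables (n : nat) (t : nat -> R) (delta : R).
Hypotheses (t0 : t 0%N = 0) (tn : t n = 1).
Hypothesis tS : forall i, (i < n)%N -> t i <= t i.+1 < t i + delta.

Lemma partition_le i j : (i <= j)%N -> (j <= n)%N -> t i <= t j.
Proof.
elim: j => [|j IH]; first by rewrite leqn0 => /eqP ->.
rewrite leq_eqVlt => /predU1P[-> //|]; rewrite ltnS => ij jn.
by apply: le_trans (IH ij (ltnW jn)) _; have /andP[] := tS jn.
Qed.

Lemma partition01 i : (i <= n)%N -> t i \in `[0, 1].
Proof. by move=> ni; rewrite in_itv/= -{1}t0 -tn !partition_le. Qed.

(** The real indicator of a closed left ray; differences of two of them are the indicators of the
    half-open cells, and products with them reduce to integrals from 0. *)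
Definition below (u s : R) : R := (s <= u)%R%:R.

Let cell i s := below (t i.+1) s - below (t i) s.

(* The integrand [b (left end of the cell of s) - b s]. *)
Definition lag (b : R -> R) k s := \sum_(0 <= i < k) cell i s * (b (t i) - b s).

(** The point [u] is the left end of the cell of [s]. It is chosen before the path [b], hence is the
    same in all scenarios, and [lag] at time s is then minus a Brownian increment over a
    deterministic interval. *)
Lemma lagE s : s \in `[0, 1] -> exists u, [/\ 0 <= u, u <= s, s - u <= delta &
  forall b : R -> R, lag b n s = b u - b s].
Proof.
rewrite in_itv/= => /andP[]; rewrite le_eqVlt => /predU1P[<- _|s0 s1].
  (* Time 0 lies in no half-open cell, so the lag vanishes there; nonnegativity of [delta] is read
     off the first step of the partition. *)
  exists 0; split=> //.
    rewrite subrr leNgt; apply/negP => dl.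
    have : (0 < n)%N by rewrite lt0n; apply/eqP => n0; move: tn; rewrite n0 t0 => /eqP; rewrite eq_sym oner_eq0.
    by move=> /tS/andP[h1 h2]; lra.
  move=> b; rewrite subrr /lag big_nat_cond big1// => i /andP[/= ni _].
  have h j : (j <= n)%N -> below (t j) 0 = 1.
    by move=> jn; have := partition01 jn; rewrite in_itv/= /below => /andP[->].
  by rewrite /cell !h// ?subrr ?mul0r// ltnW.
suff H k : (k <= n)%N -> (t k < s -> forall b, lag b k s = 0) /\
    (s <= t k -> exists u, [/\ 0 <= u, u <= s, s - u <= delta &
      forall b : R -> R, lag b k s = b u - b s]).
  by have [_] := H n (leqnn n); rewrite tn; exact.
elim: k => [_|k IH kn].
  by split=> [_ b|]; [rewrite /lag big_geq|rewrite t0 leNgt s0].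
have [IH1 IH2] := IH (ltnW kn); have /andP[tk1 tk2] := tS kn.
have lagS b : lag b k.+1 s = lag b k s + cell k s * (b (t k) - b s).
  by rewrite /lag big_nat_recr.
split=> [ts b|st].
  rewrite lagS IH1 ?(le_lt_trans tk1)// add0r /cell /below.
  by rewrite !leNgt ts (le_lt_trans tk1 ts) subrr mul0r.
have [tks|stk] := ltP (t k) s.
  exists (t k); split.
  - by have := partition01 (ltnW kn); rewrite in_itv/= => /andP[].
  - exact: ltW.
  - by lra.
  - by move=> b; rewrite lagS IH1// add0r /cell /below st leNgt tks subr0 mul1r.
have [u [u0 us sud uE]] := IH2 stk; exists u; split => // b.
by rewrite lagS uE /cell /below st stk subrr mul0r addr0.
Qed.

Lemma integral_below (h : R -> R) u : u \in `[0, 1] ->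
  mu.-integrable `[0, 1] (EFin \o h) ->
  mu.-integrable `[0, 1] (EFin \o (fun s => below u s * h s)) /\
  \int[mu]_(s in `[0, 1]) (below u s * h s) = \int[mu]_(s in `[0, u]) h s.
Proof.
rewrite in_itv/= => /andP[u0 u1] ih; split.
  apply: (le_integrable _ _ _ ih) => //.
    apply/measurable_EFinP; apply: measurable_funM.
      rewrite (_ : below u = \1_(`]-oo, u]%classic)); last first.
        by apply/funext => s; rewrite /below indicE mem_setE in_itv.
      exact: measurable_indic.
    by have /integrableP[/measurable_EFinP] := ih.
  move=> s _ /=; rewrite lee_fin normrM /below; case: (s <= u).
    by rewrite normr1 mul1r.
  by rewrite normr0 mul0r.
rewrite /Rintegral; congr fine; rewrite integral_mkcond [RHS]integral_mkcond.
apply: eq_integral => s _; rewrite !patchE /below.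
case: ifPn; rewrite ?inE/= ?notin_setE/= in_itv/=.
  move=> /andP[s0 s1]; case: ifPn; rewrite ?inE/= ?notin_setE/= in_itv/= s0/=.
    by move=> ->; rewrite mul1r.
  by move=> /negP/negPf ->; rewrite mul0r.
move=> h1; case: ifPn => //; rewrite inE/= in_itv/= => /andP[s0 su].
by exfalso; apply: h1; rewrite s0 (le_trans su).
Qed.

(** Writes the error of the left-endpoint sum of [b] against the drift [th] as an integral of the
    lag against the density, ready for a quadratic estimate. *)
Lemma integral_lag (b al th : R -> R) : {within `[0, 1], continuous b} ->
  {within `[0, 1], continuous al} -> primitive_from 0 al th ->
  forall k, (k <= n)%N ->
  mu.-integrable `[0, 1] (EFin \o (fun s => lag b k s * al s)) /\
  \int[mu]_(s in `[0, 1]) (lag b k s * al s) =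
  \sum_(0 <= i < k) b (t i) * (th (t i.+1) - th (t i)) -
  \int[mu]_(s in `[0, t k]) (b s * al s).
Proof.
move=> cb ca [ia pth].
have m01 : measurable (`[0, 1]%classic : set (measurableTypeR R)) by exact: measurable_itv.
have iba : mu.-integrable `[0, 1] (EFin \o (fun s => b s * al s)).
  by apply: integrable_continuous01 => x; apply: cvgM; [exact: cb|exact: ca].
elim=> [_|k IH kn].
  have E : (fun s => lag b 0 s * al s) = cst 0.
    by apply/funext => s; rewrite /lag big_geq// mul0r.
  rewrite E big_geq// t0 set_itv1 {2}/Rintegral integral_set1/= subr0; split.
    exact: integrable0.
  by rewrite Rintegral_cst// mul0r.
have [IH1 IH2] := IH (ltnW kn).
have p0 := partition01 (ltnW kn); have p1 := partition01 kn.
have i1 := integrable_EFinB m01 (integrable_EFinZ m01 (b (t k)) ia) iba.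
have [j1 E1] := integral_below p1 i1; have [j0 E0] := integral_below p0 i1.
have jB := integrable_EFinB m01 j1 j0.
have E : (fun s => lag b k.+1 s * al s) = (fun s => lag b k s * al s +
    (below (t k.+1) s * (b (t k) * al s - b s * al s) -
     below (t k) s * (b (t k) * al s - b s * al s))).
  by apply/funext => s; rewrite /lag big_nat_recr//= -/(lag b k s) /cell; ring.
rewrite E; split; first exact: integrable_EFinD.
rewrite (RintegralD m01 IH1 jB) (RintegralB m01 j1 j0) IH2 E1 E0 big_nat_recr//=.
have int u : u \in `[0, 1] -> \int[mu]_(s in `[0, u]) (b (t k) * al s - b s * al s) =
    b (t k) * th u - \int[mu]_(s in `[0, u]) (b s * al s).
  move=> u01; have mu0 : measurable (`[0, u]%classic : set (measurableTypeR R)) by exact: measurable_itv.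
  have ia' := integrable_sub01 u01 ia; have iba' := integrable_sub01 u01 iba.
  rewrite (RintegralB mu0 (integrable_EFinZ mu0 (b (t k)) ia') iba').
  by rewrite (RintegralZl _ mu0 ia') (pth u u01) add0r.
by rewrite !int//; ring.
Qed.

(** Discrete Ito formula for b^2, with the sum of squared increments split into elapsed time and the
    excess over it. *)
Lemma sum_quadratic (b : R -> R) k : b 0 = 0 ->
  \sum_(0 <= i < k) b (t i) * (b (t i.+1) - b (t i)) =
  (b (t k) ^+ 2 - \sum_(0 <= i < k) ((b (t i.+1) - b (t i)) ^+ 2 - (t i.+1 - t i)) - t k) / 2.
Proof.
move=> b0; elim: k => [|k IH]; first by rewrite !big_geq// t0 b0; field.
by rewrite !big_nat_recr//= IH; field.
Qed.

Section quadratic_variation.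
Context d (T : measurableType d) (Q : probability T R).
Variables (B : R -> T -> R) (V : T -> R).
Hypotheses (HB : is_brownian Q B) (mV : measurable_fun setT V).
Hypothesis VB : forall A, <<s history B 1>> A -> forall D, measurable D ->
  Q (A `&` V @^-1` D) = (Q A * Q (V @^-1` D))%E.
Notation unit_box := (`[(0 : R), 1]%classic `*` [set: T]).

Definition variation_excess k w :=
  \sum_(0 <= i < k) (increment B (t i) (t i.+1) w ^+ 2 - (t i.+1 - t i)).

Lemma variation_excess_history k : (k <= n)%N ->
  measurable_fun [set: g_sigma_algebraType (full_history B V (t k))]
    (variation_excess k : g_sigma_algebraType _ -> R).
Proof.
rewrite /variation_excess; elim: k => [_|k IH kn].
  rewrite (_ : (fun w => _) = cst 0); first exact: measurable_cst.
  by apply/funext => w; rewrite big_geq.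
have := partition01 (ltnW kn); rewrite in_itv/= => /andP[k0 k1].
have /andP[tk _] := tS kn.
rewrite (_ : (fun w => _) = fun w => variation_excess k w +
    (increment B (t k) (t k.+1) w ^+ 2 - (t k.+1 - t k))); last first.
  by apply/funext => w; rewrite big_nat_recr.
apply: measurable_funD.
  apply: measurable_fun_sub_sigma (IH (ltnW kn)).
  exact: full_history_le.
apply: measurable_funB => //; apply: measurable_funX.
apply: measurable_funB; apply: full_history_B => //.
exact: le_trans tk.
Qed.

Let measurable_excess k : (k <= n)%N -> measurable_fun setT (variation_excess k).
Proof.
move=> kn; have := partition01 kn; rewrite in_itv/= => /andP[_ k1].
exact: (measurable_full_history HB mV k1 (variation_excess_history kn)).
Qed.

(** The new term is centred and independent of the past sum, so the cross term vanishes. By the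
    fourth moment its variance is 2 D^2 for a step of length D, which is at most 2 [delta] D and
    sums up. *)
Lemma variation_excess_moment2 k : (k <= n)%N ->
  (\int[Q]_w (variation_excess k w ^+ 2)%:E <= (2 * delta * t k)%:E)%E.
Proof.
elim: k => [_|k IH kn].
  rewrite t0 mulr0 (eq_integral (cst 0%E)) ?integral0// => w _.
  by rewrite /variation_excess big_geq// expr0n.
have kn' := ltnW kn; have IHk := IH kn'.
have := partition01 kn'; rewrite in_itv/= => /andP[k0 k1].
have := partition01 kn; rewrite in_itv/= => /andP[_ k11].
have /andP[tk dk] := tS kn.
have SS w : variation_excess k.+1 w = variation_excess k w +
    (increment B (t k) (t k.+1) w ^+ 2 - (t k.+1 - t k)).
  by rewrite /variation_excess big_nat_recr.
pose xi w := increment B (t k) (t k.+1) w ^+ 2 - (t k.+1 - t k).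
(* Partition points may repeat; an empty step contributes nothing, and the Gaussian law below needs
   a positive variance. *)
move: tk; rewrite le_eqVlt => /predU1P[tkE|tk].
  rewrite -tkE; under eq_integral do rewrite SS /increment -tkE !subrr expr0n subrr addr0.
  exact: IHk.
have mS := measurable_excess kn'.
have minc : measurable_fun setT (increment B (t k) (t k.+1)).
  exact: (measurable_increment HB k0 (ltW tk) k11).
have m2 := increment_moment2 HB mV VB k0 (ltW tk) k11.
have m4 := increment_moment4 HB mV VB k0 (ltW tk) k11.
have i2 : Q.-integrable setT (EFin \o (fun w => increment B (t k) (t k.+1) w ^+ 2)).
  apply: integrable_ge0 => //; [exact: measurable_funX|by move=> w; exact: sqr_ge0|].
  by rewrite m2 ltry.
have i4 : Q.-integrable setT (EFin \o (fun w => increment B (t k) (t k.+1) w ^+ 4)).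
  apply: integrable_ge0 => //; [exact: measurable_funX| |by rewrite m4 ltry].
  by move=> w; rewrite (exprM _ 2 2) sqr_ge0.
have ic (r : R) : Q.-integrable setT (EFin \o cst r) by exact: finite_measure_integrable_cst.
have Ec (r : R) : (\int[Q]_w (cst r w)%:E = r%:E)%E.
  transitivity (r%:E * 1)%E; last exact: mule1.
  by rewrite -(probability_setT Q); exact: (integral_cst Q measurableT r%:E).
pose D := t k.+1 - t k.
have xi2E : (\int[Q]_w (xi w ^+ 2)%:E = (2 * D ^+ 2)%:E)%E.
  have E w : xi w ^+ 2 = increment B (t k) (t k.+1) w ^+ 4 +
     (- (2 * D)) * increment B (t k) (t k.+1) w ^+ 2 + cst (D ^+ 2) w.
    by rewrite /xi /D /=; ring.
  under eq_integral do rewrite E.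
  have iz := integrable_EFinZ measurableT (- (2 * D)) i2.
  rewrite (integral_EFinD measurableT (integrable_EFinD measurableT i4 iz) (ic _)).
  rewrite (integral_EFinD measurableT i4 iz) (integral_EFinZ measurableT _ i2) m2 m4 Ec.
  by rewrite -EFinM -!EFinD; congr (_%:E); rewrite /D; ring.
have mxi : measurable_fun setT xi by apply: measurable_funB => //; exact: measurable_funX.
have S2 : (\int[Q]_w (variation_excess k w ^+ 2)%:E < +oo)%E.
  by apply: le_lt_trans IHk _; rewrite ltry.
have iS2 : Q.-integrable setT (EFin \o (fun w => variation_excess k w ^+ 2)).
  by apply: integrable_ge0 => //; [exact: measurable_funX|move=> w; exact: sqr_ge0].
have ix2 : Q.-integrable setT (EFin \o (fun w => xi w ^+ 2)).
  by apply: integrable_ge0 => //; [exact: measurable_funX|move=> w; exact: sqr_ge0|rewrite xi2E ltry].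
have iS : Q.-integrable setT (EFin \o variation_excess k).
  by apply: (integrable_sqr (m := Q)) => //; exact: fin_num_fun_lty.
have sD : 0 < Num.sqrt D by rewrite sqrtr_gt0 subr_gt0.
pose nu : probability _ R := normal_prob 0 (Num.sqrt D).
pose gx (x : R) : R := x ^+ 2 - D.
have ind E F : measurable E -> measurable F ->
    (Q (variation_excess k @^-1` E `&` increment B (t k) (t k.+1) @^-1` F) =
     Q (variation_excess k @^-1` E) * nu F)%E.
  move=> mE mF; apply: (increment_indep HB mV VB) => //.
  exact: (g_sigma_measurable_fun (variation_excess_history kn') mE).
have mg : measurable_fun [set: R] gx by apply: measurable_funB => //; exact: measurable_funX.
have in2 : nu.-integrable setT (EFin \o (fun x : R => x ^+ 2)).
  apply: (integrable_ge0 (m := nu)) => //.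
  - by move=> x; exact: sqr_ge0.
  - by rewrite normal_moment2// ltry.
have inc : nu.-integrable setT (EFin \o cst D) by exact: finite_measure_integrable_cst.
have ig : nu.-integrable setT (EFin \o gx) by exact: (integrable_EFinB measurableT in2 inc).
have g0 : (\int[nu]_x (gx x)%:E = 0)%E.
  have := integral_EFinB measurableT in2 inc; rewrite normal_moment2// => ->.
  rewrite (_ : (\int[nu]_x (cst D x)%:E = D%:E)%E); last first.
    transitivity (D%:E * 1)%E; last exact: mule1.
    by rewrite -(probability_setT nu); exact: (integral_cst nu measurableT D%:E).
  by rewrite sqr_sqrtr ?subee// subr_ge0 ltW.
have [iSx ESx] := integral_indep_mul (nu := nu) (X := variation_excess k)
  (Y := increment B (t k) (t k.+1)) (g := gx) mS minc mg ind iS ig g0.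
have {}iSx : Q.-integrable setT (EFin \o (fun w => variation_excess k w * xi w)) := iSx.
have E w : variation_excess k.+1 w ^+ 2 = variation_excess k w ^+ 2 +
    2 * (variation_excess k w * xi w) + xi w ^+ 2.
  by rewrite SS -/(xi w); ring.
under eq_integral do rewrite E.
have iz := integrable_EFinZ measurableT 2 iSx.
rewrite (integral_EFinD measurableT (integrable_EFinD measurableT iS2 iz) ix2).
rewrite (integral_EFinD measurableT iS2 iz) (integral_EFinZ measurableT 2 iSx).
rewrite (_ : (\int[Q]_w (variation_excess k w * xi w)%:E = 0)%E) ?mule0 ?adde0//.
rewrite xi2E (_ : 2 * delta * t k.+1 = 2 * delta * t k + 2 * delta * D).
  rewrite EFinD leeD// lee_fin -mulrA ler_pM2l// expr2 ler_wpM2r//.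
    by rewrite subr_ge0 ltW.
  by rewrite /D; lra.
by rewrite /D; ring.
Qed.

Lemma measurable_process_lag k : (k <= n)%N ->
  measurable_fun unit_box (fun p => lag (bpath B ^~ p.2) k p.1).
Proof.
rewrite /lag; elim: k => [_|k IH kn].
  rewrite (_ : (fun p => _) = cst 0); first exact: measurable_cst.
  by apply/funext => p; rewrite big_geq.
rewrite (_ : (fun p => _) = fun p => lag (bpath B ^~ p.2) k p.1 +
    (below (t k.+1) p.1 - below (t k) p.1) * (bpath B (t k) p.2 - bpath B p.1 p.2)); last first.
  by apply/funext => p; rewrite /lag big_nat_recr.
apply: measurable_funD; first exact: IH (ltnW kn).
have mbelow u : measurable_fun unit_box (fun p : R * T => below u p.1).
  apply: measurable_funTS; apply: (measurableT_comp (f := below u)) => //.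
  rewrite (_ : below u = \1_(`]-oo, u]%classic)); last first.
    by apply/funext => s; rewrite /below indicE mem_setE in_itv.
  exact: measurable_indic.
apply: measurable_funM; first exact: measurable_funB.
apply: measurable_funB; last exact: (measurable_process_bpath HB).
apply: measurable_funTS; apply: (measurableT_comp (f := bpath B (t k))) => //.
by apply: (measurable_bpath HB); exact: partition01 (ltnW kn).
Qed.

(** At each time the lag is a Brownian increment over at most [delta]. *)
Lemma lag_moment2 :
  (\int[Q]_w \int[mu]_(s in `[0%R, 1%R]) (lag (bpath B ^~ w) n s ^+ 2)%:E <= delta%:E)%E.
Proof.
have m2 : measurable_fun unit_box (fun p => (lag (bpath B ^~ p.2) n p.1 ^+ 2)%:E).
  by apply/measurable_EFinP; apply: measurable_funX; exact: measurable_process_lag.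
have p2 s w : (0 <= (lag (bpath B ^~ w) n s ^+ 2)%:E)%E by rewrite lee_fin sqr_ge0.
rewrite (tonelli_process Q (f := fun s w => (lag (bpath B ^~ w) n s ^+ 2)%:E) m2 p2).
apply: (@le_trans _ _ (\int[mu]_(s in `[0%R, 1%R]) delta%:E)%E); last first.
  by rewrite integral_cst//= lebesgue_measure_itv/= lte_fin ltr01 -EFinB subr0 mule1.
have s00 : (0 : R) \in `[0, 1] by rewrite in_itv/= lexx ler01.
have d0 : 0 <= delta.
  by have [u [u0 us]] := lagE s00; move: u0 us; move=> u0 us h _; lra.
rewrite integral_mkcond [leRHS]integral_mkcond; apply: ge0_ae_le_integral.
- by move=> s; rewrite patchE; case: ifPn => // _; exact: integral_ge0.
- by move=> s; rewrite patchE; case: ifPn => // _; rewrite lee_fin.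
- apply: aeW => s; rewrite !patchE; case: ifPn => //; rewrite inE => s01.
  have [u [u0 us sud uE]] := lagE s01.
  move: s01; rewrite /= in_itv/= => /andP[_ s1].
  rewrite (eq_integral (fun w => (increment B u s w ^+ 2)%:E)).
    by rewrite (increment_moment2 HB mV VB)// lee_fin.
  by move=> w _; rewrite uE -bpathB -sqrrN opprB.
Qed.

End quadratic_variation.
End partitions.

(** * The stochastic integral and the noise traders' loss *)

Section noise_traders.
Context (R : realType) (d : measure_display) (Omega : measurableType d).
Variables (M : kyle_model R Omega) (sigma mu gamma kappa : R).
Hypotheses (sigma_gt0 : 0 < sigma) (gamma_gt0 : 0 < gamma) (kappa_gt0 : 0 < kappa).
Hypothesis value_normal : forall D : set R, measurable D ->
  prior M D = normal_prob mu gamma D.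
Variable theta : R -> Omega -> R.
Hypothesis theta_solves : solves_theta_star M kappa gamma sigma mu theta.
Notation leb := (@lebesgue_measure R).
Notation B := (noise M).
Notation V := (value M).
Notation L := (Lambda kappa).
Notation lam := (L * (gamma / sigma)).
Notation H := (price_star lam mu).
Notation Q := (joint_law M).
Notation Y := (demand M sigma theta).
Notation sig := (signal B V L mu gamma).
Notation beta := (bpath B).
Notation rate0 := (explicit_rate M sigma mu gamma kappa).
Notation position0 := (explicit_position M sigma mu gamma kappa).
Notation unit_box := (`[(0 : R), 1]%classic `*` [set: Omega]).
Notation dint F := (\int[joint_law M]_w \int[leb]_(s in `[0%R, 1%R]) F s w)%E.

Let L0 : 0 < L := Lambda_gt0 kappa.
Let L1 : L < 1 := Lambda_lt1 kappa_gt0.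
Let HB := kyle_brownian M.
Let mV : measurable_fun setT V := measurable_value M.
Let VB := kyle_independence (k := M).
Let lam0 : 0 < lam.
Proof. by rewrite mulr_gt0// divr_gt0. Qed.

Let m01 : measurable (`[0%R, 1%R]%classic : set (measurableTypeR R)).
Proof. exact: measurable_itv. Qed.

Lemma joint_zscore2 : (\int[Q]_w (zscore V mu gamma w ^+ 2)%:E < +oo)%E.
Proof.
have mz : measurable_fun setT (zscore V mu gamma).
  by apply: measurable_funM => //; exact: measurable_funB.
rewrite (ge0_integral_indep (nu := normal_prob 0 1) (f := fun x : R => (x ^+ 2)%:E) measurableT mz)//.
- rewrite (normal_moment2 ltr01) probability_setT mul1e ltry//.
- move=> D mD; rewrite setTI probability_setT mul1e.
  exact: (zscore_law gamma_gt0 value_normal).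
- by apply/measurable_EFinP; exact: measurable_funX.
- by move=> x; rewrite lee_fin sqr_ge0.
Qed.

Let square_rate : square_process Q rate0.
Proof. exact: (square_explicit_rate sigma kappa_gt0 HB VB joint_zscore2). Qed.

Let rate_continuous w : {within `[0, 1], continuous (rate0^~ w)}.
Proof.
move=> x; apply: cvgM; first exact: cvg_cst.
apply: cvgM; first exact: (innov_continuous HB L0 L1).
by apply: continuous_residV => // s /=; rewrite in_itv/= => /andP[].
Qed.

Let beta_continuous w : {within `[0, 1], continuous (beta^~ w)}.
Proof. exact: (bpath_continuous HB). Qed.

Let integrable_beta_rate w : leb.-integrable `[0, 1] (EFin \o (fun s => beta s w * rate0 s w)).
Proof.
by apply: integrable_continuous01 => x; apply: cvgM; [exact: beta_continuous|exact: rate_continuous].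
Qed.

Definition noise_integral w :=
  lam * \int[leb]_(s in `[0, 1]) (beta s w * rate0 s w) +
  lam * sigma * ((beta 1 w ^+ 2 - 1) / 2).

Let mbeta t : t \in `[0, 1] -> measurable_fun setT (beta t).
Proof. exact: (measurable_bpath HB). Qed.

Let t11 : (1 : R) \in `[0, 1]. Proof. by rewrite in_itv/= lexx ler01. Qed.

Lemma measurable_noise_integral : measurable_fun setT noise_integral.
Proof.
apply: measurable_funD; apply: measurable_funM => //.
  apply: measurable_Rintegral_process; apply: measurable_funM; last by have [] := square_rate.
  exact: (measurable_process_bpath HB).
by apply: measurable_funM => //; apply: measurable_funB => //; apply: measurable_funX; exact: mbeta.
Qed.

Let measurable_price t : t \in `[0, 1] -> measurable_fun setT (fun w => H t (Y t w)).
Proof.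
move=> t01; apply: measurable_funD => //; apply: measurable_funM => //.
exact: (measurable_demand theta_solves).
Qed.

Let measurable_noise t : t \in `[0, 1] -> measurable_fun setT (B t).
Proof. exact: (measurable_B HB). Qed.

(** The price is affine in the demand, so the error of a Riemann sum splits into a lag term from the
    drift and the excess variation from the noise. *)
Let deviation_path n t delta w : t 0%N = 0 -> t n = 1 ->
  (forall i, (i < n)%N -> t i <= t i.+1 < t i + delta) ->
  (forall i, (i <= n)%N -> Y (t i) w = sigma * sig (t i) w) ->
  (forall s, beta s w = B s w) ->
  ito_sum B (fun t w => H t (Y t w)) n t w - noise_integral w =
  lam * (\int[leb]_(s in `[0, 1]) (lag t (beta^~ w) n s * rate0 s w)) -
  lam * sigma / 2 * variation_excess t B n w.
Proof.
move=> t0 tn tS Yw Bw.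
have b0 : beta 0 w = 0 by exact: bpath0.
have [_ ->] := integral_lag t0 tn tS (beta_continuous (w := w)) (rate_continuous (w := w))
  (explicit_primitive M sigma mu gamma kappa_gt0 w) (leqnn n).
have QV := sum_quadratic t0 (b := beta^~ w) n b0.
have exE : variation_excess t B n w =
    \sum_(0 <= i < n) ((beta (t i.+1) w - beta (t i) w) ^+ 2 - (t i.+1 - t i)).
  by rewrite /variation_excess; apply: eq_bigr => i _; rewrite bpathB.
rewrite tn in QV; rewrite -exE in QV.
have -> : ito_sum B (fun t w => H t (Y t w)) n t w =
    lam * (\sum_(0 <= i < n) beta (t i) w * (position0 (t i.+1) w - position0 (t i) w)) +
    lam * sigma * (\sum_(0 <= i < n) beta (t i) w * (beta (t i.+1) w - beta (t i) w)).
  rewrite /ito_sum !mulr_sumr -big_split/=; apply: eq_big_nat => i /andP[_ ni].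
  rewrite /price_star !Yw ?(ltnW ni)// -Bw /explicit_position.
  by ring.
by rewrite QV tn /noise_integral /=; move: (L * (gamma / sigma)) => l; field.
Qed.

(** Both error terms are bounded by x y <= (x^2 / r + r y^2) / 2, with y = 1 for the excess
    variation. For mesh r^2 the second moments are of order r^2, so the expected error is of order
    r, and Markov's inequality concludes. *)
Lemma noise_ito_integral : is_ito_integral Q B (fun t w => H t (Y t w)) noise_integral.
Proof.
split=> [|eps eta eps0 eta0]; first exact: measurable_noise_integral.
have [mrate rate2] := square_rate.
pose K := fine (dint (fun s w => (rate0 s w ^+ 2)%:E)).
have dge0 : (0 <= dint (fun s w => (rate0 s w ^+ 2)%:E))%E.
  by apply: integral_ge0 => w _; apply: integral_ge0 => s _; rewrite lee_fin sqr_ge0.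
have K0 : 0 <= K by exact: fine_ge0.
have KE : dint (fun s w => (rate0 s w ^+ 2)%:E) = K%:E.
  by rewrite fineK// ge0_fin_numE.
(* The expected error is at most r C: the lag contributes r + r K, and the excess variation 2 r +
   r. *)
pose C := lam / 2 * (1 + K) + lam * sigma / 4 * 3.
have C0 : 0 < C.
  apply: ltr_wpDl; first by apply: mulr_ge0; [exact: divr_ge0 (ltW lam0) _|exact: addr_ge0].
  by apply: mulr_gt0 => //; apply: divr_gt0 => //; exact: mulr_gt0.
pose r := eps * eta / C.
have r0 : 0 < r by rewrite divr_gt0// mulr_gt0.
exists (r ^+ 2); first by rewrite exprn_gt0.
move=> n t t0 tn tS.
have p01 i : (i <= n)%N -> t i \in `[0, 1] by exact: (partition01 t0 tn tS).
pose dev w := ito_sum B (fun t w => H t (Y t w)) n t w - noise_integral w.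
have mdev : measurable_fun setT dev.
  apply: measurable_funB; last exact: measurable_noise_integral.
  by apply: measurable_ito_sum.
pose G w := \int[leb]_(s in `[0, 1]) (lag t (beta^~ w) n s ^+ 2).
pose A w := \int[leb]_(s in `[0, 1]) (rate0 s w ^+ 2).
pose W w := variation_excess t B n w.
have iAw w : leb.-integrable `[0, 1] (EFin \o (fun s => rate0 s w ^+ 2)).
  by apply: integrable_continuous01 => x; apply: cvgM; exact: rate_continuous.
have mlag := measurable_process_lag t0 tn tS HB (leqnn n).
have lag_bound w s : s \in `[0, 1] -> exists2 u, u \in `[0, 1] &
    lag t (beta^~ w) n s = beta u w - beta s w.
  move=> s01; have [u [u0 us _ uE]] := lagE t0 tn tS s01; exists u; last exact: uE.
  by move: s01; rewrite !in_itv/= u0 => /andP[_]; exact: le_trans.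
(* The lag jumps at partition points; it is integrable because it is a difference of two values of a
   bounded path. *)
have iGw w : leb.-integrable `[0, 1] (EFin \o (fun s => lag t (beta^~ w) n s ^+ 2)).
  have /compact_bounded[N [_ HN]] := continuous_compact (beta_continuous (w := w)) (@segment_compact R 0 1).
  pose N1 := Num.max 1 (N + 1).
  have bN s : s \in `[0, 1] -> `|beta s w| <= N1.
    move=> s01; apply: HN; first by rewrite lt_max ltrDl ltr01 orbT.
    by exists s.
  apply: (le_integrable m01 (g := EFin \o cst ((2 * N1) ^+ 2))).
  - apply/measurable_EFinP; apply: measurable_funX.
    exact: (measurable_section (f := fun s w => lag t (beta^~ w) n s) w mlag).
  - move=> s s01 /=; have [u u01 ->] := lag_bound w s s01; rewrite lee_fin !normrX.
    rewrite lerXn2r ?nnegrE//; apply: le_trans (ler_normB _ _) _.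
    rewrite ger0_norm; last by rewrite mulr_ge0// le_max ler01.
    by have := bN u u01; have := bN s s01; lra.
  - by apply: integrable_continuous01 => x; exact: cvg_cst.
pose U w := lam / 2 * (G w / r + r * A w) + lam * sigma / 4 * (W w ^+ 2 / r + r).
have dev_bound : {ae Q, forall w, `|dev w| <= U w}.
  (* Each time has its own null set in [joint_demand], but only the countably many indexed times
     enter the sum. *)
  have Yae : {ae Q, forall w, forall i, (i <= n)%N -> Y (t i) w = sigma * sig (t i) w}.
    apply: ae_foralln => i; have [ni|ni] := leqP i n; last first.
      by apply: aeW => w.
    by apply: (ae_imp (joint_demand sigma_gt0 gamma_gt0 kappa_gt0 theta_solves (p01 i ni))).
  apply: (ae_imp2 Yae (bpath_ae HB)) => w Yw Bw.
  rewrite /dev (deviation_path t0 tn tS Yw Bw).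
  have scale (k x : R) : 0 <= k -> `|k * x| = k * `|x|.
    by move=> k0; rewrite normrM ger0_norm.
  have ls0 : 0 <= lam * sigma / 2 by apply: ltW; apply: divr_gt0 => //; exact: mulr_gt0.
  apply: le_trans (ler_normB _ _) _; rewrite (scale _ _ (ltW lam0)) (scale _ _ ls0) /U.
  apply: lerD.
    rewrite (_ : lam / 2 * _ = lam * (2^-1 * (G w / r + r * A w))); last exact: (esym (mulrA _ _ _)).
    apply: ler_wpM2l; first exact: ltW.
    have ilr : leb.-integrable `[0, 1] (EFin \o (fun s => lag t (beta^~ w) n s * rate0 s w)).
      by have [] := integral_lag t0 tn tS (beta_continuous (w := w)) (rate_continuous (w := w))
        (explicit_primitive M sigma mu gamma kappa_gt0 w) (leqnn n).
    apply: (le_trans (le_normr_Rintegral m01 ilr)).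
    have i1 := integrable_EFinZ m01 r^-1 (iGw w); have i2 := integrable_EFinZ m01 r (iAw w).
    have i3 := integrable_EFinZ m01 2^-1 (integrable_EFinD m01 i1 i2).
    apply: (@le_trans _ _ (\int[leb]_(s in `[0, 1])
        (2^-1 * (r^-1 * lag t (beta^~ w) n s ^+ 2 + r * rate0 s w ^+ 2)))).
      apply: le_Rintegral => //.
        have := integrable_abse ilr; apply: eq_integrable => // s _.
      move=> s _; rewrite normrM -(real_normK (num_real (lag _ _ _ _))).
      rewrite -(real_normK (num_real (rate0 s w))).
      move: `|lag _ _ _ _| `|rate0 s w| => x y.
      rewrite -subr_ge0 (_ : _ - _ = (x - r * y) ^+ 2 / (2 * r)).
        by rewrite divr_ge0 ?sqr_ge0// mulr_ge0// ltW.
      by field; rewrite lt0r_neq0.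
    rewrite (RintegralZl _ m01 (integrable_EFinD m01 i1 i2)) (RintegralD m01 i1 i2).
    by rewrite (RintegralZl _ m01 (iGw w)) (RintegralZl _ m01 (iAw w)) -/(G w) -/(A w) [r^-1 * _]mulrC.
  rewrite (_ : lam * sigma / 4 * _ = lam * sigma / 2 * ((W w ^+ 2 / r + r) / 2)); last first.
    by move: (L * (gamma / sigma)) (W w ^+ 2 / r + r) => l y; field.
  apply: ler_wpM2l => //; rewrite -/(W w) -(real_normK (num_real (W w))); move: `|W w| => x.
  rewrite -subr_ge0 (_ : _ - _ = (x - r) ^+ 2 / (2 * r)).
    by rewrite divr_ge0 ?sqr_ge0// mulr_ge0// ltW.
  by field; rewrite lt0r_neq0.
have lag2 := lag_moment2 t0 tn tS HB mV VB.
have exc2 := variation_excess_moment2 t0 tn tS HB mV VB (leqnn n).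
rewrite tn mulr1 in exc2.
have [iG EG] := integrable_double_integral (Q := Q) (f := fun s w => lag t (beta^~ w) n s ^+ 2)
  (measurable_funX 2 mlag) (fun _ _ _ => sqr_ge0 _) iGw (le_lt_trans lag2 (ltry _)).
have [iA EA] := integrable_double_integral (Q := Q) (f := fun s w => rate0 s w ^+ 2)
  (measurable_funX 2 mrate) (fun _ _ _ => sqr_ge0 _) iAw rate2.
have mW : measurable_fun setT W.
  have := @variation_excess_history _ n t _ t0 tn tS _ Omega B V n (leqnn n); rewrite tn.
  exact: (measurable_full_history HB mV (lexx 1)).
have iW : Q.-integrable setT (EFin \o (fun w => W w ^+ 2)).
  apply: integrable_ge0 => //; [exact: measurable_funX|by move=> w; exact: sqr_ge0|].
  exact: le_lt_trans exc2 (ltry _).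
have ic : Q.-integrable setT (EFin \o cst r) by exact: finite_measure_integrable_cst.
have Ec : (\int[Q]_w (cst r w)%:E = r%:E)%E.
  transitivity (r%:E * 1)%E; last exact: mule1.
  by rewrite -(probability_setT Q); exact: (integral_cst Q measurableT r%:E).
have UE w : U w = lam / (2 * r) * G w + lam * r / 2 * A w +
    lam * sigma / (4 * r) * W w ^+ 2 + lam * sigma / 4 * cst r w.
  by rewrite /U /=; move: lam => l; field; rewrite lt0r_neq0.
have j1 := integrable_EFinZ measurableT (lam / (2 * r)) iG.
have j2 := integrable_EFinZ measurableT (lam * r / 2) iA.
have j3 := integrable_EFinZ measurableT (lam * sigma / (4 * r)) iW.
have j4 := integrable_EFinZ measurableT (lam * sigma / 4) ic.
have k1 := integrable_EFinD measurableT j1 j2.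
have k2 := integrable_EFinD measurableT k1 j3.
have h1 : 0 <= lam / (2 * r) by apply: ltW; apply: divr_gt0 => //; exact: mulr_gt0.
have h2 : 0 <= lam * sigma / (4 * r) by apply: ltW; apply: divr_gt0; exact: mulr_gt0.
have EU : (\int[Q]_w (U w)%:E <= (eps * eta)%:E)%E.
  under eq_integral do rewrite UE.
  rewrite (integral_EFinD measurableT k2 j4) (integral_EFinD measurableT k1 j3).
  rewrite (integral_EFinD measurableT j1 j2).
  rewrite (integral_EFinZ measurableT _ iG) (integral_EFinZ measurableT _ iA).
  rewrite (integral_EFinZ measurableT _ iW) (integral_EFinZ measurableT _ ic) Ec EG EA KE.
  apply: (@le_trans _ _ ((lam / (2 * r))%:E * (r ^+ 2)%:E + (lam * r / 2)%:E * K%:E +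
     (lam * sigma / (4 * r))%:E * (2 * r ^+ 2)%:E + (lam * sigma / 4)%:E * r%:E)%E).
    apply: leeD; last exact: lexx.
    apply: leeD.
      apply: leeD; last exact: lexx.
      by apply: lee_wpmul2l => //; rewrite lee_fin.
    by apply: lee_wpmul2l => //; rewrite lee_fin.
  rewrite -!EFinM -!EFinD lee_fin (_ : _ + _ = r * C).
    by rewrite /r divfK// lt0r_neq0.
  by rewrite /C; move: lam => l; field; rewrite lt0r_neq0.
(* Markov's inequality for the deviation; [r] was chosen so that its expectation is at most eps
   eta. *)
have mk := le_integral_abse Q measurableT (g := EFin \o dev) (proj2 (measurable_EFinP _ _) mdev) eps0.
have dev_int : (\int[Q]_w `|(EFin \o dev) w| <= (eps * eta)%:E)%E.
  apply: le_trans EU; apply: ge0_ae_le_integral.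
  - by move=> w; exact: abse_ge0.
  - move=> w; rewrite lee_fin /U.
    have G0 : 0 <= G w by apply: Rintegral_ge0 => // s _; exact: sqr_ge0.
    have A0 : 0 <= A w by apply: Rintegral_ge0 => // s _; exact: sqr_ge0.
    have rr := ltW r0; have ll := ltW lam0; have ss := ltW sigma_gt0.
    by do ?[assumption|exact: sqr_ge0|exact: ler0n|apply: addr_ge0|apply: mulr_ge0|rewrite invr_ge0].
  - by apply: (ae_imp dev_bound) => w; rewrite /= lee_fin.
by have := le_trans mk dev_int; rewrite setTI EFinM lee_pmul2l.
Qed.

Lemma noise_ito_unique I : is_ito_integral Q B (fun t w => H t (Y t w)) I ->
  {ae Q, forall w, I w = noise_integral w}.
Proof.
by move=> HI; apply: (ito_unique _ _ HI noise_ito_integral).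
Qed.

(** Integration by parts of B against the drift leaves sigma (V - mu) B_1 and an anticipating
    integral, both of mean zero, together with - lambda sigma^2 (B_1^2 + 1) / 2. *)
Lemma expected_noise_wealth I : is_ito_integral Q B (fun t w => H t (Y t w)) I ->
  (\int[Q]_w (noise_wealth M sigma H theta I w)%:E = (- (lam * sigma ^+ 2))%:E)%E.
Proof.
move=> HI; have [mrate rate2] := square_rate.
pose N w := \int[leb]_(s in `[0, 1]) (rate0 s w * increment B s 1 w).
rewrite (ae_integral_eq (g := fun w => (sigma * ((V w - mu) * increment B 0 1 w)
    + - (sigma * lam) * N w + - (lam * sigma ^+ 2 / 2) * increment B 0 1 w ^+ 2
    + cst (- (lam * sigma ^+ 2 / 2)) w)%:E)); last first.
  apply: (ae_imp2 (noise_ito_unique HI) (ae_imp2 (bpath_ae HB)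
    (joint_demand sigma_gt0 gamma_gt0 kappa_gt0 theta_solves t11)
    (fun w h1 h2 => conj h1 h2))) => w Iw [Bw Yw].
  have [ir prE] := explicit_primitive M sigma mu gamma kappa_gt0 w.
  have NE : N w = beta 1 w * position0 1 w - \int[leb]_(s in `[0, 1]) (beta s w * rate0 s w).
    rewrite (prE 1 t11) add0r -(RintegralZl _ m01 ir) -RintegralB//; last exact: integrable_EFinZ.
    by apply: eq_Rintegral => s _; rewrite -bpathB; ring.
  rewrite /noise_wealth Iw Yw -(Bw 1) /noise_integral NE /price_star /=.
  rewrite -(bpathB B 0 1) bpath0 subr0.
  have -> : sigma * sig 1 w = position0 1 w + sigma * beta 1 w by rewrite subrK.
  congr (_%:E); move: (\int[leb]_(s in _) _) (position0 1 w) (beta 1 w) (V w) lam => J p b v l.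
  by field.
have kr t : t \in `[0, 1] -> forall D, measurable D -> known Q B V t (rate0 t @^-1` D).
  by move=> t01 D mD; apply: insider_known_joint; exact: explicit_rate_adapted.
have [iN EN] := integral_anticipating HB mV VB mrate kr rate2.
have kV : forall D, measurable D -> known Q B V 0 ((fun w => V w - mu) @^-1` D).
  move=> D mD; apply: insider_known_joint; apply: (full_history_insider (t := 0)) => //.
  apply: (g_sigma_measurable_fun _ mD); apply: measurable_funB => //.
  exact: full_history_V.
have iV : Q.-integrable setT (EFin \o (fun w => V w - mu)).
  have mz : measurable_fun setT (zscore V mu gamma).
    by apply: measurable_funM => //; exact: measurable_funB.
  have iz : Q.-integrable setT (EFin \o zscore V mu gamma).
    by apply: (integrable_sqr (m := Q)) => //; [exact: fin_num_fun_lty|exact: joint_zscore2].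
  have := integrable_EFinZ measurableT gamma iz; apply: eq_integrable => // w _ /=.
  by congr (_%:E); rewrite /zscore mulrC divfK// lt0r_neq0.
have [iVB EVB] := integral_known_increment HB mV VB (lexx 0) ler01 kV iV.
have m2 := increment_moment2 HB mV VB (lexx 0) ler01 (lexx 1); rewrite subr0 in m2.
have i2 : Q.-integrable setT (EFin \o (fun w => increment B 0 1 w ^+ 2)).
  apply: integrable_ge0 => //; [|by move=> w; exact: sqr_ge0|by rewrite m2 ltry].
  by apply: measurable_funX; exact: (measurable_increment HB (lexx 0) ler01 (lexx 1)).
have ic : Q.-integrable setT (EFin \o cst (- (lam * sigma ^+ 2 / 2))).
  exact: finite_measure_integrable_cst.
have Ec : (\int[Q]_w (cst (- (lam * sigma ^+ 2 / 2)) w)%:E = (- (lam * sigma ^+ 2 / 2))%:E)%E.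
  transitivity ((- (lam * sigma ^+ 2 / 2))%:E * 1)%E; last exact: mule1.
  by rewrite -(probability_setT Q); exact: (integral_cst Q measurableT (- (lam * sigma ^+ 2 / 2))%:E).
have iVB' : Q.-integrable setT (EFin \o (fun w => (V w - mu) * increment B 0 1 w)) := iVB.
have iN' : Q.-integrable setT (EFin \o N) := iN.
have j1 := integrable_EFinZ measurableT sigma iVB'.
have j2 := integrable_EFinZ measurableT (- (sigma * lam)) iN'.
have j3 := integrable_EFinZ measurableT (- (lam * sigma ^+ 2 / 2)) i2.
have k1 := integrable_EFinD measurableT j1 j2.
have k2 := integrable_EFinD measurableT k1 j3.
rewrite (integral_EFinD measurableT k2 ic) (integral_EFinD measurableT k1 j3).
rewrite (integral_EFinD measurableT j1 j2) (integral_EFinZ measurableT _ iVB').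
rewrite (integral_EFinZ measurableT _ iN') (integral_EFinZ measurableT _ i2).
rewrite EVB EN m2 Ec !mule0 adde0 add0e -EFinM -EFinD; congr (_%:E).
by move: lam => l; field.
Qed.

End noise_traders.

(** * The affine price and the assembly of the equilibrium *)

Lemma admissible_price_star (R : realType) (lam mu : R) : 0 < lam ->
  admissible_pricing_rule (price_star lam mu).
Proof.
move=> lam0.
have cH (A : set (R * R)) :
    {within A, continuous (fun p : R * R => price_star lam mu p.1 p.2)}.
  apply: continuous_subspaceT => p; apply: cvgD; last exact: cvg_cst.
  by apply: cvgM; [exact: cvg_cst|exact: cvg_snd].
have cc (A : set (R * R)) (k : R) : {within A, continuous (fun p : R * R => k)}.
  by apply: continuous_subspaceT => p; exact: cvg_cst.
split => //; last by move=> t _ x y xy; rewrite /price_star ltrD2r ltr_pM2l.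
exists (fun _ _ => 0), (fun _ _ => lam), (fun _ _ => 0); split => //.
- move=> t x _; rewrite (_ : (fun s => _) = cst 0); first exact: cvg_cst.
  by apply/funext => s; rewrite subrr mul0r.
- move=> t x _.
  have := @is_deriveD R R R (cst lam * id) (cst mu) x 1 _ _
    (@is_deriveM R R (cst lam) id x 1 _ _ (is_derive_cst _ _ _) (is_derive_id _ _))
    (is_derive_cst _ _ _).
  by move/is_derive_eq; apply; rewrite /GRing.scale/= mulr1 mulr0 !addr0.
- by move=> t x _; exact: is_derive_cst.
Qed.

Theorem corollary5p3 (R : realType) (d : measure_display)
    (Omega : measurableType d) (M : kyle_model R Omega)
    (sigma c mu gamma kappa : R)
    (sigma_gt0 : 0 < sigma) (gamma_gt0 : 0 < gamma) (kappa_gt0 : 0 < kappa)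
    (cE : c = kappa * (gamma / sigma))
    (value_normal : forall D : set R, measurable D ->
      prior M D = normal_prob mu gamma D) :
  let L := Lambda kappa in
  let lambda := lambda_star c gamma sigma in
  let chat := c * sigma ^+ 2 in
  let H := price_star lambda mu in
  lambda = L * (gamma / sigma) /\
  (exists theta, solves_theta_star M kappa gamma sigma mu theta) /\
  forall theta, solves_theta_star M kappa gamma sigma mu theta ->
  let Y := demand M sigma theta in
  let FY := market_filtration M sigma theta in
  equilibrium M sigma c H theta /\
  (forall t : R, t \in `[0, 1] ->
    let K := fun w => normal_prob (lambda * Y t w + mu)
                        (Num.sqrt (gamma ^+ 2 * (1 - t * L ^+ 2))) in
    is_cond_law (joint_law M) (FY t) (value M) K /\
    forall w (D : set R), measurable D ->
      K w D = (\int[prior M]_(v in D)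
                 (rho_star kappa gamma lambda mu t (Y t w) v)%:E)%E) /\
  (forall v, {ae cond_law M v, forall w,
    let b := fun s => drift_star kappa gamma sigma mu s (value M w) (Y s w) in
    [/\ Y 0 w = 0,
        lebesgue_measure.-integrable `[0, 1] (EFin \o b)
      & forall t : R, t \in `[0, 1] ->
          Y t w = sigma * noise M t w +
                  \int[lebesgue_measure]_(s in `[0, t]) b s]}) /\
  (forall alpha, trading_rate M theta alpha -> forall v : R,
    expected_wealth M sigma c H theta alpha v =
      (chat / 2 * ln (c / (c + lambda)) + (mu - v) ^+ 2 / (2 * (c + lambda))
       + lambda * sigma ^+ 2 / 2)%:E) /\
  ((exists I, is_ito_integral (joint_law M) (noise M)
                (fun t w => H t (Y t w)) I) /\
   (forall I, is_ito_integral (joint_law M) (noise M)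
                (fun t w => H t (Y t w)) I ->
     (- 'E_(joint_law M)[noise_wealth M sigma H theta I] =
        (lambda * sigma ^+ 2)%:E)%E) /\
   lambda * sigma ^+ 2 = L * gamma * sigma) /\
  (forall Z, is_cond_var (joint_law M) (FY 1) (value M) Z ->
     ('E_(joint_law M)[Z] = (chat * lambda)%:E)%E) /\
  chat * lambda = kappa * L * gamma ^+ 2 /\
  (forall t : R, t \in `[0, 1] ->
     is_cond_var (joint_law M) (FY t) (value M)
       (cst (kappa * L * gamma ^+ 2 + L ^+ 2 * gamma ^+ 2 * (1 - t))) /\
     kappa * L * gamma ^+ 2 + L ^+ 2 * gamma ^+ 2 * (1 - t) =
       gamma ^+ 2 * (1 - t) + t * kappa * L * gamma ^+ 2).
Proof.
rewrite {}cE (lambda_starE kappa gamma_gt0 sigma_gt0) => L lambda chat H.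
have L0 : 0 < L := Lambda_gt0 kappa; have LE : L ^+ 2 + kappa * L = 1 := Lambda_eq kappa.
have lam0 : 0 < lambda by rewrite mulr_gt0// divr_gt0.
have sn0 := lt0r_neq0 sigma_gt0.
have scale1 l : kappa * (gamma / sigma) * sigma ^+ 2 * (l * (gamma / sigma)) =
    kappa * l * gamma ^+ 2 by field.
have scale2 l : l * (gamma / sigma) * sigma ^+ 2 = l * gamma * sigma by field.
have chatE : chat * lambda = kappa * L * gamma ^+ 2 by exact: scale1.
split => //; split.
  by exists (explicit_position M sigma mu gamma kappa); exact: explicit_solves.
move=> theta th Y FY.
(* Substituting 1 = L^2 + kappa L separates the variance that remains at time 1 from the part
   revealed between t and 1. *)
have varE t : gamma ^+ 2 * resid L t = kappa * L * gamma ^+ 2 + L ^+ 2 * gamma ^+ 2 * (1 - t).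
  by rewrite /resid -{1}LE; ring.
have t11 : (1 : R) \in `[0, 1] by rewrite in_itv/= ler01 lexx.
split.
  split.
  - exact: admissible_price_star.
  - by exists (explicit_rate M sigma mu gamma kappa); exact: solution_admissible.
  - by move=> t t01; exact: (market_cond_exp sigma_gt0 gamma_gt0 kappa_gt0 value_normal th).
  - move=> alpha al v; split; first exact: solution_optimal.
    by rewrite solution_wealth// ltry.
split.
  move=> t t01 K; split.
    exact: (market_cond_law sigma_gt0 gamma_gt0 kappa_gt0 value_normal th).
  by move=> w D mD; exact: market_density.
split; first by move=> v; exact: demand_equation.
split.
  move=> alpha al v; rewrite solution_wealth// /control_value.
  by rewrite -[(v - mu) ^+ 2]sqrrN opprB.
split.
  split; first by eexists; exact: (noise_ito_integral sigma_gt0 gamma_gt0 kappa_gt0 value_normal th).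
  split; last exact: scale2.
  move=> I HI; rewrite expectation.unlock.
  by rewrite (expected_noise_wealth sigma_gt0 gamma_gt0 kappa_gt0 value_normal th HI) -EFinN opprK.
split.
  move=> Z HZ; rewrite expectation.unlock.
  rewrite (expected_cond_var sigma_gt0 gamma_gt0 kappa_gt0 value_normal th t11 HZ).
  by rewrite varE subrr mulr0 addr0 chatE.
split => // t t01; split; last first.
  transitivity ((L ^+ 2 + kappa * L) * gamma ^+ 2 * (1 - t) + t * kappa * L * gamma ^+ 2).
    by ring.
  by rewrite LE mul1r.
by rewrite -varE; exact: (market_cond_var sigma_gt0 gamma_gt0 kappa_gt0 value_normal th).
Qed.
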